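(* Let $(E,\|\cdot\|_E)$ be a real Banach space of Rademacher type $p\in(1,2]$, let $p'\in[2,\infty)$ satisfy $\frac1p+\frac1{p'}=1$, and let $q\in[p,\infty)$, $k\in\mathbb{N}$. Let $X\in L_k(\Omega;E)$, let $(X_\ell)_{\ell\in\mathbb{N}}\subset L_{kq}(\Omega;E)$, and for every $\ell\in\mathbb{N}$ define $$\xi_\ell:=\otimes^kX_\ell-\otimes^kX_{\ell-1}\in L_q(\Omega;\otimes^{k,s}_{\varepsilon_s}E),\qquad X_0:=0\in E.$$ For $\ell\in\mathbb{N}$ let $\mathcal{C}_\ell$ denote the cost (number of floating point operations) to generate one sample of $\xi_\ell$. Suppose there exist a sequence $(N_\ell)_{\ell\in\mathbb{N}}$ of positive integers and constants $\alpha,\beta,\gamma,C_\alpha,C_\beta,C_\gamma,C_{\mathsf{stab}}\in(0,\infty)$, $A\in(1,\infty)$ such that $N_\ell\eqsim A^\ell$ for all $\ell\in\mathbb{N}$ and, for all $\ell\in\mathbb{N}$: ($\alpha$) $\|\mathbb{M}^k_\varepsilon[X]-\mathbb{M}^k_\varepsilon[X_\ell]\|_{\varepsilon_s}\le C_\alpha N_\ell^{-\alpha}$; ($\beta$) $\|X_\ell-X_{\ell-1}\|_{L_{kq}(\Omega;E)}\le C_\beta N_\ell^{-\beta}$; ($\gamma$) $\mathcal{C}_\ell\le C_\gamma N_\ell^\gamma$; (stab) $\max\{\|X\|_{L_k(\Omega;E)},\|X_\ell\|_{L_{kq}(\Omega;E)}\}\le C_{\mathsf{stab}}$. For each $\ell\in\mathbb{N}$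 let $(\xi_{\ell,j})_{j\in\mathbb{N}}\subset L_q(\Omega;\otimes^{k,s}_{\varepsilon_s}E)$ be a sequence of independent copies of $\xi_\ell$. Then, for every $\epsilon\in(0,\tfrac12]$, there exist integers $L\in\mathbb{N}$ and $M_1,\ldots,M_L\in\mathbb{N}$ such that the accuracy $$\Bigl\|\mathbb{M}^k_\varepsilon[X]-\sum_{\ell=1}^L\frac1{M_\ell}\sum_{j=1}^{M_\ell}\xi_{\ell,j}\Bigr\|_{L_q(\Omega;\otimes^{k,s}_{\varepsilon_s}E)}<\epsilon$$ is achieved at total computational cost $$\mathcal{C}^{k,\mathsf{ML}}_{q,\varepsilon_s}(X)\le C\cdot\begin{cases}\epsilon^{-\frac\gamma\alpha}+\epsilon^{-p'}&\text{if }\beta p'>\gamma,\\ \epsilon^{-\frac\gamma\alpha}+\epsilon^{-p'}|\log_A\epsilon|^{p'+1}&\text{if }\beta p'=\gamma,\\ \epsilon^{-\frac\gamma\alpha}+\epsilon^{-p'-\frac{\gamma-\beta p'}{\alpha}}&\text{if }\beta p'<\gamma,\end{cases}$$ with a constant $C\in(0,\infty)$ independent of $\epsilon$, which may depend on $\alpha,\beta,\gamma,A,p,q$, on $C_\alpha,C_\beta,C_\gamma,C_{\mathsf{stab}}$, on $k$ and the type constant of $E$, and on the constants implied in $N_\ell\eqsim A^\ell$.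
   Context: $(\Omega,\mathcal{A},\mathbb{P})$ is a complete probability space with expectation $\mathbb{E}$. For a real Banach space $F$ and $q\in[1,\infty)$, $L_q(\Omega;F)$ is the space of (classes of) Bochner measurable $\eta\colon\Omega\to F$ with $\|\eta\|_{L_q(\Omega;F)}:=(\mathbb{E}[\|\eta\|_F^q])^{1/q}<\infty$. $E'$ is the dual of $E$ and $B_{E'}$ its closed unit ball. $N_\ell\eqsim A^\ell$ means: there are constants $0<c_1\le c_2<\infty$ with $c_1A^\ell\le N_\ell\le c_2A^\ell$ for all $\ell\in\mathbb{N}$. The total computational cost $\mathcal{C}^{k,\mathsf{ML}}_{q,\varepsilon_s}(X)$ of the multilevel Monte Carlo estimator $\sum_{\ell=1}^L\frac1{M_\ell}\sum_{j=1}^{M_\ell}\xi_{\ell,j}$ is, up to constant factors, $\sum_{\ell=1}^L\mathcal{C}_\ell M_\ell$. No independence is assumed between samples on different levels $\ell$. Tensor products: $\otimes^kE$ is the $k$-fold algebraic tensor product, $\otimes^k x:=x\otimes\cdots\otimes x$ ($k$ times), and $\otimes^{k,s}E$ is the symmetric $k$-fold algebraic tensor product, i.e. the set of finite sums $U=\sum_{j=1}^M\lambda_j\otimes^kx_j$ with $\lambda_j\in\mathbb{R}$, $x_j\in E$. The injective norm of $U=\sum_{j} x_{j,1}\otimes\cdots\otimes x_{j,k}\in\otimes^kE$ is $\|U\|_\varepsilon:=\sup\{|\sum_j\prod_{n=1}^kf_n(x_{j,n})|: f_1,\ldots,f_k\in B_{E'}\}$; the symmetric injective norm of $U=\sum_j\lambda_j\otimes^kx_j\in\otimes^{k,s}E$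 is $\|U\|_{\varepsilon_s}:=\sup\{|\sum_j\lambda_jf(x_j)^k|: f\in B_{E'}\}$. $\otimes^k_\varepsilon E$ and $\otimes^{k,s}_{\varepsilon_s}E$ are the completions of $\otimes^kE$ and $\otimes^{k,s}E$ in these norms; the two norms are equivalent on symmetric tensors. For $\xi\in L_k(\Omega;E)$ the injective $k$th moment is the Bochner integral $\mathbb{M}^k_\varepsilon[\xi]:=\mathbb{E}[\otimes^k\xi]$ in $\otimes^k_\varepsilon E$; it belongs to $\otimes^{k,s}_{\varepsilon_s}E$. A Rademacher family is a family of independent random variables $r_j$ with values in $\{-1,1\}$, each value having probability $\tfrac12$, on a complete probability space $(\widetilde\Omega,\widetilde{\mathcal A},\widetilde{\mathbb P})$. A real Banach space $F$ has Rademacher type $p\in[1,2]$ if there is $\tau\in(0,\infty)$ with $\|\sum_{j=1}^nr_jx_j\|_{L_p(\widetilde\Omega;F)}\le\tau(\sum_{j=1}^n\|x_j\|_F^p)^{1/p}$ for all Rademacher families, all $n$ and all $x_j\in F$; the smallest such $\tau$ is the type $p$ constant of $F$. *)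

(* Defs.v *)
From mathcomp Require Import all_boot all_order all_algebra.
From mathcomp Require Import all_classical all_reals all_analysis.
Set Implicit Arguments.
Unset Strict Implicit.
Unset Printing Implicit Defensive.
Import Order.TTheory GRing.Theory Num.Theory.
Import numFieldNormedType.Exports.
Local Open Scope classical_set_scope.
Local Open Scope ring_scope.

Section BochnerSpaces.
Context (R : realType) (d : measure_display) (T : measurableType d).
Variable (P : probability T R).
Context (F : completeNormedModType R).

(* A simple function \sum_i 1_(A_i) v_i is represented by the list of the
   pairs (A_i, v_i); the A_i need not be disjoint. *)
Definition simple_data (s : seq (set T * F)) : Prop :=
  forall i, (i < size s)%N -> measurable (nth (set0, 0) s i).1.

Definition simple_eval (s : seq (set T * F)) (w : T) : F :=
  \sum_(a <- s) (\1_(a.1) w : R) *: a.2.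

Definition simple_integral (s : seq (set T * F)) : F :=
  \sum_(a <- s) fine (P a.1) *: a.2.

Definition bochner_measurable (eta : T -> F) : Prop :=
  exists2 s : nat -> seq (set T * F),
    forall n, simple_data (s n) &
    {ae P, forall w, simple_eval (s n) w @[n --> \oo] --> eta w}.

Definition is_bochner_integral (eta : T -> F) (v : F) : Prop :=
  bochner_measurable eta /\
  exists s : nat -> seq (set T * F),
    [/\ forall n, simple_data (s n),
        (\int[P]_w (`|eta w - simple_eval (s n) w|)%:E)%E @[n --> \oo] --> 0%E &
        simple_integral (s n) @[n --> \oo] --> v].

(* Equal to 0 if eta is not Bochner integrable. *)
Definition bochner_integral (eta : T -> F) : F :=
  xget 0 [set v | is_bochner_integral eta v].

Definition Lq_norm (q : R) (eta : T -> F) : \bar R :=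
  Lnorm P q%:E (fun w => (`|eta w|)%:E).

Definition in_Lq (q : R) (eta : T -> F) : Prop :=
  bochner_measurable eta /\ (Lq_norm q eta < +oo)%E.

End BochnerSpaces.

Section Independence.
Context (R : realType) (d : measure_display) (T : measurableType d).
Variable (P : probability T R).
Context (V : topologicalType).

Definition borel : set (set V) := <<s (@open V) >>.

Definition independent_family (I : eqType) (X : I -> T -> V) : Prop :=
  forall (J : seq I) (B : I -> set V), uniq J ->
    (forall i, borel (B i)) ->
    P (\bigcap_(i in [set` J]) X i @^-1` B i) =
    (\prod_(i <- J) P (X i @^-1` B i))%E.

Definition same_distribution (X Y : T -> V) : Prop :=
  forall B : set V, borel B -> P (X @^-1` B) = P (Y @^-1` B).

Definition independent_copies (X : T -> V) (Y : nat -> T -> V) : Prop :=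
  independent_family Y /\ forall j, same_distribution (Y j) X.

End Independence.

Section RademacherType.
Context (R : realType).

Definition rademacher_family (d : measure_display) (T : measurableType d)
    (P : probability T R) (n : nat) (r : 'I_n -> T -> R) : Prop :=
  [/\ forall i, measurable_fun setT (r i),
      forall i w, r i w = 1 \/ r i w = - 1,
      forall i, P (r i @^-1` [set 1]) = (2^-1)%:E /\
                P (r i @^-1` [set - 1]) = (2^-1)%:E &
      independent_family P r].

Definition type_bound (F : completeNormedModType R) (p tau : R) : Prop :=
  forall (d : measure_display) (T : measurableType d) (P : probability T R)
         (n : nat) (r : 'I_n -> T -> R) (x : 'I_n -> F),
    measure_is_complete P -> rademacher_family P r ->
    (Lq_norm P p (fun w => (\sum_(j < n) r j w *: x j)%R) <=
     (tau * (\sum_(j < n) `|x j| `^ p) `^ p^-1)%:E)%E.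

Definition rademacher_type (F : completeNormedModType R) (p : R) : Prop :=
  exists2 tau : R, 0 < tau & type_bound F p tau.

(* The infimum is a minimum unless F = 0, in which case it is 0. *)
Definition type_constant (F : completeNormedModType R) (p : R) : R :=
  inf [set tau : R | 0 < tau /\ type_bound F p tau].

End RademacherType.

Section AlgebraicTensors.
Context (R : realType) (k : nat) (E : lmodType R).

Definition upd (x : 'I_k -> E) (i : 'I_k) (u : E) : 'I_k -> E :=
  fun j => if j == i then u else x j.

Definition multilinear (B : ('I_k -> E) -> R) : Prop :=
  forall (x : 'I_k -> E) (i : 'I_k) (a : R) (u v : E),
    B (upd x i (a *: u + v)) = a * B (upd x i u) + B (upd x i v).

Definition multilinear_form : Type := {B : ('I_k -> E) -> R | multilinear B}.

Definition tensor_functional := multilinear_form -> R^o.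

(* The k-fold algebraic tensor product is realized as the span of the
   elementary tensors inside the linear functionals on k-linear forms, where
   x_1 (x) ... (x) x_k is evaluation at (x_1, ..., x_k). Scalars are absorbed
   into the factors, so sums of elementary tensors form a subspace if k > 0. *)
Definition elementary_tensor (x : 'I_k -> E) : tensor_functional :=
  fun B => sval B x.

Definition tensor_power (x : E) : tensor_functional :=
  elementary_tensor (fun _ => x).

Definition alg_tensor : set tensor_functional :=
  [set U | exists s : seq ('I_k -> E), U = \sum_(x <- s) elementary_tensor x].

Definition sym_alg_tensor : set tensor_functional :=
  [set U | exists s : seq (R * E), U = \sum_(a <- s) a.1 *: tensor_power a.2].

Lemma multilinear_prod (f : 'I_k -> {linear E -> R^o}) :
  multilinear (fun x => \prod_(n < k) (f n (x n) : R)).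
Proof.
move=> x i a u v.
have H w : \prod_(n < k) (f n (upd x i w n) : R) =
    f i w * \prod_(n < k | n != i) f n (x n).
  rewrite (bigD1 i) //= {1}/upd eqxx; congr (_ * _).
  by apply: eq_bigr => j /negPf ji; rewrite /upd ji.
have fE : f i (a *: u + v) = a * f i u + f i v := linearP (f i) a u v.
by rewrite !H fE mulrDl [in RHS]mulrA.
Qed.

(* The k-linear form (x_1, ..., x_k) |-> f_1 (x_1) * ... * f_k (x_k). *)
Definition prod_form (f : 'I_k -> {linear E -> R^o}) : multilinear_form :=
  exist _ _ (multilinear_prod f).

End AlgebraicTensors.

Section InjectiveTensors.
Context (R : realType) (k : nat) (E : completeNormedModType R).

Definition dual_ball : set {linear E -> R^o} :=
  [set f | forall x : E, `|f x| <= `|x|].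

(* For U = \sum_j x_(j,1) (x) ... (x) x_(j,k) the value U (prod_form f) is
   \sum_j \prod_n f_n (x_(j,n)); see injective_normE and sym_injective_normE. *)
Definition injective_norm (U : tensor_functional k E) : R :=
  sup [set r | exists2 f : 'I_k -> {linear E -> R^o},
         forall n, dual_ball (f n) & r = `|U (prod_form f)|].

Definition sym_injective_norm (U : tensor_functional k E) : R :=
  sup [set r | exists2 f : {linear E -> R^o},
         dual_ball f & r = `|U (prod_form (fun _ => f))|].

Lemma injective_normE (s : seq ('I_k -> E)) :
  injective_norm (\sum_(x <- s) elementary_tensor x) =
  sup [set r | exists2 f : 'I_k -> {linear E -> R^o},
         forall n, dual_ball (f n) &
         r = `|\sum_(x <- s) \prod_(n < k) (f n (x n) : R)|].
Proof.
have H f : (\sum_(x <- s) @elementary_tensor R k E x) (prod_form f) =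
    \sum_(x <- s) \prod_(n < k) (f n (x n) : R).
  elim: s => [|x s IH]; first by rewrite !big_nil.
  by rewrite !big_cons -IH.
by congr sup; apply/seteqP; split=> r [f Bf ->]; exists f; rewrite ?H.
Qed.

Lemma sym_injective_normE (s : seq (R * E)) :
  sym_injective_norm (\sum_(a <- s) a.1 *: tensor_power (k := k) a.2) =
  sup [set r | exists2 f : {linear E -> R^o}, dual_ball f &
         r = `|\sum_(a <- s) a.1 * (f a.2 : R) ^+ k|].
Proof.
have H f : (\sum_(a <- s) a.1 *: @tensor_power R k E a.2)
      (prod_form (fun _ => f)) = \sum_(a <- s) a.1 * (f a.2 : R) ^+ k.
  elim: s => [|a s IH]; first by rewrite !big_nil.
  rewrite !big_cons -IH; congr (_ * _ + _).
  by rewrite /tensor_power /elementary_tensor /= prodr_const card_ord.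
by congr sup; apply/seteqP; split=> r [f Bf ->]; exists f; rewrite ?H.
Qed.

End InjectiveTensors.

(* F, with the map iota, is a completion of the linear subspace S of V for the
   norm N; a completion is unique up to a unique isometric isomorphism. *)
Definition is_completion (R : realType) (V : lmodType R) (S : set V)
    (N : V -> R) (F : completeNormedModType R) (iota : V -> F) : Prop :=
  [/\ forall (a : R) (u v : V), S u -> S v ->
        iota (a *: u + v) = a *: iota u + iota v,
      forall u, S u -> `|iota u| = N u &
      closure (iota @` S) = setT].

Definition is_injective_tensor_product (R : realType) (k : nat)
    (E F : completeNormedModType R) (iota : tensor_functional k E -> F) : Prop :=
  is_completion (@alg_tensor R k E) (@injective_norm R k E) iota.

Definition is_sym_injective_tensor_product (R : realType) (k : nat)
    (E F : completeNormedModType R) (iota : tensor_functional k E -> F) : Prop :=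
  is_completion (@sym_alg_tensor R k E) (@sym_injective_norm R k E) iota.

Section Moments.
Context (R : realType) (d : measure_display) (T : measurableType d).
Variable (P : probability T R).
Context (k : nat) (E : completeNormedModType R).
Context (F : completeNormedModType R) (iota : tensor_functional k E -> F).
Context (Fs : completeNormedModType R) (iota_s : tensor_functional k E -> Fs).

Definition injective_moment (xi : T -> E) : F :=
  bochner_integral P (fun w => iota (tensor_power (k := k) (xi w))).

(* The identification of the symmetric completion Fs with a subspace of F: the
   closure of the graph of iota_s U |-> iota U on symmetric tensors U. *)
Definition sym_identified (y : Fs) (z : F) : Prop :=
  exists U : nat -> tensor_functional k E,
    [/\ forall n, sym_alg_tensor (U n),
        iota_s (U n) @[n --> \oo] --> y & iota (U n) @[n --> \oo] --> z].

(* The injective moment viewed as an element of Fs, to which it belongs. *)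
Definition sym_injective_moment (xi : T -> E) : Fs :=
  xget 0 [set y | sym_identified y (injective_moment xi)].

Definition level_difference (X_ : nat -> T -> E) (l : nat) (w : T) : Fs :=
  iota_s (tensor_power (k := k) (X_ l w)) - iota_s (tensor_power (k := k) (X_ l.-1 w)).

End Moments.

Section MultilevelMonteCarlo.
Context (R : realType).

Definition mlmc_estimator (T : Type) (F : lmodType R) (L : nat) (M : nat -> nat)
    (xi : nat -> nat -> T -> F) (w : T) : F :=
  \sum_(1 <= l < L.+1) (M l)%:R^-1 *: \sum_(j < M l) xi l j w.

Definition mlmc_cost (L : nat) (M : nat -> nat) (cost : nat -> R) : R :=
  \sum_(1 <= l < L.+1) cost l * (M l)%:R.

Definition mlmc_rate (alpha beta gamma A p' eps : R) : R :=
  if gamma < beta * p' then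
    eps `^ (- (gamma / alpha)) + eps `^ (- p')
  else if beta * p' == gamma then
    eps `^ (- (gamma / alpha)) +
    eps `^ (- p') * `|ln eps / ln A| `^ (p' + 1)
  else
    eps `^ (- (gamma / alpha)) +
    eps `^ (- p' - (gamma - beta * p') / alpha).

End MultilevelMonteCarlo.

(* Main.v *)
Require Import Defs.
From HB Require Import structures.
From mathcomp Require Import all_boot all_order all_algebra.
From mathcomp Require Import all_classical all_reals all_analysis.
From mathcomp Require Import measurable_realfun ring lra.
Set Implicit Arguments.
Unset Strict Implicit.
Unset Printing Implicit Defensive.
Import Order.TTheory GRing.Theory Num.Theory.
Import numFieldNormedType.Exports.
Local Open Scope classical_set_scope.
Local Open Scope ring_scope.

(* At each level the Monte Carlo error of xi_l = x^(k) - y^(k), x = X_l, y = X_(l-1),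
   is bounded although the tensor product has no type: after symmetrization one faces
   the Rademacher average of sup_f |sum_j +-(f(x_j)^k - f(y_j)^k)| over the dual ball, and
   each summand is Lipschitz in f(x_j - y_j), f(x_j), f(y_j) with constants such that a
   contraction principle replaces it by vectors of E of norm at most a multiple of
   zeta_j = |x_j - y_j| max(|x_j|, |y_j|)^(k-1). Type p of E then bounds the first
   moment, and concentration of Rademacher sums (exponential moments) lifts the bound to
   q-th moments, so that no Kahane inequality is needed.

   The copies xi_(l,j) are only equal in law to tensor differences. They are replaced by
   functions of finitely many Borel cells, represented by values of xi_l at points where
   zeta is at most its average over the cell; all expectations become finite weighted
   sums, and symmetrization is done one sample at a time by convexity.

   The bias is telescoped over the levels, and the sample sizes
   M_l ~ (eps^-1 A^(-(beta+gamma) l/(p'+1)) S)^p', S = sum_l A^(kappa l) with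
   kappa = (gamma - beta p')/(p'+1), give error O(eps) and cost
   O(eps^(-gamma/alpha) + eps^(-p') S^(p'+1)). *)

(** * Rademacher averages and contraction *)

(** The weight [zeta] depends on the pair of values of X_l and X_(l-1), not on the tensor difference
    alone, so equality in law does not carry it over to the copies; picking in each cell one pair
    with at most average [zeta] takes the place of that transport. Concentration around the first
    moment costs the l2-norm of the norms of the summands. Since p <= 2, their lp-norm dominates it,
    so this cost has the order of the mean itself. Nothing relates samples on different levels, so
    the level errors are added by the triangle inequality. Minimizing the sum of A^(gamma l) M_l for
    a given sum of A^(-beta l) M_l^(-1/p') is what produces the power S^(p'+1). The constant C is
    chosen before E and the random variables, so all estimates carry explicit constants in the
    parameters and [tau]. *)

Section RademacherAverages.
Context (R : realType).

Definition symop (V : zmodType) (v : V) (g : V -> R) : V -> R :=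
  fun x => (g (x + v) + g (x - v)) / 2.

(** The mean of [g] at the sum of the entries of [s] with independent random signs, as nested
    two-point averages: no probability space is involved, and an induction over [s] absorbs one sign
    into [g]. *)
Fixpoint ravg (V : zmodType) (s : seq V) (g : V -> R) : R :=
  if s is v :: s' then ravg s' (symop v g) else g 0.

(** The domain [D] is there because some maps averaged later are controlled only on a set stable
    under the steps: symmetric tensors or bounded functions. *)
Lemma le_ravg_in (V : zmodType) (D : V -> Prop) (s : seq V) (g h : V -> R) :
  D 0 -> (forall x v, v \in s -> D x -> D (x + v) /\ D (x - v)) ->
  (forall x, D x -> g x <= h x) -> ravg s g <= ravg s h.
Proof.
move=> D0; elim: s g h => [|v s IH] g h Ds gh /=; first exact: gh.
apply: IH => [x u us|x Dx]; first by apply: Ds; rewrite inE us orbT.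
have [Dp Dm] := Ds x v (mem_head _ _) Dx.
by rewrite /symop ler_pM2r ?invr_gt0// lerD// gh.
Qed.

Lemma eq_ravg_in (V : zmodType) (D : V -> Prop) (s : seq V) (g h : V -> R) :
  D 0 -> (forall x v, v \in s -> D x -> D (x + v) /\ D (x - v)) ->
  (forall x, D x -> g x = h x) -> ravg s g = ravg s h.
Proof.
move=> D0 Ds gh; apply/le_anti/andP; split; apply: (@le_ravg_in _ D) => // x Dx;
by rewrite gh.
Qed.

Lemma le_ravg (V : zmodType) (s : seq V) (g h : V -> R) :
  (forall x, g x <= h x) -> ravg s g <= ravg s h.
Proof. by move=> gh; apply: (@le_ravg_in _ (fun=> True)). Qed.

Lemma eq_ravg (V : zmodType) (s : seq V) (g h : V -> R) :
  g =1 h -> ravg s g = ravg s h.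
Proof. by move=> /funext ->. Qed.

Lemma ravgD (V : zmodType) (s : seq V) (g h : V -> R) :
  ravg s (fun x => g x + h x) = ravg s g + ravg s h.
Proof.
elim: s g h => //= v s IH g h; rewrite -IH; apply: eq_ravg => x.
by rewrite /symop; field.
Qed.

Lemma ravgZ (V : zmodType) (s : seq V) (c : R) (g : V -> R) :
  ravg s (fun x => c * g x) = c * ravg s g.
Proof.
elim: s g => //= v s IH g; rewrite -IH; apply: eq_ravg => x.
by rewrite /symop; field.
Qed.

Lemma ravg_cst (V : zmodType) (s : seq V) (c : R) : ravg s (fun=> c) = c.
Proof.
elim: s => //= v s IH; rewrite -[RHS]IH; apply: eq_ravg => x.
by rewrite /symop; field.
Qed.

Lemma ravg_ge0 (V : zmodType) (s : seq V) (g : V -> R) :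
  (forall x, 0 <= g x) -> 0 <= ravg s g.
Proof. by move=> g0; rewrite -(ravg_cst s 0); exact: le_ravg. Qed.

Lemma ravg_map_in (V W : zmodType) (D : V -> Prop) (f : V -> W) (s : seq V)
    (g : W -> R) :
  f 0 = 0 -> D 0 -> (forall x v, v \in s -> D x -> D (x + v) /\ D (x - v)) ->
  (forall x v, v \in s -> D x -> f (x + v) = f x + f v /\ f (x - v) = f x - f v) ->
  ravg [seq f v | v <- s] g = ravg s (fun x => g (f x)).
Proof.
move=> f0 D0; elim: s g => [|v s IH] g Ds fD /=; first by rewrite f0.
rewrite IH; last 2 first.
- by move=> x u us; apply: Ds; rewrite inE us orbT.
- by move=> x u us; apply: fD; rewrite inE us orbT.
apply: (@eq_ravg_in _ D) => // [x u us|x Dx].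
  by apply: Ds; rewrite inE us orbT.
by have [fp fm] := fD x v (mem_head _ _) Dx; rewrite /symop fp fm.
Qed.

Lemma ravg_opp (V : zmodType) (s : seq V) (g : V -> R) :
  ravg s (fun x => g (- x)) = ravg s g.
Proof.
elim: s g => [|v s IH] g /=; first by rewrite oppr0.
rewrite -[RHS]IH; apply: eq_ravg => x.
by rewrite /symop !opprD opprK addrC.
Qed.

Lemma ravg_sum (V : zmodType) (I : Type) (r : seq I) (s : seq V)
    (c : I -> R) (g : I -> V -> R) :
  ravg s (fun x => \sum_(i <- r) c i * g i x) = \sum_(i <- r) c i * ravg s (g i).
Proof.
elim: r => [|i r IH].
  by under eq_ravg do rewrite big_nil; rewrite ravg_cst big_nil.
by under eq_ravg do rewrite big_cons; rewrite ravgD ravgZ IH big_cons.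
Qed.

(** The factor 2 in the exponent allows an elementary argument: for x <= 1/2 the bound exp(-x) >= 1
    - x inverts to exp(x) <= 1 + x + 2x^2, and for x > 1/2 already x <= 2x^2. *)
Lemma cosh_le_expR2 (x : R) : (expR x + expR (- x)) / 2 <= expR (2 * x ^+ 2).
Proof.
wlog x0 : x / 0 <= x.
  move=> H; have [|/ltW x0] := leP 0 x; first exact: H.
  by have := H (- x); rewrite opprK sqrrN addrC oppr_ge0; apply.
have [x1|x1] := leP x 2^-1; last first.
  have h : expR (- x) <= expR x by rewrite ler_expR; lra.
  have h2 : expR x <= expR (2 * x ^+ 2) by rewrite ler_expR; nra.
  lra.
have bnd (y : R) : y <= 2^-1 -> expR y <= 1 + y + 2 * y ^+ 2.
  move=> y1; have h := expR_ge1Dx (- y).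
  have e : expR (- y) * expR y = 1 by rewrite -expRD addNr expR0.
  have := expR_gt0 y; nra.
have h1 := bnd x x1; have h2 : - x <= 2^-1 by lra.
have := bnd _ h2; have := expR_ge1Dx (2 * x ^+ 2); rewrite sqrrN; lra.
Qed.

(** A martingale argument, one sign at a time: [symop v g] is again 1-Lipschitz, and the deviation
    of [g] from it is a symmetric two-point variable of size at most the norm of [v], with
    exponential moment bounded by [cosh_le_expR2]. *)
Lemma ravg_expR (V : normedModType R) (lam : R) (s : seq V) (g : V -> R) :
  (forall x y, `|g x - g y| <= `|x - y|) ->
  ravg s (fun x => expR (lam * g x)) <=
  expR (lam * ravg s g + 2 * lam ^+ 2 * \sum_(v <- s) `|v| ^+ 2).
Proof.
elim: s g => [|v s IH] g gL /=; first by rewrite big_nil mulr0 addr0.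
rewrite big_cons mulrDr addrCA expRD.
have Sg x y : `|symop v g x - symop v g y| <= `|x - y|.
  rewrite /symop.
  have h1 := gL (x + v) (y + v); have h2 := gL (x - v) (y - v).
  have e1 : x + v - (y + v) = x - y by rewrite opprD addrACA subrr addr0.
  have e2 : x - v - (y - v) = x - y by rewrite opprD addrACA subrr addr0.
  rewrite e1 in h1; rewrite e2 in h2.
  move: h1 h2; rewrite !ler_norml => /andP[? ?] /andP[? ?]; apply/andP; split; lra.
apply: le_trans (ler_wpM2l (expR_ge0 _) (IH _ Sg)).
rewrite -ravgZ; apply: le_ravg => x; rewrite -expRD.
set m := symop v g x; set t := (g (x + v) - g (x - v)) / 2.
have -> : symop v (fun x0 => expR (lam * g x0)) x =
    expR (lam * m) * ((expR (lam * t) + expR (- (lam * t))) / 2).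
  rewrite mulrA mulrDr -!expRD /symop; congr ((expR _ + expR _) / _);
    by rewrite /m /t /symop; field.
rewrite [X in _ <= expR X]addrC expRD; apply: ler_wpM2l; first exact: expR_ge0.
apply: le_trans (cosh_le_expR2 _) _; rewrite ler_expR exprMn mulrA.
apply: ler_wpM2l; first by rewrite mulr_ge0 ?sqr_ge0.
rewrite -[t ^+ 2]real_normK ?num_real//; apply: lerXn2r; rewrite ?nnegrE//.
rewrite /t normrM (ger0_norm (_ : 0 <= 2^-1))// ler_pdivrMr//.
apply: le_trans (gL _ _) _.
have -> : x + v - (x - v) = v + v by rewrite [x + v]addrC opprB addrACA subrr addr0.
by apply: le_trans (ler_normD _ _) _; rewrite mulr_natr mulr2n.
Qed.

End RademacherAverages.

(** * Jensen and superadditivity for real powers *)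

Section PowerInequalities.
Context (R : realType).

Lemma ler_powR_base (r x y : R) : 0 <= r -> 0 <= x -> x <= y -> x `^ r <= y `^ r.
Proof.
move=> r0 x0 xy; apply: ge0_ler_powR => //; rewrite nnegrE //; exact: le_trans xy.
Qed.

(** Young's inequality for t and s^(r-1), with exponents r and r/(r-1), is the tangent line of the
    r-th power at s. *)
Lemma powR_tangent (r s t : R) : 1 <= r -> 0 <= s -> 0 <= t ->
  s `^ r + r * s `^ (r - 1) * (t - s) <= t `^ r.
Proof.
rewrite le_eqVlt => /predU1P[<-|r1] s0 t0.
  by rewrite subrr powRr0 !powRr1// !mul1r addrC subrK.
have [->|sn0] := eqVneq s 0.
  by rewrite !powR0 ?mulr0 ?mul0r ?addr0 ?powR_ge0// ?subr_eq0 gt_eqF//; lra.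
have r0 : r != 0 by rewrite gt_eqF//; lra.
have q0 : 0 < r / (r - 1) by rewrite divr_gt0; lra.
have rm0 : r - 1 != 0 by rewrite subr_eq0 gt_eqF.
have rp0 : 0 < r by lra.
have qE : r^-1 + (r / (r - 1))^-1 = 1 by rewrite invf_div; field.
have := conjugate_powR t0 (powR_ge0 s (r - 1)) rp0 q0 qE.
rewrite -powRrM mulrCA divff ?mulr1; last by rewrite subr_eq0 gt_eqF.
have -> : s `^ r = s * s `^ (r - 1) by rewrite -{2}(powRr1 s0) -powRD; [congr (_ `^ _); ring|rewrite sn0 implybT].
rewrite invf_div => h.
have r00 : 0 < r by lra.
rewrite -(ler_pM2r r00) in h.
set X := s `^ (r - 1) in h *; set Y := t `^ r in h *.
have e : (Y / r + s * X * ((r - 1) / r)) * r = Y + s * X * (r - 1) by field.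
rewrite e in h.
nra.
Qed.

(** Averaging the tangent lines at the weighted mean leaves only their constant term. *)
Lemma powR_jensen (I : Type) (s : seq I) (w t : I -> R) (r : R) : 1 <= r ->
  (forall i, 0 <= w i) -> (forall i, 0 <= t i) -> \sum_(i <- s) w i = 1 ->
  (\sum_(i <- s) w i * t i) `^ r <= \sum_(i <- s) w i * t i `^ r.
Proof.
move=> r1 w0 t0 w1; set m := \sum_(i <- s) w i * t i.
have m0 : 0 <= m by apply: sumr_ge0 => i _; rewrite mulr_ge0.
suff <- : \sum_(i <- s) w i * (m `^ r + r * m `^ (r - 1) * (t i - m)) = m `^ r.
  by apply: ler_sum => i _; apply: ler_wpM2l => //; exact: powR_tangent.
transitivity (\sum_(i <- s) (w i * m `^ r + (r * m `^ (r - 1)) * (w i * t i) - r * m `^ (r - 1) * m * w i)).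
  by apply: eq_bigr => i _; ring.
rewrite sumrB big_split/= -mulr_suml w1 -!mulr_sumr -/m w1; ring.
Qed.

Lemma powR_sum_le (I : Type) (s : seq I) (t : I -> R) (r : R) : 1 <= r ->
  (forall i, 0 <= t i) ->
  (\sum_(i <- s) t i) `^ r <= (size s)%:R `^ (r - 1) * \sum_(i <- s) t i `^ r.
Proof.
move=> r1 t0; have r0 : r != 0 by rewrite gt_eqF//; lra.
case: s => [|i0 s]; first by rewrite !big_nil powR0// mulr0.
set n := (size (i0 :: s))%:R; have n0 : 0 < n by rewrite ltr0n.
have nn : n != 0 by rewrite gt_eqF.
have w1 : \sum_(i <- i0 :: s) n^-1 = 1 :> R.
  by rewrite big_const_seq count_predT iter_addr_0 -mulr_natr mulVf.
have n0' : (0 : R) <= n^-1 by rewrite invr_ge0 ltW.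
have := @powR_jensen _ (i0 :: s) (fun=> n^-1) t r r1 (fun=> n0') t0 w1.
rewrite -!mulr_sumr powRM//; last by rewrite sumr_ge0.
move=> h; rewrite -(ler_pM2l (_ : 0 < n^-1 `^ r)); last by rewrite powR_gt0 ?invr_gt0.
apply: le_trans h _; rewrite mulrA ler_wpM2r ?sumr_ge0// => [? _|]; first exact: powR_ge0.
rewrite -(powR_inv1 (ltW n0)) -powRrM mulN1r -powRD; last by rewrite nn implybT.
by rewrite addrA addNr add0r.
Qed.

(** Superadditivity, from x^r = x x^(r-1) <= x (x+y)^(r-1). *)
Lemma sum_powR_le (I : Type) (s : seq I) (t : I -> R) (r : R) : 1 <= r ->
  (forall i, 0 <= t i) -> \sum_(i <- s) t i `^ r <= (\sum_(i <- s) t i) `^ r.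
Proof.
move=> r1 t0; have r0 : r != 0 by rewrite gt_eqF//; lra.
elim: s => [|i s IH]; first by rewrite !big_nil powR0.
rewrite !big_cons; have S0 : 0 <= \sum_(j <- s) t j by rewrite sumr_ge0.
set S := \sum_(j <- s) t j in IH S0 *.
apply: le_trans (lerD (lexx _) IH) _.
have aux x y : 0 <= x -> 0 <= y -> x * x `^ (r - 1) <= x * (x + y) `^ (r - 1).
  by move=> x0 y0; apply: ler_wpM2l => //; apply: ler_powR_base; lra.
have e x : 0 <= x -> x `^ r = x * x `^ (r - 1).
  move=> x0; have [->|xn] := eqVneq x 0; first by rewrite powR0// mul0r.
  by rewrite -{2}(powRr1 x0) -powRD; [congr (_ `^ _); ring|rewrite xn implybT].
rewrite !e// ?addr_ge0// mulrDl; apply: lerD; first exact: aux.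
by rewrite [t i + S]addrC; apply: aux.
Qed.

End PowerInequalities.

Section RademacherMoments.
Context (R : realType).

Lemma ravg_zero (V : zmodType) (s : seq V) (g : V -> R) :
  (forall v, v \in s -> v = 0) -> ravg s g = g 0.
Proof.
elim: s g => //= v s IH g sz; rewrite IH => [|u us]; last first.
  by apply: sz; rewrite inE us orbT.
by rewrite (sz v) ?mem_head// /symop subr0 addr0; field.
Qed.

(** A 1-Lipschitz [g] has exponential tails around its mean on the scale [a], so a q-th moment only
    adds [q * a] to the mean. Taking [lam] = 1/a in [ravg_expR] bounds the quadratic term of the
    exponent by 2, whence [expR 2]. *)
Lemma ravg_powR (V : normedModType R) (s : seq V) (g : V -> R) (q a : R) :
  (forall x y, `|g x - g y| <= `|x - y|) -> (forall x, 0 <= g x) ->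
  0 < q -> 0 <= a -> \sum_(v <- s) `|v| ^+ 2 <= a ^+ 2 ->
  ravg s (fun x => g x `^ q) <= (1 + expR 2) * (ravg s g + q * a) `^ q.
Proof.
move=> gL g0 q0 + sa; set m := ravg s g.
have m0 : 0 <= m by exact: ravg_ge0.
rewrite le_eqVlt => /predU1P[az|a0].
  (* For a = 0 all vectors vanish and the average is the value of [g] at 0. *)
  have vz (v : V) : v \in s -> v = 0.
    move=> vs; apply/eqP; rewrite -normr_eq0 -sqrf_eq0; apply/eqP/le_anti.
    rewrite sqr_ge0 andbT; apply: le_trans (_ : \sum_(u <- s) `|u| ^+ 2 <= 0).
      by rewrite (big_rem v)//= lerDl sumr_ge0.
    by apply: le_trans sa _; rewrite -az expr0n.
  rewrite /m !ravg_zero// -az mulr0 addr0 ler_peMl ?powR_ge0// lerDl; exact: expR_ge0.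
have an0 : a != 0 by rewrite gt_eqF.
have qn0 : q != 0 by rewrite gt_eqF.
have pt x : g x `^ q <=
    (m + q * a) `^ q * 1 + ((m + q * a) `^ q * expR (- (m / a))) * expR (a^-1 * g x).
  (* The positive deviation in units of [a]. Through 1 + t/q <= exp(t/q) the q-th power costs a
     factor exp(t), which is at most 1 + exp((g x - m)/a). *)
  pose t := Num.max 0 ((g x - m) / a).
  have t0 : 0 <= t by rewrite le_max lexx.
  have gt : g x <= m + t * a.
    have : (g x - m) / a <= t by rewrite le_max lexx orbT.
    by rewrite ler_pdivrMr//; lra.
  have qa : 0 < q * a by rewrite mulr_gt0.
  have h : g x <= (m + q * a) * expR (t / q).
    have h1 := expR_ge1Dx (t / q).
    apply: (@le_trans _ _ ((m + q * a) * (1 + t / q))); last first.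
      by rewrite ler_pM2l//; lra.
    have -> : (m + q * a) * (1 + t / q) = m + t * a + (q * a + m * t / q).
      by field.
    have : 0 <= m * t / q by rewrite divr_ge0 ?mulr_ge0// ltW.
    by lra.
  have mq : 0 <= m + q * a by lra.
  apply: le_trans (ler_powR_base (ltW q0) (g0 x) h) _.
  rewrite powRM ?expR_ge0// -expRM divfK// -mulrA -mulrDr ler_wpM2l ?powR_ge0//.
  rewrite -expRD (_ : - (m / a) + a^-1 * g x = (g x - m) / a); last by field.
  rewrite /t maxEle; case: ifP => _; last by rewrite expR0 lerDl expR_ge0.
  by rewrite lerDr.
apply: le_trans (le_ravg s pt) _.
rewrite ravgD ravgZ ravg_cst ravgZ mulr1.
have /(ler_wpM2l (expR_ge0 (- (m / a)))) := ravg_expR a^-1 s gL.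
rewrite -expRD -/m => h.
have {h} h : expR (- (m / a)) * ravg s (fun x => expR (a^-1 * g x)) <= expR 2.
  apply: le_trans h _; rewrite ler_expR [a^-1 * m]mulrC addrA addNr add0r.
  rewrite exprVn -mulrA -[leRHS]mulr1; apply: ler_wpM2l => //.
  by rewrite mulrC ler_pdivrMr ?exprn_gt0// mul1r.
rewrite mulrDl mul1r lerD2l -mulrA [leRHS]mulrC.
by rewrite ler_wpM2l// powR_ge0.
Qed.

End RademacherMoments.

Section Contraction.
Context (R : realType) (I : Type) (i0 : I).

Definition fsup (A : I -> R^o) : R := sup (range A).

Definition fbounded (A : I -> R^o) : Prop := exists M : R, forall i, `|A i| <= M.

Lemma fbounded0 : fbounded 0.
Proof. by exists 0 => i; rewrite normr0. Qed.

Lemma fboundedD A B : fbounded A -> fbounded B -> fbounded (A + B).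
Proof.
move=> [M MA] [N NB]; exists (M + N) => i.
by apply: le_trans (ler_normD _ _) _; apply: lerD.
Qed.

Lemma fboundedB A B : fbounded A -> fbounded B -> fbounded (A - B).
Proof.
move=> [M MA] [N NB]; exists (M + N) => i.
by apply: le_trans (ler_normB _ _) _; apply: lerD.
Qed.

Lemma le_fsup A i : fbounded A -> A i <= fsup A.
Proof.
move=> [M MA]; apply: ub_le_sup; last by exists i.
by exists M => _ [j _ <-]; apply: le_trans (MA j); exact: ler_norm.
Qed.

Lemma fsup_le A (c : R) : (forall i, A i <= c) -> fsup A <= c.
Proof.
move=> Ac; apply: ge_sup; first by exists (A i0), i0.
by move=> _ [j _ <-].
Qed.

(* The property of [fsup] that drives the contraction principle; it is inherited
   by [symop]-averages, so that coordinates can be treated one after the other. *)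
Definition contractive (Psi : (I -> R^o) -> R) : Prop :=
  forall A phi a b c : I -> R^o,
    [/\ fbounded A, fbounded phi, fbounded a, fbounded b & fbounded c] ->
    (forall i j, `|phi i - phi j| <= `|a i - a j| + `|b i - b j| + `|c i - c j|) ->
    symop phi Psi A <=
    3^-1 * (symop (a *+ 3) Psi A + symop (b *+ 3) Psi A + symop (c *+ 3) Psi A).

(** Twice the left side is a supremum over i, j of A i + A j + phi i - phi j. The sum of the three
    increments is the mean of their triples, and A i + A j + 3|a i - a j| is a value of A + 3a at
    one index plus a value of A - 3a at the other, the sign deciding which index is which. *)
Lemma contractive_fsup : contractive fsup.
Proof.
move=> A phi a b c [bA bphi ba bb bc] H; rewrite /symop.
have b3 v : fbounded v -> fbounded (v *+ 3).
  by move=> bv; rewrite !mulrS mulr0n addr0; do ?apply: fboundedD.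
have mulr3E (v : I -> R^o) i : (v *+ 3) i = 3 * (v i : R) :> R.
  by rewrite !mulrS mulr0n !fctE /= addr0; ring.
have pair v i j : fbounded v -> A i + A j + 3 * `|v i - v j| <=
    fsup (A + v *+ 3) + fsup (A - v *+ 3).
  move=> bv; have p k : A k + 3 * v k <= fsup (A + v *+ 3).
    have := le_fsup k (fboundedD bA (b3 _ bv)); by rewrite -mulr3E.
  have m k : A k - 3 * v k <= fsup (A - v *+ 3).
    have := le_fsup k (fboundedB bA (b3 _ bv)); by rewrite -mulr3E.
  have [vij|vij] := leP 0 (v i - v j).
    by have := p i; have := m j; rewrite (ger0_norm vij); lra.
  by have := p j; have := m i; rewrite (ltr0_norm vij); lra.
set rhs := (X in _ <= X).
suff : fsup (A + phi) <= rhs *+ 2 - fsup (A - phi) by lra.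
apply: fsup_le => i.
suff : fsup (A - phi) <= rhs *+ 2 - (A + phi) i by lra.
apply: fsup_le => j; rewrite !fctE.
have := H i j; have := ler_norm (phi i - phi j).
have := pair a i j ba; have := pair b i j bb; have := pair c i j bc.
rewrite /rhs; lra.
Qed.

(** The operators [symop] commute, so the inequality at [A] is the average of those at [A + v] and
    [A - v]. *)
Lemma contractive_symop Psi v : fbounded v -> contractive Psi -> contractive (symop v Psi).
Proof.
move=> bv cPsi A phi a b c [bA bphi ba bb bc] H.
have C u : symop u (symop v Psi) A = (symop u Psi (A + v) + symop u Psi (A - v)) / 2.
  by rewrite /symop !(addrAC A u) !(addrAC A (- u)); field.
rewrite !C.
have h1 := cPsi (A + v) phi a b c; have h2 := cPsi (A - v) phi a b c.
have {}h1 := h1 (And5 (fboundedD bA bv) bphi ba bb bc) H.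
have {}h2 := h2 (And5 (fboundedB bA bv) bphi ba bb bc) H.
lra.
Qed.

(** Contractivity bounds the average with [phi x] by the mean of three averages in which a tripled
    vector replaces it. One of the three is at least as large as the original, and its vector is
    kept. Hence [s] receives one vector per entry of [l], and [W] has to dominate each of the three
    weights but not their sum. *)
Lemma ravg_contraction (E : zmodType) (X : Type) (ev : E -> I -> R^o)
    (phi : X -> I -> R^o) (a b c : X -> E) (wt : E -> R) (W : X -> R)
    (l : seq X) (Psi : (I -> R^o) -> R) :
  (forall x, ev (x *+ 3) = ev x *+ 3) ->
  contractive Psi -> (forall x, fbounded (ev x)) -> (forall x, fbounded (phi x)) ->
  (forall x i j, `|phi x i - phi x j| <= `|ev (a x) i - ev (a x) j| +
     `|ev (b x) i - ev (b x) j| + `|ev (c x) i - ev (c x) j|) ->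
  (forall x, [/\ wt (a x *+ 3) <= W x, wt (b x *+ 3) <= W x & wt (c x *+ 3) <= W x]) ->
  exists s : seq E, \sum_(v <- s) wt v <= \sum_(x <- l) W x /\
    ravg [seq phi x | x <- l] Psi <= ravg [seq ev v | v <- s] Psi.
Proof.
move=> ev3 + bev bphi H HW; elim: l Psi => [|x l IH] Psi cPsi.
  by exists [::]; rewrite !big_nil.
have key (u : E) : wt (u *+ 3) <= W x ->
    ravg [seq phi x | x <- l] (symop (phi x) Psi) <=
    ravg [seq phi x | x <- l] (symop (ev (u *+ 3)) Psi) ->
  exists s : seq E, \sum_(v <- s) wt v <= \sum_(x <- x :: l) W x /\
    ravg [seq phi x | x <- x :: l] Psi <= ravg [seq ev v | v <- s] Psi.
  move=> wu hu; have [s [ws hs]] := IH _ (contractive_symop (bev (u *+ 3)) cPsi).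
  by exists (u *+ 3 :: s); rewrite !big_cons lerD//; split=> //; exact: le_trans hs.
have [Wa Wb Wc] := HW x.
have h3 : ravg [seq phi x | x <- l] (symop (phi x) Psi) <= 3^-1 *
   (ravg [seq phi x | x <- l] (symop (ev (a x *+ 3)) Psi) +
    ravg [seq phi x | x <- l] (symop (ev (b x *+ 3)) Psi) +
    ravg [seq phi x | x <- l] (symop (ev (c x *+ 3)) Psi)).
  rewrite -!ravgD -ravgZ; apply: (@le_ravg_in _ _ fbounded); first exact: fbounded0.
    elim: l {IH key} => // y l IHl A v; rewrite inE => /predU1P[->|vl]; last exact: IHl.
    by move=> bA; split; [apply: fboundedD|apply: fboundedB].
  by move=> A bA; rewrite !ev3; apply: cPsi.
(* If the first two averages are both smaller than the left side of [h3], the third cannot be. *)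
have [ha|ha] := lerP (ravg [seq phi x | x <- l] (symop (phi x) Psi))
  (ravg [seq phi x | x <- l] (symop (ev (a x *+ 3)) Psi)); first exact: key Wa ha.
have [hb|hb] := lerP (ravg [seq phi x | x <- l] (symop (phi x) Psi))
  (ravg [seq phi x | x <- l] (symop (ev (b x *+ 3)) Psi)); first exact: key Wb hb.
apply: key Wc _; lra.
Qed.

End Contraction.

(** * Symmetrization of sums of samples with finitely many values *)

Section Symmetrization.
Context (R : realType) (V : lmodType R) (n : nat) (w : 'I_n -> R) (v : 'I_n -> V).
Hypothesis w0 : forall i, 0 <= w i.
Hypothesis w1 : \sum_i w i = 1.

Definition wmean : V := \sum_i w i *: v i.

(** The mean of [g] at a sum of [M] independent centered samples, where [v i] is drawn with weight
    [w i]. *)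
Fixpoint cavg (M : nat) (g : V -> R) : R :=
  if M is m.+1 then cavg m (fun x => \sum_i w i * g (x + (v i - wmean))) else g 0.

(** The analogue of [cavg] in which a centered sample becomes [v i *+ 2] with a random sign. *)
Fixpoint savg (M : nat) (g : V -> R) : R :=
  if M is m.+1 then savg m (fun x => \sum_i w i * symop (v i *+ 2) g x) else g 0.

(** Convexity in the two cases that occur, both stable under [symop] and weighted sums. *)
Definition wconvex (g : V -> R) : Prop :=
  (forall y : 'I_n -> V, g (\sum_i w i *: y i) <= \sum_i w i * g (y i)) /\
  (forall x y, g (2^-1 *: (x + y)) <= (g x + g y) / 2).

Lemma le_cavg M g h : (forall x, g x <= h x) -> cavg M g <= cavg M h.
Proof.
elim: M g h => //= M IH g h gh; apply: IH => x.
by apply: ler_sum => i _; apply: ler_wpM2l.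
Qed.

Lemma wconvex_symop u g : wconvex g -> wconvex (symop u g).
Proof.
move=> [g1 g2]; split=> [y|x y].
  have e c : \sum_i w i *: y i + c = \sum_i w i *: (y i + c).
    rewrite [RHS](eq_bigr (fun i => w i *: y i + w i *: c)); last by move=> i _; rewrite scalerDr.
    by rewrite big_split/= -scaler_suml w1 scale1r.
  rewrite /symop !e; have h1 := g1 (fun i => y i + u); have h2 := g1 (fun i => y i - u).
  rewrite [leRHS](eq_bigr (fun i => 2^-1 * (w i * g (y i + u)) + 2^-1 * (w i * g (y i - u)))).
    by rewrite big_split/= -!mulr_sumr; lra.
  by move=> i _; field.
have e c : 2^-1 *: (x + y) + c = 2^-1 *: ((x + c) + (y + c)).
  rewrite [in RHS]addrACA -[c + c]mulr2n [RHS]scalerDr; congr (_ + _).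
  by rewrite -[c *+ 2]scaler_nat scalerA mulVf ?scale1r.
by rewrite /symop !e; have := g2 (x + u) (y + u); have := g2 (x - u) (y - u); lra.
Qed.

Lemma wconvex_sum (c : 'I_n -> V -> R) :
  (forall i, wconvex (c i)) -> wconvex (fun x => \sum_i w i * c i x).
Proof.
move=> hc; split=> [y|x y].
  rewrite [leRHS](eq_bigr (fun j => \sum_i w i * (w j * c i (y j)))); last first.
    by move=> j _; rewrite mulr_sumr; apply: eq_bigr => i _; rewrite mulrCA.
  rewrite exchange_big/=; apply: ler_sum => i _; rewrite -mulr_sumr.
  by apply: ler_wpM2l => //; exact: (hc i).1.
rewrite mulrDl !mulr_suml -big_split/=; apply: ler_sum => i _.
by rewrite -!mulrA -mulrDr; apply: ler_wpM2l => //; rewrite -mulrDl; exact: (hc i).2.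
Qed.

(** For one sample, Jensen replaces [wmean] by an independent copy [v j], and x + v i - v j is the
    midpoint of x + 2 v i and x - 2 v j. Since i and j have the same weights, the two halves
    recombine into [symop] with [v i *+ 2]. *)
Lemma cavg_le_savg M g : wconvex g -> cavg M g <= savg M g.
Proof.
elim: M g => //= M IH g cg; apply: le_trans (IH _ _); last first.
  by apply: wconvex_sum => i; exact: wconvex_symop.
apply: le_cavg => x {IH}.
pose G i j := g (x + (v i - v j)).
have h1 : \sum_i w i * g (x + (v i - wmean)) <= \sum_i w i * \sum_j w j * G i j.
  apply: ler_sum => i _; apply: ler_wpM2l => //; rewrite /G.
  have -> : x + (v i - wmean) = \sum_j w j *: (x + (v i - v j)).
    rewrite [RHS](eq_bigr (fun j => w j *: (x + v i) - w j *: v j)); last first.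
      by move=> j _; rewrite addrA scalerBr.
    by rewrite sumrB -scaler_suml w1 scale1r addrA.
  exact: cg.1.
have h2 : \sum_i w i * \sum_j w j * G i j <=
    \sum_i \sum_j w i * w j * ((g (x + v i *+ 2) + g (x - v j *+ 2)) / 2).
  apply: ler_sum => i _; rewrite mulr_sumr; apply: ler_sum => j _.
  rewrite mulrA; apply: ler_wpM2l; first exact: mulr_ge0.
  apply: le_trans (cg.2 _ _); rewrite le_eqVlt; apply/orP; left; apply/eqP.
  congr g; rewrite addrACA -[x + x]mulr2n -mulrnBl -mulrnDl.
  by rewrite -[(_ + _) *+ 2]scaler_nat scalerA mulVf ?scale1r.
apply: le_trans h1 (le_trans h2 _).
rewrite le_eqVlt; apply/orP; left; apply/eqP.
transitivity (\sum_i \sum_j (w j * (w i * (g (x + v i *+ 2) / 2)) + w i * (w j * (g (x - v j *+ 2) / 2)))).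
  by apply: eq_bigr => i _; apply: eq_bigr => j _; ring.
rewrite (eq_bigr (fun i => w i * (g (x + v i *+ 2) / 2) +
    w i * \sum_j w j * (g (x - v j *+ 2) / 2))); last first.
  by move=> i _; rewrite big_split/= -mulr_suml w1 mul1r -mulr_sumr.
rewrite big_split/= -[X in _ + X]mulr_suml w1 mul1r -big_split/=.
by apply: eq_bigr => i _; rewrite /symop; ring.
Qed.

(** A bound that is additive over the samples can be averaged one sample at a time; [c] collects the
    samples already averaged. *)
Lemma savg_le M g (c : R) (Z : 'I_n -> R) :
  (forall s, size s = M -> ravg [seq v i *+ 2 | i <- s] g <= c + \sum_(i <- s) Z i) ->
  savg M g <= c + M%:R * \sum_i w i * Z i.
Proof.
elim: M c g => [|M IH] c g H /=; first by have := H [::] erefl; rewrite big_nil mul0r.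
rewrite -[M.+1]add1n natrD mulrDl mul1r addrA; apply: IH => s sM.
rewrite ravg_sum; have -> : c + \sum_i w i * Z i + \sum_(i <- s) Z i =
    \sum_i w i * (c + (Z i + \sum_(j <- s) Z j)).
  under [RHS]eq_bigr do rewrite addrCA mulrDr.
  by rewrite big_split/= -mulr_suml w1 mul1r addrAC addrC.
apply: ler_sum => i _; apply: ler_wpM2l => //.
by have := H (i :: s); rewrite /= sM big_cons; apply.
Qed.

End Symmetrization.

(** * Rademacher type *)

Section CubeMeasure.
Context (R : realType).

Definition cube_avg (n : nat) (F : nat -> R) : R := (2 ^+ n)^-1 * \sum_(i < 2 ^ n) F i.

Lemma cube_avgS n F : cube_avg n.+1 F =
  (cube_avg n (fun i => F i.*2.+1) + cube_avg n (fun i => F i.*2)) / 2.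
Proof.
have dbl m : \sum_(i < m.*2) F i = \sum_(i < m) F i.*2.+1 + \sum_(i < m) F i.*2.
  elim: m => [|m IH]; first by rewrite !big_ord0 addr0.
  by rewrite doubleS !big_ord_recr/= IH; ring.
rewrite /cube_avg expnS mul2n dbl exprS.
by field; rewrite expf_neq0.
Qed.

Definition sgn_of_bool (b : bool) : R := if b then 1 else - 1.

(* The digits of a uniform random element of {0, ..., 2 ^ n - 1} form a
   Rademacher family of length n. *)
Definition digit (j i : nat) : bool := odd (iter j half i).

Definition rad (j i : nat) : R := sgn_of_bool (digit j i).

Lemma digit0 (b : bool) i : digit 0 (b + i.*2) = b.
Proof. by rewrite /digit/= oddD odd_double addbF; case: b. Qed.

Lemma digitS j (b : bool) i : digit j.+1 (nat_of_bool b + i.*2) = digit j i.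
Proof. by rewrite /digit iterSr half_bit_double. Qed.

(** The lowest digit factors off and the others are the digits of the half. This product formula is
    the independence of the digits. *)
Lemma cube_avg_prod n (h : 'I_n -> bool -> R) :
  cube_avg n (fun w => \prod_(i < n) h i (digit i w)) =
  \prod_(i < n) ((h i true + h i false) / 2).
Proof.
elim: n h => [|n IH] h.
  by rewrite /cube_avg big_ord_recl !big_ord0 addr0 expr0 invr1 mul1r.
rewrite cube_avgS big_ord_recl -(IH (fun i => h (lift ord0 i))).
have e b : cube_avg n (fun i => \prod_(j < n.+1) h j (digit j (nat_of_bool b + i.*2)%N)) =
   h ord0 b * cube_avg n (fun w => \prod_(i < n) h (lift ord0 i) (digit i w)).
  rewrite /cube_avg [RHS]mulrCA [in RHS]mulr_sumr; congr (_ * _); apply: eq_bigr => i _.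
  rewrite big_ord_recl digit0; congr (_ * _); apply: eq_bigr => j _.
  by rewrite lift0 digitS.
by rewrite [X in (X + _) / _](e true) [X in (_ + X) / _](e false); field.
Qed.

(** Splitting off the lowest digit reproduces [symop] for the first vector. *)
Lemma ravg_cube (V : lmodType R) n (x : 'I_n -> V) (g : V -> R) :
  ravg [seq x i | i <- enum 'I_n] g =
  cube_avg n (fun w => g (\sum_(i < n) rad i w *: x i)).
Proof.
elim: n x g => [|n IH] x g.
  by rewrite enum_ord0 /cube_avg big_ord_recl !big_ord0 addr0 expr0 invr1 mul1r.
rewrite enum_ordSl /= -map_comp IH cube_avgS.
have e b : cube_avg n (fun i => g (\sum_(j < n.+1) rad j (nat_of_bool b + i.*2)%N *: x j)) =
   cube_avg n (fun w => g (\sum_(i < n) rad i w *: x (lift ord0 i) + sgn_of_bool b *: x ord0)).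
  rewrite /cube_avg; congr (_ * _); apply: eq_bigr => i _; congr g.
  rewrite big_ord_recl /rad digit0 addrC; congr (_ + _); apply: eq_bigr => j _.
  by rewrite lift0 digitS.
rewrite [X in (X + _) / _](e true) [X in (_ + X) / _](e false).
rewrite /cube_avg -mulrDr -mulrA; congr (_ * _).
rewrite -big_split mulr_suml; apply: eq_bigr => i _.
by rewrite /symop /sgn_of_bool scale1r scaleN1r.
Qed.

(** A bound on [ravg] is obtained from [type_bound] by applying it to a concrete Rademacher family.
    As a scaled sum of Dirac masses on [nat], this measure inherits its structure and all sets are
    measurable. *)
Definition cube_measure (n : nat) : set nat -> \bar R :=
  mscale ((2 ^+ n)^-1)%:nng (msum (fun i => \d_i) (2 ^ n)).

HB.instance Definition _ n := Measure.on (cube_measure n).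

Lemma cube_measureE n (A : set nat) : cube_measure n A = (cube_avg n (\1_A))%:E.
Proof.
rewrite /cube_measure /mscale /= /msum /cube_avg EFinM; congr (_ * _)%E.
by rewrite -sumEFin.
Qed.

Lemma cube_avg_cst n (c : R) : cube_avg n (fun=> c) = c.
Proof.
rewrite /cube_avg sumr_const card_ord -[c *+ _]mulr_natr natrX mulrC mulfK//.
Qed.

Let cube_measureT n : cube_measure n setT = 1%E.
Proof.
rewrite cube_measureE (_ : \1_setT = fun=> 1) ?cube_avg_cst//.
by apply/funext => i; rewrite indicE in_setT.
Qed.

HB.instance Definition _ n :=
  @Measure_isProbability.Build _ _ R (cube_measure n) (cube_measureT n).

Lemma integral_cube n (F : nat -> R) : (forall i, 0 <= F i) ->
  (\int[cube_measure n]_i (F i)%:E = (cube_avg n F)%:E)%E.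
Proof.
move=> F0; rewrite ge0_integral_mscale//=; last by move=> i _; rewrite lee_fin.
rewrite ge0_integral_measure_sum//; last by move=> i _; rewrite lee_fin.
rewrite /cube_avg EFinM; congr (_ * _)%E.
rewrite -sumEFin; apply: eq_bigr => i _.
by rewrite integral_dirac// diracT mul1e.
Qed.

(** The laws of single digits and their independence are both instances of [cube_avg_prod], with
    factor 1 for the digits not involved. *)
Lemma cube_rademacher n : rademacher_family (cube_measure n) (fun i : 'I_n => rad i).
Proof.
have single (i : 'I_n) (B : set R) : cube_measure n (rad i @^-1` B) =
    ((\1_B (1 : R) + \1_B (-1 : R)) / 2)%:E.
  rewrite cube_measureE; congr EFin.
  pose h (j : 'I_n) b : R := if j == i then \1_B (sgn_of_bool b) else 1.
  transitivity (cube_avg n (fun w => \prod_(j < n) h j (digit j w))).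
    congr cube_avg; apply/funext => w; rewrite (bigD1 i)//= big1; last first.
      by move=> j /negPf ji; rewrite /h ji.
    by rewrite /h eqxx mulr1 !indicE.
  rewrite cube_avg_prod (bigD1 i)//= big1.
    by rewrite /h eqxx mulr1.
  by move=> j /negPf ji; rewrite /h ji; field.
split=> //.
- by move=> i w; rewrite /rad; case: digit; [left|right].
- have n1 : (1 == -1 :> R) = false by apply/eqP => h; lra.
  have n1' : (-1 == 1 :> R) = false by rewrite eq_sym.
  by move=> i; split; apply: etrans (single i _) _; rewrite !indicE !in_set1 ?n1 ?n1' ?eqxx;
    congr EFin; rewrite ?addr0 ?add0r mul1r.
- move=> J B uJ _; apply: (etrans (cube_measureE n _)).
  pose h (j : 'I_n) b : R := if j \in J then \1_(B j) (sgn_of_bool b) else 1.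
  transitivity ((cube_avg n (fun w => \prod_(j < n) h j (digit j w)))%:E).
    congr EFin; congr cube_avg; apply/funext => w.
    transitivity (\prod_(j <- J) (\1_(B j) (rad j w) : R)); last first.
      by rewrite big_uniq// big_mkcond.
    rewrite indicE; elim: {uJ h} J => [|j J IH].
      by rewrite big_nil mem_set.
    rewrite big_cons -IH indicE -natrM mulnb; congr (_%:R); congr nat_of_bool.
    apply/idP/andP; rewrite ?in_setE.
      by move=> H; split; [apply: H; exact: mem_head|move=> i iJ; apply: H => /=; rewrite inE iJ orbT].
    by move=> [Bj H] i /=; rewrite inE => /orP[/eqP->//|]; exact: H.
  rewrite cube_avg_prod (eq_bigr (fun j => ((\1_(B j) (1 : R) + \1_(B j) (-1 : R)) / 2)%:E)); last first.
    by move=> j _; exact: single.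
  rewrite prodEFin; congr EFin.
  rewrite [RHS]big_uniq//.
  rewrite [RHS]big_mkcond.
  apply: eq_bigr => j _; rewrite /h; case: ifP => // _; by field.
Qed.

Lemma cube_complete n : measure_is_complete (cube_measure n).
Proof. by []. Qed.

End CubeMeasure.

Section TypeBound.
Context (R : realType).

Lemma Lq_normE d (T : measurableType d) (P : probability T R)
    (F : completeNormedModType R) (q : R) (f : T -> F) :
  Lq_norm P q f = ((\int[P]_w ((`|f w| `^ q)%:E)) `^ q^-1)%E.
Proof.
rewrite /Lq_norm unlock; congr (_ `^ _)%E; apply: eq_integral => w _.
by rewrite abse_EFin normr_id poweR_EFin.
Qed.

(** The type inequality bounds a p-th moment; Jensen over the points of the cube passes to the
    mean. *)
Lemma type_bound_ravg (F : completeNormedModType R) (p tau : R) (s : seq F) :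
  1 <= p -> 0 <= tau -> type_bound F p tau ->
  ravg s (fun x => `|x|) <= tau * (\sum_(v <- s) `|v| `^ p) `^ p^-1.
Proof.
move=> p1 tau0 tb; pose n := size s; pose t := in_tuple s.
have p0 : p != 0 by rewrite gt_eqF//; lra.
have avgE : ravg s (fun x => `|x|) = cube_avg n (fun w => `|\sum_(j < n) rad R j w *: tnth t j|).
  by rewrite -(ravg_cube (tnth t) (fun x => `|x|)) map_tnth_enum.
have := tb _ _ (cube_measure R n) n (fun i => rad R i) (tnth t) (@cube_complete R n) (@cube_rademacher R n).
rewrite Lq_normE integral_cube; last by move=> i; exact: powR_ge0.
have -> : \sum_(v <- s) `|v| `^ p = \sum_(j < n) `|tnth t j| `^ p by rewrite big_tnth.
rewrite poweR_EFin lee_fin avgE.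
apply: le_trans; set G := fun w => `|_|.
have G0 w : 0 <= G w by exact: normr_ge0.
have c0 : 0 <= (2 ^+ n)^-1 :> R by rewrite invr_ge0 exprn_ge0.
have := @powR_jensen R 'I_(2 ^ n) (index_enum _) (fun=> (2 ^+ n)^-1) (fun i => G i) p p1 (fun=> c0) (fun i => G0 i).
have w1 : \sum_(i < 2 ^ n) (2 ^+ n)^-1 = 1 :> R.
  rewrite -[RHS](cube_avg_cst n 1) /cube_avg mulr_sumr.
  by apply: eq_bigr => i _; rewrite mulr1.
rewrite -!mulr_sumr => /(_ w1).
rewrite -/(cube_avg n G) => /(ler_powR_base (_ : 0 <= p^-1)).
move=> h; apply: le_trans (h _ (powR_ge0 _ _)); last by rewrite invr_ge0; lra.
by rewrite -powRrM divff// powRr1// mulr_ge0// sumr_ge0.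
Qed.

End TypeBound.

(** * Symmetric injective tensors *)

Section PowerDifferences.
Context (R : realType).

Lemma ler_distXn (k : nat) (s t m : R) : `|s| <= m -> `|t| <= m ->
  `|s ^+ k - t ^+ k| <= k%:R * `|s - t| * m ^+ k.-1.
Proof.
move=> sm tm; have m0 : 0 <= m by exact: le_trans sm.
case: k => [|k]; first by rewrite !expr0 subrr normr0 !mul0r.
rewrite subrXX normrM -mulrA mulrCA ler_wpM2l//=.
apply: le_trans (ler_norm_sum _ _ _) _.
apply: (@le_trans _ _ (\sum_(i < k.+1) m ^+ k)); last first.
  by rewrite sumr_const card_ord mulr_natl.
apply: ler_sum => i _; rewrite normrM !normrX.
have -> : m ^+ k = m ^+ (k - i) * m ^+ i by rewrite -exprD subnK// -ltnS.
by rewrite ler_pM ?exprn_ge0// lerXn2r ?nnegrE.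
Qed.

(** The divided difference of the k-th power, written as a polynomial so that s = t is no
    exception. *)
Definition pow_quotient (k : nat) (s t : R) : R :=
  \sum_(i < k) s ^+ (k.-1 - i) * t ^+ i.

Lemma pow_quotient_bound k (s t m : R) : `|s| <= m -> `|t| <= m ->
  `|pow_quotient k s t| <= k%:R * m ^+ k.-1.
Proof.
move=> sm tm; have m0 : 0 <= m by exact: le_trans sm.
apply: le_trans (ler_norm_sum _ _ _) _.
apply: (@le_trans _ _ (\sum_(i < k) m ^+ k.-1)); last first.
  by rewrite sumr_const card_ord mulr_natl.
apply: ler_sum => i _; rewrite normrM !normrX.
have -> : m ^+ k.-1 = m ^+ (k.-1 - i) * m ^+ i.
  by rewrite -exprD subnK//; case: (k) i => [[]|n i]//; rewrite -ltnS.
by rewrite ler_pM ?exprn_ge0// lerXn2r ?nnegrE.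
Qed.

Lemma pow_quotient_lip k (s t s' t' m : R) :
  `|s| <= m -> `|t| <= m -> `|s'| <= m -> `|t'| <= m ->
  `|pow_quotient k s t - pow_quotient k s' t'| <=
  k%:R * k.-1%:R * m ^+ k.-2 * (`|s - s'| + `|t - t'|).
Proof.
move=> sm tm s'm t'm; have m0 : 0 <= m by exact: le_trans sm.
rewrite /pow_quotient -sumrB; apply: le_trans (ler_norm_sum _ _ _) _.
set c := (X in _ <= X).
have -> : c = \sum_(i < k) (k.-1%:R * m ^+ k.-2 * (`|s - s'| + `|t - t'|)).
  by rewrite sumr_const card_ord -[RHS]mulr_natl /c !mulrA.
apply: ler_sum => i _.
have ik : (i <= k.-1)%N by case: (k) i => [[]|n i]//; rewrite -ltnS.
(* For a = 0 the left side vanishes; otherwise the two exponents add up to [k.-2]. *)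
have part (a b : nat) (x : R) : (a + b = k.-1)%N -> 0 <= x ->
    a%:R * x * m ^+ a.-1 * m ^+ b <= k.-1%:R * m ^+ k.-2 * x.
  move=> abk x0; case: a abk => [|a] abk.
    by rewrite !mul0r mulr_ge0// mulr_ge0// exprn_ge0.
  rewrite -mulrA -exprD -abk addSn/= mulrAC ler_wpM2r// ler_wpM2r ?exprn_ge0//.
  by rewrite ler_nat leq_addr.
have -> : s ^+ (k.-1 - i) * t ^+ i - s' ^+ (k.-1 - i) * t' ^+ i =
   (s ^+ (k.-1 - i) - s' ^+ (k.-1 - i)) * t ^+ i +
   s' ^+ (k.-1 - i) * (t ^+ i - t' ^+ i) by ring.
apply: le_trans (ler_normD _ _) _; rewrite [leRHS]mulrDr; apply: lerD.
  apply: le_trans (part (k.-1 - i)%N i _ _ (normr_ge0 _)); last by rewrite subnK.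
  by rewrite normrM ler_pM// ?ler_distXn// normrX lerXn2r ?nnegrE.
apply: le_trans (part i (k.-1 - i)%N _ _ (normr_ge0 _)); last by rewrite subnKC.
by rewrite normrM mulrC ler_pM// ?ler_distXn// normrX lerXn2r ?nnegrE.
Qed.

Lemma powB_factor k (s t : R) : s ^+ k - t ^+ k = (s - t) * pow_quotient k s t.
Proof.
by rewrite subrXX.
Qed.

(** The product rule for (s - t) times the divided difference: the increment of s - t meets the
    bound on the quotient, and the increment of the quotient meets [de], which bounds the other
    factor. This keeps a factor of size |x - y| in every term. *)
Lemma powB_lip k (s t s' t' m de : R) :
  `|s| <= m -> `|t| <= m -> `|s'| <= m -> `|t'| <= m -> `|s' - t'| <= de ->
  `|(s ^+ k - t ^+ k) - (s' ^+ k - t' ^+ k)| <=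
  k%:R * m ^+ k.-1 * `|(s - t) - (s' - t')| +
  de * (k%:R * k.-1%:R * m ^+ k.-2) * `|s - s'| +
  de * (k%:R * k.-1%:R * m ^+ k.-2) * `|t - t'|.
Proof.
move=> sm tm s'm t'm st'; rewrite !powB_factor.
have -> : (s - t) * pow_quotient k s t - (s' - t') * pow_quotient k s' t' =
  pow_quotient k s t * ((s - t) - (s' - t')) +
  (s' - t') * (pow_quotient k s t - pow_quotient k s' t') by ring.
rewrite -[leRHS]addrA -[X in _ <= _ + X]mulrDr; apply: le_trans (ler_normD _ _) _; rewrite !normrM.
apply: lerD; first by rewrite ler_wpM2r// pow_quotient_bound.
by rewrite -mulrA ler_pM// pow_quotient_lip.
Qed.

End PowerDifferences.

Section TensorNorms.
Context (R : realType) (k : nat) (E : completeNormedModType R).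

(** The dual ball as a type, to serve as index set for [fsup]. *)
Definition ball_functional : Type := {f : {linear E -> R^o} | dual_ball f}.

Definition null_functional : {linear E -> R^o} := \0.

Lemma dual_ball_null : dual_ball null_functional.
Proof. by move=> x; rewrite normr0. Qed.

Definition null_ball : ball_functional := exist _ _ dual_ball_null.

Definition ball_eval (x : E) : ball_functional -> R^o := fun f => sval f x.

Lemma ball_eval_le x (f : ball_functional) : `|ball_eval x f| <= `|x|.
Proof. exact: (svalP f). Qed.

Lemma fbounded_ball_eval x : fbounded (ball_eval x).
Proof. by exists `|x| => f; exact: ball_eval_le. Qed.

Lemma ball_evalB x y (f : ball_functional) : ball_eval (x - y) f = ball_eval x f - ball_eval y f.
Proof. exact: linearB. Qed.

Lemma ball_evalD x y : ball_eval (x + y) = ball_eval x + ball_eval y.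
Proof. by apply/funext => f; exact: linearD. Qed.

Lemma ball_evalZ a x (f : ball_functional) : ball_eval (a *: x) f = a * ball_eval x f.
Proof. exact: linearZ. Qed.

(* Replaces the norm of x ^ (k) - y ^ (k) wherever type p is used: the injective
   tensor power itself need not have any nontrivial type. *)
Definition zeta (z : E * E) : R := `|z.1 - z.2| * Num.max `|z.1| `|z.2| ^+ k.-1.

Lemma zeta_ge0 z : 0 <= zeta z.
Proof. by rewrite mulr_ge0// exprn_ge0// le_max normr_ge0. Qed.

Local Notation tens := (tensor_functional k E).

Definition sym_eval (U : tens) : ball_functional -> R^o :=
  fun f => U (prod_form (fun=> sval f)).

Lemma sym_eval_power x (f : ball_functional) :
  sym_eval (tensor_power x) f = (ball_eval x f : R) ^+ k.
Proof. by rewrite /sym_eval/= prodr_const card_ord. Qed.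

Lemma sym_alg0 : @sym_alg_tensor R k E 0.
Proof. by exists [::]; rewrite big_nil. Qed.

Lemma sym_algD U V : @sym_alg_tensor R k E U -> sym_alg_tensor V -> sym_alg_tensor (U + V).
Proof. by move=> [s ->] [t ->]; exists (s ++ t); rewrite big_cat. Qed.

Lemma sym_algZ a U : @sym_alg_tensor R k E U -> sym_alg_tensor (a *: U).
Proof.
move=> [s ->]; exists [seq (a * b.1, b.2) | b <- s].
by rewrite big_map scaler_sumr; apply: eq_bigr => b _; rewrite scalerA.
Qed.

Lemma sym_algB U V : @sym_alg_tensor R k E U -> sym_alg_tensor V -> sym_alg_tensor (U - V).
Proof. by move=> sU sV; rewrite -scaleN1r; apply: sym_algD => //; exact: sym_algZ. Qed.

Lemma sym_alg_power x : @sym_alg_tensor R k E (tensor_power x).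
Proof. by exists [:: (1, x)]; rewrite big_seq1 scale1r. Qed.

(** For k > 0 there is a slot into which the coefficient can be moved. *)
Lemma alg_sym_alg U : (0 < k)%N -> @sym_alg_tensor R k E U -> alg_tensor U.
Proof.
move=> k0 [s ->]; exists [seq upd (fun=> b.2) (Ordinal k0) (b.1 *: b.2) | b <- s].
rewrite big_map; apply: eq_bigr => b _; apply/funext => -[B mB].
rewrite /tensor_power /elementary_tensor/=.
have updE : upd (fun=> b.2) (Ordinal k0) b.2 = (fun=> b.2).
  by apply/funext => j; rewrite /upd; case: ifP.
have h0 : B (upd (fun=> b.2) (Ordinal k0) 0) = 0.
  by have := mB (fun=> b.2) (Ordinal k0) (-1) 0 0; rewrite scaler0 addr0; lra.
have := mB (fun=> b.2) (Ordinal k0) b.1 b.2 0.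
by rewrite addr0 h0 addr0 updE => ->.
Qed.

(** Makes the [sup] in both norms a genuine supremum instead of a default value. *)
Lemma alg_tensor_bounded U : @alg_tensor R k E U -> exists M : R,
  forall f : 'I_k -> {linear E -> R^o}, (forall n, dual_ball (f n)) ->
  `|U (prod_form f)| <= M.
Proof.
move=> [s ->]; exists (\sum_(x <- s) \prod_(n < k) `|x n|) => f Bf.
elim: s => [|x s IH]; first by rewrite !big_nil normr0.
rewrite !big_cons; apply: le_trans (ler_normD _ _) _; apply: lerD => //=.
rewrite normr_prod; apply: ler_prod => n _; rewrite normr_ge0/=; exact: Bf.
Qed.

Lemma sym_norm_le_inj_norm U : @alg_tensor R k E U ->
  sym_injective_norm U <= injective_norm U.
Proof.
move=> /alg_tensor_bounded[M HM]; rewrite /sym_injective_norm.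
apply: ge_sup; first by exists `|U (prod_form (fun=> null_functional))|,
  null_functional => //; exact: dual_ball_null.
move=> _ [f Bf ->]; apply: ub_le_sup; last by exists (fun=> f).
by exists M => _ [g Bg ->]; exact: HM.
Qed.

(** Telescoping over the factors: with one factor split off, f(x)a - f(y)b = f(x-y)a + f(y)(a-b). *)
Lemma inj_norm_power_diff x y :
  injective_norm (@tensor_power R k E x - tensor_power y) <= k%:R * zeta (x, y).
Proof.
rewrite /injective_norm; apply: ge_sup.
  exists `|(@tensor_power R k E x - tensor_power y) (prod_form (fun=> null_functional))|.
  by exists (fun=> null_functional) => // n; exact: dual_ball_null.
move=> _ [f Bf ->].
set m := Num.max `|x| `|y|.
have xm : `|x| <= m by rewrite le_max lexx.
have ym : `|y| <= m by rewrite le_max lexx orbT.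
have m0 : 0 <= m by exact: le_trans xm.
have -> : (@tensor_power R k E x - tensor_power y) (prod_form f) =
   \prod_(n < k) (f n x : R) - \prod_(n < k) (f n y : R) by [].
rewrite /zeta/= -/m mulrA.
elim: k f Bf => [|n IH] f Bf; first by rewrite !big_ord0 subrr normr0 mul0r mul0r.
rewrite !big_ord_recl /=.
set a := \prod_(i < n) _; set b := \prod_(i < n) _.
have -> : f ord0 x * a - f ord0 y * b = (f ord0 (x - y) : R) * a + (f ord0 y : R) * (a - b).
  by have -> : f ord0 (x - y) = f ord0 x - f ord0 y :> R by [exact: linearB]; ring.
apply: le_trans (ler_normD _ _) _; rewrite !normrM.
have am : `|a| <= m ^+ n.
  rewrite normr_prod -[n in m ^+ n]card_ord -prodr_const; apply: ler_prod => i _.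
  by rewrite normr_ge0/=; apply: le_trans xm; exact: Bf.
have abm : `|a - b| <= n%:R * `|x - y| * m ^+ n.-1 by apply: IH => i; exact: Bf.
rewrite -[n.+1]add1n natrD !mulrDl mul1r; apply: lerD.
  by rewrite ler_pM//; exact: Bf.
have := Bf ord0 y; move: (f ord0 y) => /= c cy.
clearbody a b; case: n {IH f Bf am} abm => [|n] abm.
  by rewrite !mul0r in abm *; rewrite (le_trans (ler_wpM2l _ abm))// mulr0.
rewrite [leRHS](_ : _ = m * (n.+1%:R * `|x - y| * m ^+ n)); last by rewrite exprS; ring.
by rewrite ler_pM// (le_trans cy).
Qed.

Section Completion.
Context (Fs : completeNormedModType R) (iota_s : tens -> Fs).
Hypothesis k0 : (0 < k)%N.
Hypothesis HFs : is_sym_injective_tensor_product iota_s.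

Lemma iota_sB U V : sym_alg_tensor U -> sym_alg_tensor V ->
  iota_s (U - V) = iota_s U - iota_s V.
Proof.
have [L _ _] := HFs; move=> sU sV.
by rewrite addrC -scaleN1r L// scaleN1r addrC.
Qed.

Lemma iota_sD U V : sym_alg_tensor U -> sym_alg_tensor V ->
  iota_s (U + V) = iota_s U + iota_s V.
Proof. by have [L _ _] := HFs; move=> sU sV; have := L 1 U V sU sV; rewrite !scale1r. Qed.

Lemma iota_s0 : iota_s 0 = 0.
Proof. by have := iota_sB sym_alg0 sym_alg0; rewrite !subrr. Qed.

Lemma norm_iota_s U : sym_alg_tensor U -> `|iota_s U| = sym_injective_norm U.
Proof. by have [_ H _] := HFs; exact: H. Qed.

Definition power_diff (z : E * E) : Fs :=
  iota_s (tensor_power z.1) - iota_s (tensor_power z.2).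

Lemma norm_power_diff z : `|power_diff z| <= k%:R * zeta z.
Proof.
case: z => x y; rewrite /power_diff -iota_sB; try exact: sym_alg_power.
have S : sym_alg_tensor (@tensor_power R k E x - tensor_power y).
  by apply: sym_algB; exact: sym_alg_power.
rewrite norm_iota_s//; apply: le_trans (inj_norm_power_diff _ _).
by apply: sym_norm_le_inj_norm; exact: alg_sym_alg.
Qed.

Lemma fbounded_sym_eval U : sym_alg_tensor U -> fbounded (sym_eval U).
Proof.
move=> /(alg_sym_alg k0)/alg_tensor_bounded[M HM]; exists M => f; apply: HM => _.
exact: (svalP f).
Qed.

(** The contraction principle concerns suprema without absolute values. As k > 0, the null
    functional makes both one-sided suprema nonnegative, so their sum dominates the absolute
    value. *)
Lemma sym_norm_le_fsup U : sym_alg_tensor U ->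
  sym_injective_norm U <= fsup (sym_eval U) + fsup (sym_eval (- U)).
Proof.
move=> sU; have sNU : sym_alg_tensor (- U) by rewrite -scaleN1r; exact: sym_algZ.
have bU := fbounded_sym_eval sU; have bNU := fbounded_sym_eval sNU.
have ev0 (V : tens) : sym_eval V null_ball = - sym_eval (- V) null_ball by rewrite [RHS]opprK.
have z0 V : sym_alg_tensor V -> sym_eval V null_ball = 0.
  move=> [s ->]; rewrite /sym_eval; elim: s => [|a s IH]; first by rewrite big_nil.
  rewrite big_cons; transitivity (a.1 * (sym_eval (tensor_power a.2) null_ball : R) + 0).
    by rewrite -[X in _ = _ + X]IH.
  by rewrite sym_eval_power /ball_eval /= expr0n gtn_eqF// mulr0 addr0.
have p1 : 0 <= fsup (sym_eval U) by rewrite -(z0 _ sU); exact: le_fsup.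
have p2 : 0 <= fsup (sym_eval (- U)) by rewrite -(z0 _ sNU); exact: le_fsup.
apply: ge_sup; first by exists `|U (prod_form (fun=> null_functional))|,
  null_functional => //; exact: dual_ball_null.
move=> _ [f Bf ->]; pose g : ball_functional := exist _ f Bf.
have h1 := le_fsup g bU; have h2 := le_fsup g bNU.
have {}h2 : - (U (prod_form (fun=> f)) : R) <= fsup (sym_eval (- U)) := h2.
have {}h1 : (U (prod_form (fun=> f)) : R) <= fsup (sym_eval U) := h1.
by rewrite ler_norml; apply/andP; split; lra.
Qed.

(** The factor 2 comes from the two one-sided suprema, 3 from the tripled vectors of the contraction
    principle, and k^2 dominates the Lipschitz constants k and k(k-1) of [powB_lip]. *)
Lemma ravg_power_diff (p tau : R) (l : seq (E * E)) :
  1 <= p -> 0 <= tau -> type_bound E p tau ->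
  ravg [seq power_diff z | z <- l] (fun x => `|x|) <=
  2 * tau * (3 * k%:R ^+ 2) * (\sum_(z <- l) zeta z `^ p) `^ p^-1.
Proof.
move=> p1 tau0 tb.
have pn0 : p != 0 by rewrite gt_eqF//; lra.
pose U (z : E * E) : tens := tensor_power z.1 - tensor_power z.2.
have sU z : sym_alg_tensor (U z) by apply: sym_algB; exact: sym_alg_power.
have stepU (V W : tens) : W \in [seq U z | z <- l] -> sym_alg_tensor V ->
    sym_alg_tensor (V + W) /\ sym_alg_tensor (V - W).
  move=> /mapP[z _ ->] sV; split; [exact: sym_algD|exact: sym_algB].
(* [iota_s] is linear and isometric only on symmetric tensors, which the signed sums never leave. *)
have -> : ravg [seq power_diff z | z <- l] (fun x => `|x|) =
    ravg [seq U z | z <- l] (fun V => `|iota_s V|).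
  have -> : [seq power_diff z | z <- l] = [seq iota_s V | V <- [seq U z | z <- l]].
    rewrite -map_comp; apply: eq_map => z /=.
    by rewrite iota_sB//; exact: sym_alg_power.
  apply: (@ravg_map_in _ _ _ (@sym_alg_tensor R k E)) => //.
  - exact: iota_s0.
  - exact: sym_alg0.
  - move=> V W /mapP[z _ ->] sV; split; [exact: iota_sD|exact: iota_sB].
pose phi (z : E * E) := sym_eval (U z).
have phiE z f : phi z f = (ball_eval z.1 f : R) ^+ k - (ball_eval z.2 f : R) ^+ k.
  by rewrite -!sym_eval_power.
have key : ravg [seq U z | z <- l] (fun V => `|iota_s V|) <=
    2 * ravg [seq phi z | z <- l] (@fsup R ball_functional).
  apply: (@le_trans _ _ (ravg [seq U z | z <- l]
      (fun V => fsup (sym_eval V) + fsup (sym_eval (- V))))).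
    apply: (@le_ravg_in _ _ (@sym_alg_tensor R k E)) => //; first exact: sym_alg0.
    by move=> V sV; rewrite norm_iota_s//; exact: sym_norm_le_fsup.
  rewrite ravgD (ravg_opp _ (fun V => fsup (sym_eval V))) mulr_natl mulr2n.
  have -> : ravg [seq phi z | z <- l] (@fsup R ball_functional) =
      ravg [seq U z | z <- l] (fun V => fsup (sym_eval V)); last by [].
  rewrite (_ : [seq phi z | z <- l] = [seq sym_eval V | V <- [seq U z | z <- l]]).
    by apply: (@ravg_map_in _ _ _ (fun=> True)).
  by rewrite -map_comp.
apply: le_trans key _.
pose mx (z : E * E) := Num.max `|z.1| `|z.2|.
pose de (z : E * E) := `|z.1 - z.2|.
(* The coefficient of the last two terms of [powB_lip]. Multiplied by [mx z] it is at most k^2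
   [zeta z], as shown in [coz]. *)
pose co z := de z * (k%:R * k.-1%:R * mx z ^+ k.-2).
have mx0 z : 0 <= mx z by rewrite le_max normr_ge0.
have co0 z : 0 <= co z by rewrite /co /de !mulr_ge0 ?exprn_ge0.
have ev3 (x : E) : ball_eval (x *+ 3) = ball_eval x *+ 3.
  by rewrite !mulrS !mulr0n !addr0 !ball_evalD.
have le1 z f : `|ball_eval z.1 f| <= mx z.
  by apply: le_trans (ball_eval_le _ _) _; rewrite le_max lexx.
have le2 z f : `|ball_eval z.2 f| <= mx z.
  by apply: le_trans (ball_eval_le _ _) _; rewrite le_max lexx orbT.
have k2 : (k%:R : R) <= k%:R ^+ 2.
  by rewrite expr2 ler_peMl// ler1n.
have kk1 : (k%:R * k.-1%:R : R) <= k%:R ^+ 2.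
  by rewrite expr2 ler_wpM2l// ler_nat leq_pred.
have wtle (c : R) (x : E) (z : E * E) : 0 <= c -> c * `|x| <= k%:R ^+ 2 * zeta z ->
    `|(c *: x : E) *+ 3| `^ p <= (3 * k%:R ^+ 2 * zeta z) `^ p.
  move=> c0 h; apply: ler_powR_base => //; first by lra.
  by rewrite -scaler_nat !normrZ normr_nat (ger0_norm c0) -mulrA ler_wpM2l.
have coz (x : E) z : `|x| <= mx z -> co z * `|x| <= k%:R ^+ 2 * zeta z.
  move=> xm; apply: (@le_trans _ _ (co z * mx z)); first by rewrite ler_wpM2l.
  rewrite /zeta -/(de z) -/(mx z) /co.
  have -> : de z * (k%:R * k.-1%:R * mx z ^+ k.-2) * mx z =
     k%:R * k.-1%:R * (de z * mx z ^+ k.-1).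
    case: k => [|[|n]]; first by rewrite !(mul0r,mulr0).
      by rewrite /= !(mul0r,mulr0).
    by rewrite /= exprS; ring.
  by rewrite ler_wpM2r// /de mulr_ge0 ?exprn_ge0.
have [||||z|s [ws hs]] := @ravg_contraction R _ E (E * E)%type ball_eval phi
    (fun z => (k%:R * mx z ^+ k.-1) *: (z.1 - z.2)) (fun z => co z *: z.1)
    (fun z => co z *: z.2) (fun x => `|x| `^ p)
    (fun z => (3 * k%:R ^+ 2 * zeta z) `^ p) l (@fsup R ball_functional) ev3.
- exact: (contractive_fsup null_ball).
- exact: fbounded_ball_eval.
- by move=> z; exact: fbounded_sym_eval.
- move=> z f g; rewrite !phiE !ball_evalZ -!mulrBr !normrM.
  rewrite !(ger0_norm (exprn_ge0 _ (mx0 z))) !normr_nat (normr_id (z.1 - z.2)).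
  rewrite !ball_evalB; apply: powB_lip; rewrite ?le1 ?le2//.
  by rewrite -ball_evalB; exact: ball_eval_le.
- split; apply: wtle.
  + by rewrite mulr_ge0// exprn_ge0.
  + rewrite /zeta -mulrA [mx z ^+ _ * _]mulrC ler_wpM2r//.
    by rewrite mulr_ge0// exprn_ge0.
  + exact: co0.
  + by apply: coz; rewrite le_max lexx.
  + exact: co0.
  + by apply: coz; rewrite le_max lexx orbT.
rewrite -!mulrA ler_wpM2l//; apply: le_trans hs _.
rewrite (@ravg_map_in _ _ _ (fun=> True))//; last first.
- move=> x v _ _; split; first exact: ball_evalD.
  by apply/funext => f; exact: ball_evalB.
- by apply/funext => f; exact: linear0.
(* The supremum of f(x) over the dual ball is at most the norm of x, which returns the problem to E,
   where type applies. *)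
apply: (@le_trans _ _ (ravg s (fun x => `|x|))).
  apply: le_ravg => x; apply: (fsup_le null_ball) => f.
  by apply: le_trans (ball_eval_le x f); exact: ler_norm.
apply: le_trans (type_bound_ravg s p1 tau0 tb) _; rewrite ler_wpM2l//.
apply: (@le_trans _ _ ((\sum_(z <- l) (3 * k%:R ^+ 2 * zeta z) `^ p) `^ p^-1)).
  apply: ler_powR_base => //; first by rewrite invr_ge0; lra.
  by apply: sumr_ge0 => i _; exact: powR_ge0.
have c0 : 0 <= 3 * k%:R ^+ 2 :> R by rewrite mulr_ge0// exprn_ge0.
rewrite (eq_bigr (fun z => (3 * k%:R ^+ 2) `^ p * zeta z `^ p)); last first.
  by move=> z _; rewrite powRM// zeta_ge0.
rewrite -mulr_sumr powRM ?powR_ge0//; last by apply: sumr_ge0 => *; exact: powR_ge0.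
by rewrite -powRrM divff// powRr1// -!mulrA.
Qed.

(** 2^q comes from the doubled vectors of the symmetrization, 1 + e^2 and q from [ravg_powR], the
    first summand of the base from [ravg_power_diff], and the k next to q from [norm_power_diff]. *)
Definition moment_const (p q tau : R) : R :=
  2 `^ q * (1 + expR 2) * (2 * tau * (3 * k%:R ^+ 2) + q * k%:R) `^ q.

(** The scale in [ravg_powR] can be taken as k times the lp-norm of the [zeta z], because p <= 2. As
    q >= p, Jensen turns the q-th power of this lp-norm into a sum of q-th powers, additive in the
    entries of [l]. *)
Lemma ravg_power_diff_powR (p q tau : R) (l : seq (E * E)) :
  1 <= p -> p <= 2 -> p <= q -> 0 <= tau -> type_bound E p tau ->
  ravg [seq power_diff z *+ 2 | z <- l] (fun x => `|x| `^ q) <=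
  moment_const p q tau * (size l)%:R `^ (q / p - 1) * \sum_(z <- l) zeta z `^ q.
Proof.
move=> p1 p2 pq tau0 tb.
have pn0 : p != 0 by rewrite gt_eqF//; lra.
have q0 : 0 < q by lra.
set S := (\sum_(z <- l) zeta z `^ p) `^ p^-1.
have S0 : 0 <= S by exact: powR_ge0.
have kS : \sum_(v <- [seq power_diff z | z <- l]) `|v| ^+ 2 <= (k%:R * S) ^+ 2.
  have -> : (k%:R * S) ^+ 2 = (\sum_(z <- l) (k%:R * zeta z) `^ p) `^ (2 / p).
    rewrite (eq_bigr (fun z => k%:R `^ p * zeta z `^ p)); last first.
      by move=> z _; rewrite powRM// zeta_ge0.
    rewrite -mulr_sumr powRM ?powR_ge0//; last by apply: sumr_ge0 => *; exact: powR_ge0.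
    rewrite -powRrM [p * (_ / p)]mulrCA divff// mulr1 exprMn powR_mulrn//; congr (_ * _).
    by rewrite -powR_mulrn// /S -powRrM mulrC.
  apply: le_trans (sum_powR_le l (_ : 1 <= 2 / p) _); last by move=> z; exact: powR_ge0.
    rewrite big_map; apply: ler_sum => z _.
    rewrite -powRrM [p * (_ / p)]mulrCA divff// mulr1 powR_mulrn ?mulr_ge0 ?zeta_ge0//.
    by rewrite lerXn2r ?nnegrE ?mulr_ge0 ?zeta_ge0// norm_power_diff.
  by rewrite ler_pdivlMr; lra.
have -> : ravg [seq power_diff z *+ 2 | z <- l] (fun x => `|x| `^ q) =
    2 `^ q * ravg [seq power_diff z | z <- l] (fun x => `|x| `^ q).
  rewrite (map_comp (fun v => v *+ 2) power_diff) (@ravg_map_in _ _ _ (fun=> True))//.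
  - rewrite -ravgZ; apply: eq_ravg => x.
    by rewrite -scaler_nat normrZ normr_nat powRM.
  - by rewrite mul0rn.
  - by move=> x v _ _; rewrite mulrnDl mulrnBl.
rewrite /moment_const -!mulrA ler_wpM2l ?powR_ge0//.
have /= h := @ravg_powR R Fs [seq power_diff z | z <- l] (fun x => `|x|) q (k%:R * S)
  (@ler_dist_dist _ _) (fun x => normr_ge0 x) q0 (mulr_ge0 (ler0n _ _) S0) kS.
apply: le_trans h _; rewrite ler_wpM2l ?addr_ge0 ?expR_ge0//.
set B := 2 * (tau * _) + _.
have B0 : 0 <= B.
  by rewrite addr_ge0 ?mulr_ge0 ?exprn_ge0// ltW.
apply: (@le_trans _ _ ((B * S) `^ q)).
  apply: ler_powR_base; [lra| |].
    by rewrite addr_ge0 ?ravg_ge0// !mulr_ge0// ltW.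
  rewrite /B mulrDl; apply: lerD; last by rewrite mulrA.
  by apply: le_trans (ravg_power_diff l p1 tau0 tb) _; rewrite -!mulrA.
rewrite powRM// ler_wpM2l ?powR_ge0// /S -powRrM mulrC.
have qp1 : 1 <= q / p by rewrite ler_pdivlMr; lra.
apply: le_trans (powR_sum_le l qp1 _) _; first by move=> z; exact: powR_ge0.
rewrite ler_wpM2l ?powR_ge0//; apply: ler_sum => z _.
by rewrite -powRrM [p * (_ / p)]mulrCA divff// mulr1.
Qed.

End Completion.
End TensorNorms.

(** * Bochner measurability and integrals *)

Section BochnerBasics.
Context (R : realType) (d : measure_display) (T : measurableType d).
Variable (P : probability T R).
Hypothesis Pcomplete : measure_is_complete P.

Lemma simple_data_cons (F : completeNormedModType R) (a : set T * F) s :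
  simple_data (a :: s) <-> measurable a.1 /\ simple_data s.
Proof.
split=> [H|[ma ms] [|i] //=]; last by rewrite ltnS; exact: ms.
by split=> [|i ilt]; [exact: (H 0%N)|exact: (H i.+1)].
Qed.

Lemma simple_data_cat (F : completeNormedModType R) (s t : seq (set T * F)) :
  simple_data s -> simple_data t -> simple_data (s ++ t).
Proof.
elim: s => //= a s IH /simple_data_cons[ma ms] mt.
by apply/simple_data_cons; split=> //; exact: IH.
Qed.

Lemma simple_data_map (F G : completeNormedModType R) (f : set T * F -> set T * G)
    (s : seq (set T * F)) :
  (forall a, measurable a.1 -> measurable (f a).1) ->
  simple_data s -> simple_data [seq f a | a <- s].
Proof.
move=> mf; elim: s => //= a s IH /simple_data_cons[ma ms].
by apply/simple_data_cons; split; [exact: mf|exact: IH].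
Qed.

(* Cuts [B] into the pieces on which [u + simple_eval s] is constant, paired
   with its values. *)
Fixpoint atoms (F : completeNormedModType R) (s : seq (set T * F)) (B : set T) (u : F) :
    seq (set T * F) :=
  if s is a :: s' then atoms s' (B `&` a.1) (u + a.2) ++ atoms s' (B `\` a.1) u
  else [:: (B, u)].

Lemma simple_data_atoms (F : completeNormedModType R) (s : seq (set T * F)) B u :
  simple_data s -> measurable B -> simple_data (atoms s B u).
Proof.
elim: s B u => [|a s IH] B u /=; first by move=> _ mB; apply/simple_data_cons; split.
move=> /simple_data_cons[ma ms] mB; apply: simple_data_cat; apply: IH => //.
  exact: measurableI.
exact: measurableD.
Qed.

Lemma simple_eval_cons (F : completeNormedModType R) (a : set T * F) s w :
  simple_eval (a :: s) w = (\1_(a.1) w : R) *: a.2 + simple_eval s w.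
Proof. by rewrite /simple_eval big_cons. Qed.

Lemma simple_eval_cat (F : completeNormedModType R) (s t : seq (set T * F)) w :
  simple_eval (s ++ t) w = simple_eval s w + simple_eval t w.
Proof. by rewrite /simple_eval big_cat. Qed.

Lemma indicI (A B : set T) w : \1_(A `&` B) w = \1_A w * \1_B w :> R.
Proof. by rewrite !indicE in_setI -natrM mulnb. Qed.

(** The sets of a simple function may overlap. On an atom it has a single value, so that [phi] can
    be applied to the value and the atom cut by a condition [C] on it. *)
Lemma simple_eval_atoms (F G : completeNormedModType R) (C : F -> set T) (phi : F -> G)
    (s : seq (set T * F)) B u w :
  simple_eval [seq (a.1 `&` C a.2, phi a.2) | a <- atoms s B u] w =
  (\1_B w * \1_(C (u + simple_eval s w)) w : R) *: phi (u + simple_eval s w).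
Proof.
elim: s B u => [|a s IH] B u.
  by rewrite /simple_eval /= !big_seq1 big_nil addr0 indicI.
rewrite /= map_cat simple_eval_cat !IH simple_eval_cons setDE !indicI.
have [aw|aw] := boolP (w \in a.1).
  rewrite !indicE in_setC aw /= !mulr0 !mul0r scale0r addr0 mulr1 scale1r.
  by rewrite addrA.
by rewrite !indicE in_setC (negbTE aw) /= mulr0 mul0r !scale0r !add0r mulr1.
Qed.

Lemma measurable_simple_preimage (F : completeNormedModType R) (s : seq (set T * F))
    (A : set F) : simple_data s -> measurable (simple_eval s @^-1` A).
Proof.
move=> ms; suff : forall u, measurable [set w | A (u + simple_eval s w)].
  by move=> /(_ 0); under eq_set do rewrite add0r.
elim: s ms => [|a s IH] ms u.
  have [Au|Au] := pselect (A u).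
    rewrite (_ : [set w | _] = setT)//; apply/seteqP; split=> w //= _.
    by rewrite /simple_eval big_nil addr0.
  rewrite (_ : [set w | _] = set0)//; apply/seteqP; split=> w //=.
  by rewrite /simple_eval big_nil addr0.
move/simple_data_cons: ms => [ma ms].
rewrite (_ : [set w | _] = (a.1 `&` [set w | A ((u + a.2) + simple_eval s w)]) `|`
   (~` a.1 `&` [set w | A (u + simple_eval s w)])).
  by apply: measurableU; apply: measurableI;
    [|exact: IH|exact: measurableC|exact: IH].
apply/seteqP; split=> w /=; rewrite simple_eval_cons.
  have [aw|aw] := pselect (a.1 w).
    by rewrite indicE mem_set// scale1r addrA; left.
  by rewrite indicE memNset// scale0r add0r; right.
case=> -[aw]; first by rewrite indicE mem_set// scale1r addrA.
by rewrite indicE memNset// scale0r add0r.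
Qed.

(** Bochner measurability is an almost everywhere limit, so completeness is what makes preimages
    measurable. *)
Lemma measurable_ae (A B : set T) : measurable B ->
  {ae P, forall w, A w <-> B w} -> measurable A.
Proof.
move=> mB [N [mN N0 sN]].
have -> : A = (B `\` N) `|` (A `&` N).
  apply/seteqP; split=> w.
    move=> Aw; have [Nw|Nw] := pselect (N w); [by right|left; split=> //].
    have /contrapT[AB _] : ~ ~ (A w <-> B w) by move=> h; apply: Nw; exact: sN.
    exact: AB.
  case=> [[Bw Nw]|[]//].
  have /contrapT[_ BA] : ~ ~ (A w <-> B w) by move=> h; apply: Nw; exact: sN.
  exact: BA.
apply: measurableU; first exact: measurableD.
by apply: Pcomplete; exists N; split=> // w [].
Qed.

(** The limit lies in an open U exactly when, for some m, the balls of radius 1/(m+1) around almost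
    all terms of the sequence lie in U; [V m] collects the centers of such balls. *)
Lemma bochner_preimage_open (F : completeNormedModType R) (f : T -> F) (U : set F) :
  bochner_measurable P f -> open U -> measurable (f @^-1` U).
Proof.
move=> [s ms cvs] oU.
pose V (m : nat) : set F := [set x | ball x m.+1%:R^-1 `<=` U].
have mV : measurable (\bigcup_m \bigcup_N \bigcap_(n in [set n | (N <= n)%N])
    simple_eval (s n) @^-1` (V m)).
  apply: bigcup_measurable => m _; apply: bigcup_measurable => N _.
  apply: bigcap_measurable => [|n _]; first by exists N => /=.
  exact: measurable_simple_preimage.
apply: measurable_ae mV _; apply: filterS cvs => w cvw; split.
  move=> Uw; have /nbhs_ballP[e /= e0 eU] : nbhs (f w) U by exact: open_nbhs_nbhs.
  have [m me] : exists m : nat, m.+1%:R^-1 + m.+1%:R^-1 <= e :> R.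
    have /= := near_infty_natSinv_lt (PosNum (divr_gt0 e0 (ltr0n _ 2))).
    move=> [N _ /(_ N (leqnn N))/= h]; exists N.
    by rewrite [e]splitr; apply: lerD; exact: ltW h.
  have m0 : (0 : R) < m.+1%:R^-1 by rewrite invr_gt0.
  move/cvgrPdist_lt: cvw => /(_ _ m0)[N _ HN].
  exists m => //; exists N => // n /= Nn y /= yb; apply: eU => /=.
  rewrite -ball_normE/=; move: yb; rewrite -ball_normE/= => yb.
  have := HN n Nn => /= h; apply: lt_le_trans me.
  rewrite -(subrKA (simple_eval (s n) w)); apply: le_lt_trans (ler_normD _ _) _.
  exact: ltrD.
move=> [m _ [N _ HN]].
have m0 : (0 : R) < m.+1%:R^-1 by rewrite invr_gt0.
move/cvgrPdist_lt: cvw => /(_ _ m0)[N' _ HN'].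
have /= := HN (maxn N N') (leq_maxl _ _); apply; rewrite -ball_normE/=.
by rewrite distrC; exact: (HN' (maxn N N') (leq_maxr _ _)).
Qed.

Lemma bochner_comb (F : completeNormedModType R) (c : R) (f g : T -> F) :
  bochner_measurable P f -> bochner_measurable P g ->
  bochner_measurable P (fun w => c *: f w + g w).
Proof.
move=> [s ms cvs] [t mt cvt].
exists (fun n => [seq (a.1, c *: a.2) | a <- s n] ++ t n).
  by move=> n; apply: simple_data_cat => //; exact: simple_data_map.
apply: filterS2 cvs cvt => w fw gw.
have -> : (fun n => simple_eval ([seq (a.1, c *: a.2) | a <- s n] ++ t n) w) =
    (fun n => c *: simple_eval (s n) w + simple_eval (t n) w).
  apply/funext => n; rewrite simple_eval_cat; congr (_ + _).
  rewrite /simple_eval big_map scaler_sumr; apply: eq_bigr => a _ /=.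
  by rewrite !scalerA mulrC.
by apply: cvgD => //; exact: cvgZr.
Qed.

Lemma bochner_cst (F : completeNormedModType R) (c : F) : bochner_measurable P (fun=> c).
Proof.
exists (fun=> [:: (setT, c)]); first by move=> n; apply/simple_data_cons; split=> //=; exact: measurableT.
apply: aeW => w; rewrite (_ : (fun n => _) = (fun=> c)); first exact: cvg_cst.
by apply/funext => n; rewrite /simple_eval big_seq1 indicE in_setT scale1r.
Qed.

Lemma bochner_simple (F : completeNormedModType R) s :
  simple_data s -> bochner_measurable P (simple_eval s : T -> F).
Proof. by move=> ms; exists (fun=> s) => //; apply: aeW => w; exact: cvg_cst. Qed.

Lemma bochnerB (F : completeNormedModType R) (f g : T -> F) :
  bochner_measurable P f -> bochner_measurable P g ->
  bochner_measurable P (fun w => f w - g w).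
Proof.
move=> mf mg; rewrite (_ : (fun w => _) = (fun w => (-1) *: g w + f w)).
  exact: bochner_comb.
by apply/funext => w; rewrite scaleN1r addrC.
Qed.

Lemma bochnerD (F : completeNormedModType R) (f g : T -> F) :
  bochner_measurable P f -> bochner_measurable P g ->
  bochner_measurable P (fun w => f w + g w).
Proof.
move=> mf mg; rewrite (_ : (fun w => _) = (fun w => 1 *: f w + g w)).
  exact: bochner_comb.
by apply/funext => w; rewrite scale1r.
Qed.

Lemma bochnerZ (F : completeNormedModType R) (c : R) (f : T -> F) :
  bochner_measurable P f -> bochner_measurable P (fun w => c *: f w).
Proof.
move=> mf; rewrite (_ : (fun w => _) = (fun w => c *: f w + 0)).
  by apply: bochner_comb => //; exact: bochner_cst.
by apply/funext => w; rewrite addr0.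
Qed.

Lemma bochner_sum (F : completeNormedModType R) (I : Type) (r : seq I) (f : I -> T -> F) :
  (forall i, bochner_measurable P (f i)) ->
  bochner_measurable P (fun w => \sum_(i <- r) f i w).
Proof.
move=> mf; elim: r => [|i r IH].
  by under eq_fun do rewrite big_nil; exact: bochner_cst.
by under eq_fun do rewrite big_cons; exact: bochnerD.
Qed.

Lemma measurable_bochner_norm (F : completeNormedModType R) (f : T -> F) :
  bochner_measurable P f -> measurable_fun setT (fun w => `|f w|).
Proof.
move=> mf _; apply: (measurability _ (RGenOInfty.measurableE R)) => //.
move=> /= _ [_ [a ->] <-]; rewrite setTI.
have -> : (fun w => `|f w|) @^-1` `]a, +oo[ = f @^-1` [set x | a < `|x|].
  by apply/seteqP; split=> w /=; rewrite in_itv/= andbT.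
apply: bochner_preimage_open => //.
have -> : [set x : F | a < `|x|] = (fun x : F => `|x|) @^-1` [set y | a < y] by [].
by apply: open_comp; [move=> x _; exact: norm_continuous|exact: open_gt].
Qed.

Lemma measurable_bochner_powR (F : completeNormedModType R) (f : T -> F) (q : R) :
  bochner_measurable P f -> measurable_fun setT (fun w => (`|f w| `^ q)%:E).
Proof.
move=> mf; apply/measurable_EFinP.
exact: measurableT_comp (measurable_powR q) (measurable_bochner_norm mf).
Qed.

Lemma measurable_bochner_EFin (F : completeNormedModType R) (f : T -> F) :
  bochner_measurable P f -> measurable_fun setT (fun w => (`|f w|)%:E).
Proof. by move=> mf; apply/measurable_EFinP; exact: measurable_bochner_norm. Qed.

(** An approximation is kept only where its norm is at most twice that of [X], which provides a
    dominating function. Convergence survives: where the norm is larger, 0 is at least as close to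
    [X]. The second clause allows one sequence to be composed with several maps [phi]. *)
Lemma bochner_approx (E : completeNormedModType R) (X : T -> E) :
  bochner_measurable P X ->
  exists (at_ : nat -> seq (set T * E)) (x : nat -> T -> E),
  [/\ forall n, simple_data (at_ n),
      forall (G : completeNormedModType R) (phi : E -> G), phi 0 = 0 ->
        forall n w, simple_eval [seq (a.1, phi a.2) | a <- at_ n] w = phi (x n w),
      {ae P, forall w, x n w @[n --> \oo] --> X w} &
      forall n w, `|x n w| <= 2 * `|X w|].
Proof.
move=> mX; have [s ms cvs] := mX.
pose C (u : E) : set T := [set w | `|u| <= 2 * `|X w|].
have mC u : measurable (C u).
  have -> : C u = (fun w => `|X w|) @^-1` `[`|u| / 2, +oo[.
    apply/seteqP; split=> w; rewrite /C/= in_itv/= andbT ler_pdivrMr// mulrC//.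
  rewrite -[X in measurable X]setTI; exact: measurable_bochner_norm.
pose x n w := (\1_(C (simple_eval (s n) w)) w : R) *: simple_eval (s n) w.
exists (fun n => [seq (a.1 `&` C a.2, a.2) | a <- atoms (s n) setT 0]), x; split.
- move=> n; apply: (@simple_data_map _ _ (fun a => (a.1 `&` C a.2, a.2))).
    by move=> a ma; exact: measurableI.
  exact: simple_data_atoms.
- move=> G phi phi0 n w; rewrite -map_comp.
  rewrite (@simple_eval_atoms _ _ C phi) add0r indicE in_setT mul1r.
  rewrite /x indicE; case: (w \in C _); first by rewrite !scale1r.
  by rewrite !scale0r phi0.
- apply: filterS cvs => w cvw; apply/cvgrPdist_lt => e e0.
  move/cvgrPdist_lt: cvw => /(_ _ e0); apply: filterS => n /=.
  apply: le_lt_trans; rewrite /x indicE.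
  have [cw|/negP cw] := boolP (w \in C _); first by rewrite scale1r.
  rewrite scale0r subr0; have {}cw : ~ C (simple_eval (s n) w) w.
    by move=> h; apply: cw; rewrite inE.
  have {}cw : 2 * `|X w| < `|simple_eval (s n) w| by rewrite ltNge; exact/negP.
  have := ler_distD 0 (simple_eval (s n) w) (X w).
  have := lerB_dist (simple_eval (s n) w) (X w); rewrite distrC; lra.
- move=> n w; rewrite /x indicE; have [cw|_] := boolP (w \in C _).
    by rewrite scale1r; move: cw; rewrite inE.
  by rewrite scale0r normr0 mulr_ge0.
Qed.

End BochnerBasics.

Lemma ecvg0_lt (R : realType) (u : nat -> \bar R) (e : R) :
  (forall n, 0 <= u n)%E -> u n @[n --> \oo] --> 0%E -> 0 < e ->
  \forall n \near \oo, (u n < e%:E)%E.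
Proof.
move=> u0 /fine_cvgP[fu uu] e0; move: uu => /cvgr_dist_lt/(_ _ e0) uu; near=> n.
have fi : u n \is a fin_num by near: n.
rewrite -(fineK fi) lte_fin; have : `|0 - fine (u n)| < e by near: n.
by rewrite sub0r normrN ger0_norm// fine_ge0.
Unshelve. all: by end_near. Qed.

Section LqNorms.
Context (R : realType) (d : measure_display) (T : measurableType d).
Variable (P : probability T R).
Hypothesis Pcomplete : measure_is_complete P.

Lemma ge0_integral_le (f g : T -> R) :
  measurable_fun setT f -> measurable_fun setT g ->
  (forall w, 0 <= f w <= g w) ->
  (\int[P]_w (f w)%:E <= \int[P]_w (g w)%:E)%E.
Proof.
move=> mf mg fg; apply: ge0_le_integral => //.
- by move=> w _; rewrite lee_fin; case/andP: (fg w).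
- exact/measurable_EFinP.
- exact/measurable_EFinP.
- by move=> w _; rewrite lee_fin; case/andP: (fg w).
Qed.

Lemma Lq_norm_leP (F : completeNormedModType R) (q c : R) (f : T -> F) :
  0 < q -> 0 <= c ->
  (Lq_norm P q f <= c%:E)%E <-> (\int[P]_w (`|f w| `^ q)%:E <= (c `^ q)%:E)%E.
Proof.
move=> q0 c0; have qn0 : q != 0 by rewrite gt_eqF.
rewrite Lq_normE; have : (0 <= \int[P]_w (`|f w| `^ q)%:E)%E.
  by apply: integral_ge0 => w _; rewrite lee_fin powR_ge0.
case: (\int[P]_w _)%E => [r| |]//; last by rewrite poweRyr ?invr_neq0.
rewrite lee_fin => r0; rewrite poweR_EFin !lee_fin; split=> h.
  have := ler_powR_base (ltW q0) (powR_ge0 _ _) h.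
  by rewrite -powRrM mulVf// powRr1.
have qi : 0 <= q^-1 by rewrite invr_ge0 ltW.
by have := ler_powR_base qi r0 h; rewrite -powRrM divff// powRr1.
Qed.

Lemma Lq_norm_ltyP (F : completeNormedModType R) (q : R) (f : T -> F) : 0 < q ->
  (Lq_norm P q f < +oo)%E -> (\int[P]_w (`|f w| `^ q)%:E < +oo)%E.
Proof.
move=> q0; have qn0 : q != 0 by rewrite gt_eqF.
rewrite Lq_normE; have : (0 <= \int[P]_w (`|f w| `^ q)%:E)%E.
  by apply: integral_ge0 => w _; rewrite lee_fin powR_ge0.
case: (\int[P]_w _)%E => [r| |]//; last by rewrite poweRyr ?invr_neq0.
by move=> _ _; exact: ltry.
Qed.

Lemma Lq_norm_leD (F : completeNormedModType R) (q a b : R) (f g : T -> F) :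
  1 <= q -> bochner_measurable P f -> bochner_measurable P g ->
  (Lq_norm P q f <= a%:E -> Lq_norm P q g <= b%:E ->
   Lq_norm P q (fun w => (f w + g w)%R) <= (a + b)%R%:E)%E.
Proof.
move=> q1 mf mg fa gb.
have mnf := measurable_bochner_norm Pcomplete mf.
have mng := measurable_bochner_norm Pcomplete mg.
apply: (@le_trans _ _ (Lq_norm P q f + Lq_norm P q g)%E); last by rewrite EFinD leeD.
apply: le_trans (minkowski_EFin P mnf mng q1).
rewrite /Lq_norm unlock; apply: gt0_ler_poweR.
- by rewrite invr_ge0; lra.
- by rewrite in_itv/= leey andbT integral_ge0// => w _; exact: poweR_ge0.
- by rewrite in_itv/= leey andbT integral_ge0// => w _; exact: poweR_ge0.
have mE (h : T -> R) : measurable_fun setT h ->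
    measurable_fun setT (fun w => (`|(h w)%:E| `^ q)%E).
  move=> mh; apply: (@measurableT_comp _ _ _ _ _ _ (fun x => (x `^ q)%E)).
    exact: measurable_poweR.
  by apply: measurableT_comp => //; exact/measurable_EFinP.
apply: ge0_le_integral => //.
- by move=> w _; exact: poweR_ge0.
- apply: (mE (fun w => `|f w + g w|)).
  by apply: (measurable_bochner_norm Pcomplete (f := fun w => f w + g w)); exact: bochnerD.
- by apply: (mE (fun w => `|f w| + `|g w|)); exact: measurable_funD.
move=> w _; rewrite !abse_EFin !poweR_EFin lee_fin; apply: ler_powR_base; first lra.
  by [].
by rewrite normr_id [leRHS]ger0_norm ?addr_ge0// ler_normD.
Qed.

Lemma Lq_norm_leZ (F : completeNormedModType R) (q a c : R) (f : T -> F) :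
  0 < q -> 0 <= a -> bochner_measurable P f ->
  (Lq_norm P q f <= a%:E -> Lq_norm P q (fun w => (c *: f w)%R) <= (`|c|%R * a)%:E)%E.
Proof.
move=> q0 a0 mf /(Lq_norm_leP _ q0 a0) fa; apply/Lq_norm_leP => //.
  by rewrite mulr_ge0.
rewrite powRM//; under eq_integral do rewrite normrZ powRM// EFinM.
rewrite (ge0_integralZl_EFin P measurableT _ _ (powR_ge0 _ _)).
- by rewrite [X in (_ <= X)%E]EFinM; rewrite lee_wpmul2l// lee_fin powR_ge0.
- by move=> w _; rewrite lee_fin powR_ge0.
- exact: (measurable_bochner_powR Pcomplete).
Qed.

Lemma Lq_norm_cst (F : completeNormedModType R) (q : R) (v : F) : 0 < q ->
  (Lq_norm P q (fun=> v) <= (`|v|%R)%:E)%E.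
Proof.
move=> q0; apply/Lq_norm_leP => //.
by rewrite integral_cst// [X in (_ * X)%E](@probability_setT _ _ _ P) mule1.
Qed.

Lemma Lq_norm_le_sum (F : completeNormedModType R) (q : R) (I : Type) (r : seq I)
    (a : I -> R) (f : I -> T -> F) :
  1 <= q -> (forall i, bochner_measurable P (f i)) ->
  (forall i, Lq_norm P q (f i) <= (a i)%:E)%E ->
  (Lq_norm P q (fun w => (\sum_(i <- r) f i w)%R) <= (\sum_(i <- r) a i)%R%:E)%E.
Proof.
move=> q1 mf fa; have q0 : 0 < q by lra.
elim: r => [|i r IH].
  under eq_fun do rewrite big_nil; rewrite big_nil.
  by apply: le_trans (Lq_norm_cst _ q0) _; rewrite normr0.
under eq_fun do rewrite big_cons; rewrite big_cons.
by apply: Lq_norm_leD => //; exact: bochner_sum.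
Qed.

Lemma powR_le1D (x r s : R) : 0 <= x -> 0 <= r -> r <= s -> x `^ r <= 1 + x `^ s.
Proof.
move=> x0 r0 rs; have [x1|x1] := leP x 1.
  apply: (@le_trans _ _ 1); last by rewrite lerDl powR_ge0.
  by have := ler_powR_base r0 x0 x1; rewrite powR1.
apply: (@le_trans _ _ (x `^ s)); first by rewrite ler_powR// ltW.
by rewrite lerDr.
Qed.

Lemma integral_powR_lty (F : completeNormedModType R) (r s : R) (f : T -> F) :
  bochner_measurable P f -> 0 <= r -> r <= s ->
  (\int[P]_w (`|f w| `^ s)%:E < +oo)%E -> (\int[P]_w (`|f w| `^ r)%:E < +oo)%E.
Proof.
move=> mf r0 rs fs.
apply: (@le_lt_trans _ _ (\int[P]_w (1 + `|f w| `^ s)%R%:E)%E).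
  apply: ge0_integral_le.
  - exact/measurable_EFinP/(measurable_bochner_powR Pcomplete).
  - by apply: measurable_funD => //; exact/measurable_EFinP/(measurable_bochner_powR Pcomplete).
  - by move=> w; rewrite powR_ge0 powR_le1D.
under eq_integral do rewrite EFinD.
rewrite ge0_integralD//.
- rewrite integral_cst// [X in (_ * X)%E](@probability_setT _ _ _ P) mule1.
  by apply: lte_add_pinfty => //; exact: ltry.
- exact: (measurable_bochner_powR Pcomplete).
Qed.

End LqNorms.

Section BochnerIntegral.
Context (R : realType) (d : measure_display) (T : measurableType d).
Variable (P : probability T R).
Hypothesis Pcomplete : measure_is_complete P.
Context (F : completeNormedModType R).

Lemma fine_measure_split (A B : set T) : measurable A -> measurable B ->
  fine (P A) = fine (P (A `&` B)) + fine (P (A `\` B)).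
Proof.
move=> mA mB; rewrite [P A](measureDI P mA mB) addrC fineD//.
  by rewrite fin_num_measure//; exact: measurableI.
by rewrite fin_num_measure//; exact: measurableD.
Qed.

(** The part [B] and the offset [u] make the induction work with overlapping sets: each entry splits
    [B] in two, and on one half its value joins the offset. *)
Lemma norm_simple_integral_in (s : seq (set T * F)) (B : set T) (u : F) :
  simple_data s -> measurable B ->
  ((`|fine (P B) *: u + \sum_(a <- s) fine (P (a.1 `&` B)) *: a.2|)%R%:E <=
   \int[P]_(w in B) (`|u + simple_eval s w|)%R%:E)%E.
Proof.
elim: s B u => [|a s IH] B u ms mB.
  rewrite big_nil addr0 normrZ.
  under eq_integral do rewrite /simple_eval big_nil addr0.
  rewrite integral_cst// ger0_norm ?fine_ge0// EFinM muleC fineK//.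
  by rewrite fin_num_measure.
have [ma ms'] := (simple_data_cons a s).1 ms.
have mI : measurable (B `&` a.1) by exact: measurableI.
have mD : measurable (B `\` a.1) by exact: measurableD.
have mN (v : F) D : measurable D -> measurable_fun D (fun w => (`|v + simple_eval s w|)%:E).
  move=> mD'; apply: measurable_funTS; apply: (measurable_bochner_EFin Pcomplete (f := fun w => v + simple_eval s w)).
  by apply: bochnerD; [exact: bochner_cst|exact: bochner_simple].
have mN' D : measurable D -> measurable_fun D (fun w => (`|u + simple_eval (a :: s) w|)%:E).
  move=> mD'; apply: measurable_funTS; apply: (measurable_bochner_EFin Pcomplete (f := fun w => u + simple_eval (a :: s) w)).
  by apply: bochnerD; [exact: bochner_cst|exact: bochner_simple].
have BE : B = (B `&` a.1) `|` (B `\` a.1) by rewrite setUIDK.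
rewrite [in leRHS]BE ge0_integral_setU//; last 2 first.
- by apply: mN'; rewrite -BE.
- by rewrite disj_set2E; apply/eqP/seteqP; split=> w //= [[_ aw] [_]].
have h1 := IH (B `&` a.1) (u + a.2) ms' mI.
have h2 := IH (B `\` a.1) u ms' mD.
have {h1}h1 := le_trans h1 (_ : (_ <= \int[P]_(w in B `&` a.1) (`|u + simple_eval (a :: s) w|)%R%:E)%E).
have {h2}h2 := le_trans h2 (_ : (_ <= \int[P]_(w in B `\` a.1) (`|u + simple_eval (a :: s) w|)%R%:E)%E).
apply: le_trans (leeD (h1 _) (h2 _)); last 2 first.
- rewrite le_eqVlt; apply/orP; left; apply/eqP; apply: eq_integral => w.
  rewrite inE => -[_ aw]; rewrite simple_eval_cons indicE mem_set// scale1r.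
  by rewrite addrA.
- rewrite le_eqVlt; apply/orP; left; apply/eqP; apply: eq_integral => w.
  rewrite inE => -[_ aw]; rewrite simple_eval_cons indicE memNset// scale0r.
  by rewrite add0r.
rewrite -EFinD lee_fin; apply: le_trans (ler_normD _ _).
rewrite le_eqVlt; apply/orP; left; apply/eqP; congr (`|_|).
rewrite big_cons (fine_measure_split mB ma) scalerDl scalerDr.
have -> : \sum_(b <- s) fine (P (b.1 `&` B)) *: b.2 =
    \sum_(b <- s) fine (P (b.1 `&` (B `&` a.1))) *: b.2 +
    \sum_(b <- s) fine (P (b.1 `&` (B `\` a.1))) *: b.2.
  rewrite -big_split/=; elim: s ms' {IH ms mN mN' h1 h2} => [|b s IHs]; first by rewrite !big_nil.
  move=> /simple_data_cons[mb ms]; rewrite !big_cons IHs//; congr (_ + _).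
  have mbB : measurable (b.1 `&` B) by exact: measurableI.
  by rewrite (fine_measure_split mbB ma) scalerDl setIA setIDA.
rewrite setIC; set x := _ *: u; set y := _ *: u; set z := _ *: a.2.
set S1 := \sum_(_ <- _) _; set S2 := \sum_(_ <- _) _.
by rewrite -!addrA [z + (S1 + (y + S2))]addrA [z + S1 + _]addrCA -!addrA.
Qed.

Lemma norm_simple_integral (s : seq (set T * F)) : simple_data s ->
  ((`|simple_integral P s|)%R%:E <= \int[P]_w (`|simple_eval s w|)%R%:E)%E.
Proof.
move=> ms; have := norm_simple_integral_in 0 ms measurableT.
rewrite scaler0 add0r; under eq_integral do rewrite add0r.
by rewrite /simple_integral; under eq_bigr do rewrite setIT.
Qed.

Lemma simple_integral_dist (f : T -> F) (s t : seq (set T * F)) :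
  bochner_measurable P f -> simple_data s -> simple_data t ->
  ((`|simple_integral P s - simple_integral P t|)%R%:E <=
   \int[P]_w (`|f w - simple_eval s w|)%R%:E + \int[P]_w (`|f w - simple_eval t w|)%R%:E)%E.
Proof.
move=> mf ms mt.
have mD : simple_data (s ++ [seq (a.1, - a.2) | a <- t]).
  by apply: simple_data_cat => //; exact: simple_data_map.
have evE w : simple_eval (s ++ [seq (a.1, - a.2) | a <- t]) w = simple_eval s w - simple_eval t w.
  rewrite simple_eval_cat; congr (_ + _); rewrite /simple_eval big_map -sumrN.
  by apply: eq_bigr => a _; rewrite scalerN.
have inE : simple_integral P (s ++ [seq (a.1, - a.2) | a <- t]) = simple_integral P s - simple_integral P t.
  rewrite /simple_integral big_cat; congr (_ + _); rewrite big_map -sumrN.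
  by apply: eq_bigr => a _; rewrite scalerN.
rewrite -inE; apply: le_trans (norm_simple_integral mD) _.
have mfs u : simple_data u -> measurable_fun setT (fun w => (`|f w - simple_eval u w|)%:E).
  move=> mu; apply: (measurable_bochner_EFin Pcomplete (f := fun w => f w - simple_eval u w)).
  by apply: bochnerB => //; exact: bochner_simple.
rewrite -ge0_integralD//; try exact: mfs.
apply: ge0_le_integral => //.
- exact/(measurable_bochner_EFin Pcomplete)/bochner_simple.
- by apply: emeasurable_funD; exact: mfs.
move=> w _; rewrite evE -EFinD lee_fin.
rewrite [in leRHS](distrC (f w) (simple_eval s w)); exact: ler_distD.
Qed.

Lemma bochner_integral_dist (f : T -> F) (v : F) (t : seq (set T * F)) :
  is_bochner_integral P f v -> simple_data t ->
  ((`|v - simple_integral P t|)%R%:E <= \int[P]_w (`|f w - simple_eval t w|)%R%:E)%E.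
Proof.
move=> [mf [s [ms s0 sv]]] mt; set I := (X in (_ <= X)%E).
apply/lee_addgt0Pr => e e0.
have e20 : 0 < e / 2 by rewrite divr_gt0.
have /cvgr_dist_lt/(_ _ e20) h1 := sv.
have h2 : \forall n \near \oo, (\int[P]_w (`|f w - simple_eval (s n) w|)%R%:E < (e / 2)%:E)%E.
  by apply: ecvg0_lt => // n; exact: integral_ge0.
have [n [h1n h2n]] := filter_ex (filterI h1 h2).
apply: (@le_trans _ _ ((`|v - simple_integral P (s n)|)%R%:E +
   (`|simple_integral P (s n) - simple_integral P t|)%R%:E)%E).
  by rewrite -EFinD lee_fin ler_distD.
rewrite [e]splitr EFinD addeA [(I + _)%E]addeC -addeA leeD//; first by rewrite lee_fin ltW.
apply: le_trans (simple_integral_dist mf (ms n) mt) _.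
by rewrite addeC leeD2l// ltW.
Qed.

Lemma is_bochner_integral_unique (f : T -> F) (v v' : F) :
  is_bochner_integral P f v -> is_bochner_integral P f v' -> v = v'.
Proof.
move=> fv [mf [s [ms s0 sv']]].
apply: (@cvg_unique _ (@norm_hausdorff _ F) (simple_integral P (s n) @[n --> \oo])) => //.
apply/cvgrPdist_lt => e e0.
have h : \forall n \near \oo, (\int[P]_w (`|f w - simple_eval (s n) w|)%R%:E < e%:E)%E.
  by apply: ecvg0_lt => // n; exact: integral_ge0.
apply: filterS h => n; rewrite -lte_fin; apply: le_lt_trans.
exact: bochner_integral_dist.
Qed.

Lemma bochner_integralE (f : T -> F) (v : F) :
  is_bochner_integral P f v -> bochner_integral P f = v.
Proof.
move=> fv; apply: (is_bochner_integral_unique _ fv).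
by apply: (@xgetPex F 0 [set v | is_bochner_integral P f v]); exists v.
Qed.

Lemma is_bochner_integral0 : is_bochner_integral P (fun=> 0 : F) 0.
Proof.
split; first exact: bochner_cst.
exists (fun=> [::]); split=> //.
- rewrite (_ : (fun n : nat => _) = fun=> 0%E); first exact: cvg_cst.
  apply/funext => n; rewrite -[RHS](integral0 P setT).
  by apply: eq_integral => w _; rewrite /simple_eval big_nil subr0 normr0.
- by rewrite /simple_integral big_nil; exact: cvg_cst.
Qed.

Lemma is_bochner_integralB (f g : T -> F) (u v : F) :
  is_bochner_integral P f u -> is_bochner_integral P g v ->
  is_bochner_integral P (fun w => f w - g w) (u - v).
Proof.
move=> [mf [s [ms s0 su]]] [mg [t [mt t0 tv]]]; split; first exact: bochnerB.
exists (fun n => s n ++ [seq (a.1, - a.2) | a <- t n]); split.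
- by move=> n; apply: simple_data_cat => //; exact: simple_data_map.
- apply: (@squeeze_cvge _ _ _ _ (fun=> 0%E) _ (fun n => \int[P]_w (`|f w - simple_eval (s n) w|)%R%:E +
    \int[P]_w (`|g w - simple_eval (t n) w|)%R%:E)%E).
  + near=> n; rewrite integral_ge0//=.
    have mfs (h : T -> F) r : bochner_measurable P h -> simple_data r ->
        measurable_fun setT (fun w => (`|h w - simple_eval r w|)%:E).
      move=> mh mr; apply: (measurable_bochner_EFin Pcomplete (f := fun w => h w - simple_eval r w)).
      by apply: bochnerB => //; exact: bochner_simple.
    rewrite -ge0_integralD//; [|exact: mfs|exact: mfs].
    apply: ge0_le_integral => //.
    * apply: (mfs (fun w => f w - g w)); first exact: bochnerB.
      by apply: simple_data_cat => //; exact: simple_data_map.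
    * by apply: emeasurable_funD; exact: mfs.
    move=> w _; rewrite -EFinD lee_fin simple_eval_cat.
    have -> : simple_eval [seq (a.1, - a.2) | a <- t n] w = - simple_eval (t n) w.
      by rewrite /simple_eval big_map -sumrN; apply: eq_bigr => a _; rewrite scalerN.
    by rewrite opprD addrACA -opprD ler_normB.
  + exact: cvg_cst.
  + by rewrite -[0%E]adde0; apply: cvgeD.
- rewrite (_ : (fun n => _) = (fun n => simple_integral P (s n) - simple_integral P (t n))).
    exact: cvgB.
  apply/funext => n; rewrite /simple_integral big_cat; congr (_ + _); rewrite big_map -sumrN.
  by apply: eq_bigr => a _; rewrite scalerN.
Unshelve. all: by end_near. Qed.

End BochnerIntegral.

(** * Injective moments *)

Section MomentExistence.
Context (R : realType) (d : measure_display) (T : measurableType d).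
Variable (P : probability T R).
Hypothesis Pcomplete : measure_is_complete P.
Context (k : nat) (E : completeNormedModType R).
Hypothesis k0 : (0 < k)%N.
Local Notation tens := (tensor_functional k E).

Lemma tensor_power0 : @tensor_power R k E 0 = 0.
Proof.
apply/funext => -[B mB]; rewrite /tensor_power /elementary_tensor/=.
have updE : upd (fun=> 0 : E) (Ordinal k0) 0 = (fun=> 0).
  by apply/funext => j; rewrite /upd; case: ifP.
have := mB (fun=> 0 : E) (Ordinal k0) (-1) 0 0.
by rewrite scaler0 addr0 updE mulN1r addNr.
Qed.

(* A common description of the maps iota into the injective tensor product and
   iota_s into the symmetric one. *)
Definition tensor_map (G : completeNormedModType R) (J : tens -> G) : Prop :=
  (forall (a : R) U V, sym_alg_tensor U -> sym_alg_tensor V ->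
     J (a *: U + V) = a *: J U + J V) /\
  (forall x y : E, `|J (tensor_power x) - J (tensor_power y)| <= k%:R * zeta k (x, y)).

Lemma tensor_map0 (G : completeNormedModType R) (J : tens -> G) :
  tensor_map J -> J 0 = 0.
Proof.
move=> [JL _]; have := JL (-1) 0 0 (sym_alg0 _ _) (sym_alg0 _ _).
by rewrite scaler0 addr0 scaleN1r addNr.
Qed.

(** [U] is fixed before [G] and [J]: the same tensors must converge in the full and in the symmetric
    completion, as [sym_identified] requires. *)
Lemma moment_approx (X : T -> E) :
  bochner_measurable P X -> (\int[P]_w (`|X w| `^ k%:R)%:E < +oo)%E ->
  exists U : nat -> tens, (forall n, sym_alg_tensor (U n)) /\
    forall (G : completeNormedModType R) (J : tens -> G), tensor_map J ->
    exists y, J (U n) @[n --> \oo] --> y /\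
      is_bochner_integral P (fun w => J (tensor_power (X w))) y.
Proof.
move=> mX Xk; have [at_ [x [mat evat cvx lex]]] := bochner_approx Pcomplete mX.
have bx n : bochner_measurable P (x n).
  rewrite (_ : x n = simple_eval [seq (a.1, idfun a.2) | a <- at_ n]); last first.
    by apply/funext => w; rewrite (evat E idfun).
  by apply: bochner_simple; exact: simple_data_map.
(* An error bound valid for every [tensor_map]; 2|X| dominates the norms of both [X] and [x n]. *)
pose h n w := k%:R * (`|X w - x n w| * (2 * `|X w|) ^+ k.-1).
have h0 n w : 0 <= h n w by rewrite !mulr_ge0// exprn_ge0// mulr_ge0.
have mh n : measurable_fun setT (h n).
  apply: measurable_funM => //; apply: measurable_funM.
    by apply: (measurable_bochner_norm Pcomplete (f := fun w => X w - x n w)); exact: bochnerB.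
  apply: measurable_funX; apply: measurable_funM => //.
  exact: (measurable_bochner_norm Pcomplete mX).
(* 3 = 1 + 2, since |X - x n| <= |X| + |x n| <= 3|X|. *)
pose c : R := k%:R * (3 * 2 ^+ k.-1).
have hc n w : h n w <= c * `|X w| `^ k%:R.
  rewrite powR_mulrn// /h /c -mulrA; apply: ler_wpM2l => //.
  have -> : `|X w| ^+ k = `|X w| * `|X w| ^+ k.-1 by rewrite -exprS prednK.
  rewrite exprMn.
  have -> : 3 * 2 ^+ k.-1 * (`|X w| * `|X w| ^+ k.-1) = (3 * `|X w|) * (2 ^+ k.-1 * `|X w| ^+ k.-1).
    by ring.
  apply: ler_wpM2r; first by rewrite mulr_ge0// exprn_ge0.
  by have := ler_normB (X w) (x n w); have := lex n w; lra.
have hcv : {ae P, forall w, h n w @[n --> \oo] --> 0}.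
  apply: filterS cvx => w xw; rewrite -(mulr0 (k%:R : R)); apply: cvgMr.
  rewrite -(mul0r ((2 * `|X w|) ^+ k.-1)); apply: cvgMl.
  rewrite -(normr0 E); apply: cvg_norm; rewrite -(subrr (X w)).
  by apply: cvgB => //; exact: cvg_cst.
have Dcv : (\int[P]_w (h n w)%:E)%E @[n --> \oo] --> 0%E.
  have := @dominated_convergence _ T R P setT measurableT (fun n w => (h n w)%:E) (fun=> 0%E)
    (fun w => (c * `|X w| `^ k%:R)%:E).
  case=> //.
  - by move=> n; exact/measurable_EFinP.
  - by apply: filterS hcv => w hw _; apply/fine_cvgP; split; [exact: nearW|exact: hw].
  - apply/integrableP; split.
      apply/measurable_EFinP; apply: measurable_funM => //.
      exact/measurable_EFinP/(measurable_bochner_powR Pcomplete).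
    have c0 : 0 <= c by rewrite !mulr_ge0// exprn_ge0.
    under eq_integral do rewrite abse_EFin ger0_norm ?mulr_ge0 ?powR_ge0// EFinM.
    rewrite (ge0_integralZl_EFin P measurableT _ _ c0).
    + by rewrite lte_mul_pinfty.
    + by move=> w _; rewrite lee_fin powR_ge0.
    + exact: (measurable_bochner_powR Pcomplete).
  - by apply: aeW => w n _; rewrite abse_EFin lee_fin ger0_norm.
  by move=> _ _; rewrite integral0.
pose U n : tens := \sum_(a <- at_ n) fine (P a.1) *: tensor_power a.2.
have sU n : sym_alg_tensor (U n).
  rewrite /U; elim: (at_ n) => [|a s IH]; first by rewrite big_nil; exact: sym_alg0.
  rewrite big_cons; apply: sym_algD => //; apply: sym_algZ; exact: sym_alg_power.
exists U; split=> // G J JT; have [JL Jd] := JT.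
pose t n := [seq (a.1, J (tensor_power a.2)) | a <- at_ n].
have tE n w : simple_eval (t n) w = J (tensor_power (x n w)).
  by apply: (evat G (fun u => J (tensor_power u))); rewrite tensor_power0 (tensor_map0 JT).
have mt n : simple_data (t n) by exact: simple_data_map.
have JU n : simple_integral P (t n) = J (U n).
  rewrite /simple_integral /t big_map /U.
  elim: (at_ n) => [|a s IH]; first by rewrite !big_nil (tensor_map0 JT).
  rewrite !big_cons JL ?IH//; first exact: sym_alg_power.
  elim: s {IH} => [|b s IH]; first by rewrite big_nil; exact: sym_alg0.
  rewrite big_cons; apply: sym_algD => //; apply: sym_algZ; exact: sym_alg_power.
have le_h n w : `|J (tensor_power (X w)) - simple_eval (t n) w| <= h n w.
  rewrite tE; apply: le_trans (Jd _ _) _; rewrite /h ler_wpM2l// ler_wpM2l//=.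
  apply: lerXn2r; rewrite ?nnegrE ?le_max ?normr_ge0 ?mulr_ge0//.
  by rewrite ge_max lex andbT; have := normr_ge0 (X w); lra.
have bJ : bochner_measurable P (fun w => J (tensor_power (X w))).
  exists t => //; apply: filterS hcv => w hw; apply/cvgrPdist_lt => e e0.
  move/cvgrPdist_lt: hw => /(_ _ e0); apply: filterS => n.
  rewrite sub0r normrN ger0_norm//; exact: le_lt_trans.
have mJt n : measurable_fun setT (fun w => `|J (tensor_power (X w)) - simple_eval (t n) w|).
  apply: (measurable_bochner_norm Pcomplete (f := fun w => J (tensor_power (X w)) - simple_eval (t n) w)).
  by apply: bochnerB => //; exact: bochner_simple.
have int_le n : (\int[P]_w (`|J (tensor_power (X w)) - simple_eval (t n) w|)%R%:E <=
    \int[P]_w (h n w)%:E)%E.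
  by apply: ge0_integral_le => // w; rewrite normr_ge0 le_h.
have small e : 0 < e -> \forall n \near \oo,
    (\int[P]_w (`|J (tensor_power (X w)) - simple_eval (t n) w|)%R%:E < e%:E)%E.
  move=> e0; have := @ecvg0_lt R (fun n => \int[P]_w (h n w)%:E)%E e.
  move=> /(_ _ Dcv e0) hn; apply: filterS (hn _) => n; first exact: le_lt_trans.
  by apply: integral_ge0 => w _; rewrite lee_fin.
have cJU : cvg (J (U n) @[n --> \oo]).
  apply: cauchy_cvg; apply: cauchy_exP => e e0.
  have e20 : 0 < e / 2 by rewrite divr_gt0.
  have [N _ HN] := small _ e20.
  exists (J (U N)); exists N => // n /= Nn; rewrite -ball_normE/= -!JU.
  rewrite -lte_fin; apply: le_lt_trans (simple_integral_dist Pcomplete bJ (mt N) (mt n)) _.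
  rewrite [e]splitr EFinD; apply: lteD; [exact: HN N (leqnn N)|exact: HN n Nn].
exists (lim (J (U n) @[n --> \oo])); split=> //; split=> //; exists t; split=> //.
  apply: (@squeeze_cvge _ _ _ _ (fun=> 0%E) _ (fun n => \int[P]_w (h n w)%:E)%E) => //.
    by apply: nearW => n; rewrite integral_ge0//= => w _; rewrite lee_fin.
  exact: cvg_cst.
by under eq_fun do rewrite JU.
Qed.

Section Identification.
Context (F : completeNormedModType R) (iota : tens -> F).
Context (Fs : completeNormedModType R) (iota_s : tens -> Fs).
Hypothesis HF : is_injective_tensor_product iota.
Hypothesis HFs : is_sym_injective_tensor_product iota_s.

Lemma alg_tensorB U V : @sym_alg_tensor R k E U -> sym_alg_tensor V -> alg_tensor (U - V).
Proof. by move=> sU sV; apply: alg_sym_alg => //; exact: sym_algB. Qed.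

Lemma iotaB U V : sym_alg_tensor U -> sym_alg_tensor V ->
  iota (U - V) = iota U - iota V.
Proof.
have [L _ _] := HF; move=> sU sV.
by rewrite addrC -scaleN1r L ?scaleN1r; [rewrite addrC|exact: alg_sym_alg|exact: alg_sym_alg].
Qed.

Lemma tensor_map_iota : tensor_map iota.
Proof.
have [L N _] := HF; split=> [a U V sU sV|x y]; first by apply: L; exact: alg_sym_alg.
rewrite -iotaB; try exact: sym_alg_power.
rewrite N; first exact: inj_norm_power_diff.
by apply: alg_tensorB; exact: sym_alg_power.
Qed.

Lemma tensor_map_iota_s : tensor_map iota_s.
Proof.
by have [L N _] := HFs; split=> [|x y]; [exact: L|exact: (norm_power_diff k0 HFs (x, y))].
Qed.

(** The symmetric norm is at most the injective one, so a difference that tends to 0 in [F] does so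
    in [Fs]. *)
Lemma sym_identified_unique (y y' : Fs) (z : F) :
  sym_identified iota iota_s y z -> sym_identified iota iota_s y' z -> y = y'.
Proof.
move=> [U [sU Uy Uz]] [V [sV Vy Vz]].
apply/eqP; rewrite -subr_eq0; apply/eqP.
apply: (@cvg_unique _ (@norm_hausdorff _ Fs) (iota_s (U n) - iota_s (V n) @[n --> \oo])).
  exact: cvgB.
apply/cvgrPdist_lt => e e0.
have : (iota (U n) - iota (V n)) @[n --> \oo] --> z - z by exact: cvgB.
rewrite subrr => /cvgr_dist_lt/(_ _ e0); apply: filterS => n.
rewrite !sub0r !normrN; apply: le_lt_trans.
rewrite -(iota_sB HFs)// -iotaB//; have [_ N _] := HF.
rewrite N; last exact: alg_tensorB.
rewrite (norm_iota_s HFs); last exact: sym_algB.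
by apply: sym_norm_le_inj_norm; exact: alg_tensorB.
Qed.

(** Turns the moment, defined in [F] and then identified in [Fs], into a Bochner integral in [Fs],
    the form in which the level errors are estimated. *)
Lemma sym_injective_momentP (X : T -> E) :
  bochner_measurable P X -> (\int[P]_w (`|X w| `^ k%:R)%:E < +oo)%E ->
  is_bochner_integral P (fun w => iota_s (tensor_power (X w)))
    (sym_injective_moment P iota iota_s X).
Proof.
move=> mX Xk; have [U [sU HU]] := moment_approx mX Xk.
have [z [Uz Iz]] := HU F iota tensor_map_iota.
have [y [Uy Iy]] := HU Fs iota_s tensor_map_iota_s.
have zE : injective_moment P iota X = z by exact: bochner_integralE Iz.
have yI : sym_identified iota iota_s y (injective_moment P iota X).
  by rewrite zE; exists U.
suff -> : sym_injective_moment P iota iota_s X = y by [].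
apply: (sym_identified_unique _ yI).
by apply: (@xgetPex _ 0 [set y | sym_identified iota iota_s y (injective_moment P iota X)]); exists y.
Qed.

End Identification.
End MomentExistence.

(** * Monte Carlo error at one level *)

Section Discretization.
Context (R : realType) (d : measure_display) (T : measurableType d).
Variable (P : probability T R).
Hypothesis Pcomplete : measure_is_complete P.
Context (F : completeNormedModType R).

Lemma bochner_preimage_borel (f : T -> F) (B : set F) :
  bochner_measurable P f -> borel B -> measurable (f @^-1` B).
Proof.
move=> mf; apply: (smallest_sub (X := [set B | measurable (f @^-1` B)])); last first.
  by move=> U oU; exact: (bochner_preimage_open Pcomplete mf oU).
split=> /=.
- by rewrite preimage_set0.
- by move=> A mA; rewrite setTD preimage_setC; exact: measurableC.
- by move=> A mA; rewrite preimage_bigcup; exact: bigcupT_measurable.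
Qed.

(** The first of n balls that contains [u]; the value n stands for the remainder outside all of
    them. *)
Definition cell_index (c : nat -> F) (r : R) (n : nat) (u : F) : nat :=
  find (fun i => `|u - c i| < r) (iota 0 n).

Lemma cell_index_le c r n u : (cell_index c r n u <= n)%N.
Proof. by rewrite -[leqRHS](size_iota 0) find_size. Qed.

Lemma cell_index_lt c r n u : (cell_index c r n u < n)%N ->
  `|u - c (cell_index c r n u)| < r.
Proof.
move=> h; have hs : has (fun i => `|u - c i| < r) (iota 0 n) by rewrite has_find size_iota.
by have := nth_find 0%N hs; rewrite nth_iota// add0n.
Qed.

Lemma cell_index_eqn c r n u i : (i < n)%N -> `|u - c i| < r -> (cell_index c r n u < n)%N.
Proof.
move=> ilt ur; rewrite -[X in (_ < X)%N](size_iota 0) -has_find.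
by apply/hasP; exists i => //; rewrite mem_iota.
Qed.

(** Equality in law and independence speak of Borel sets of values only, so the discretization has
    to be built from such sets. *)
Lemma borel_cell c r n m : borel [set u | cell_index c r n u = m].
Proof.
have bB i : @measurable _ (g_sigma_algebraType (@open F)) [set u | `|u - c i| < r].
  apply: sub_sigma_algebra => /=.
  have -> : [set u : F | `|u - c i| < r] = (fun u : F => `|u - c i|) @^-1` [set y | y < r] by [].
  apply: open_comp; last exact: open_lt.
  by move=> x _; apply: cvg_norm; apply: cvgB; [exact: cvg_id|exact: cvg_cst].
have gen : forall l m, @measurable _ (g_sigma_algebraType (@open F))
    [set u | find (fun i => `|u - c i| < r) l = m].
  elim=> [|i l IH] {}m /=.
    have [->|m0] := eqVneq m 0%N.
      by rewrite (_ : [set _ | _] = setT)//; apply/seteqP; split.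
    rewrite (_ : [set _ | _] = set0)//; apply/seteqP; split=> //= u /eqP.
    by rewrite eq_sym (negbTE m0).
  rewrite (_ : [set _ | _] = ([set u | `|u - c i| < r] `&` [set u | 0%N = m]) `|`
    (~` [set u | `|u - c i| < r] `&` [set u | (find (fun j => `|u - c j| < r) l).+1 = m])).
    apply: measurableU; apply: measurableI => //.
    - have [->|m0] := eqVneq 0%N m.
        by rewrite (_ : [set _ | _] = setT)//; apply/seteqP; split.
      rewrite (_ : [set _ | _] = set0)//; apply/seteqP; split=> //= u /eqP.
      by rewrite (negbTE m0).
    - exact: measurableC.
    - case: m => [|m]; first by rewrite (_ : [set _ | _] = set0)//; apply/seteqP; split.
      rewrite (_ : [set _ | _] = [set u | find (fun j => `|u - c j| < r) l = m])//.
      by apply/seteqP; split=> u /= => [[]|->].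
  apply/seteqP; split=> u /=; first by case: ifP => h; [left|right; split=> //; rewrite h].
  by case=> -[h]; [rewrite h|rewrite (negbTE (introN idP h))].
exact: gen.
Qed.

Lemma atoms_eval (s : seq (set T * F)) B u w : B w ->
  u + simple_eval s w \in [seq a.2 | a <- atoms s B u].
Proof.
elim: s B u => [|a s IH] B u Bw /=; first by rewrite /simple_eval big_nil addr0 mem_head.
rewrite map_cat mem_cat simple_eval_cons; have [aw|aw] := pselect (a.1 w).
  by rewrite indicE mem_set// scale1r addrA IH.
by rewrite indicE memNset// scale0r add0r orbC IH.
Qed.

(** The essential range is separable: the finitely many values of each simple approximation are
    enumerated together through [pickle]. *)
Lemma bochner_centers (f : T -> F) : bochner_measurable P f ->
  exists c : nat -> F, {ae P, forall w, forall r, 0 < r -> exists i, `|f w - c i| < r}.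
Proof.
move=> [s ms cvs].
exists (fun m => if (unpickle m : option (nat * nat)) is Some (n, i)
  then nth 0 [seq a.2 | a <- atoms (s n) setT 0] i else 0).
apply: filterS cvs => w fw r r0.
have /cvgr_dist_lt/(_ _ r0)[N _ /(_ N (leqnn N))/= h] := fw.
have hin := @atoms_eval (s N) setT 0 w I; rewrite add0r in hin.
exists (pickle (N, index (simple_eval (s N) w) [seq a.2 | a <- atoms (s N) setT 0])).
by rewrite pickleK nth_index.
Qed.

Section Cells.
Variables (c : nat -> F) (r : R).
Local Notation idx := (cell_index c r).

Lemma measurable_cell (f : T -> F) n m : bochner_measurable P f ->
  measurable [set w | idx n (f w) = m].
Proof. by move=> mf; exact: (bochner_preimage_borel mf (borel_cell c r n m)). Qed.

(** Almost every value lies in one of the balls and leaves the remainder cell for large n; dominated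
    convergence does the rest. *)
Lemma cell_tail (f : T -> F) (s e : R) : bochner_measurable P f ->
  (\int[P]_w (`|f w| `^ s)%:E < +oo)%E ->
  {ae P, forall w, exists i, `|f w - c i| < r} -> 0 < e ->
  \forall n \near \oo,
    (\int[P]_w ((idx n (f w) == n)%:R * `|f w| `^ s)%R%:E < e%:E)%E.
Proof.
move=> mf fs fc e0.
have mi n : measurable_fun setT (fun w => (idx n (f w) == n)%:R : R).
  rewrite (_ : (fun w => _) = \1_([set w | idx n (f w) = n])).
    by apply: measurable_indic; exact: measurable_cell.
  apply/funext => w; rewrite indicE; congr (_%:R); congr nat_of_bool.
  by apply/eqP/idP => h; [rewrite inE|move: h; rewrite inE].
have mfs : measurable_fun setT (fun w => `|f w| `^ s).
  exact/measurable_EFinP/(measurable_bochner_powR Pcomplete).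
have D : (\int[P]_w ((idx n (f w) == n)%:R * `|f w| `^ s)%R%:E)%E @[n --> \oo] --> 0%E.
  have := @dominated_convergence _ T R P setT measurableT
    (fun n w => ((idx n (f w) == n)%:R * `|f w| `^ s)%:E) (fun=> 0%E)
    (fun w => (`|f w| `^ s)%:E).
  case=> //.
  - by move=> n; apply/measurable_EFinP; exact: measurable_funM.
  - apply: filterS fc => w [i wi] _; apply: cvg_near_cst.
    exists i.+1 => // n /= ni; rewrite (ltn_eqF (cell_index_eqn ni wi)).
    by rewrite mul0r.
  - apply/integrableP; split; first exact/measurable_EFinP.
    by under eq_integral do rewrite abse_EFin ger0_norm ?powR_ge0//.
  - apply: aeW => w n _; rewrite abse_EFin lee_fin ger0_norm ?mulr_ge0 ?powR_ge0//.
    by rewrite ler_piMl ?powR_ge0// lern1 leq_b1.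
  by move=> _ _; rewrite integral0.
apply: ecvg0_lt D e0 => n; apply: integral_ge0 => w _.
by rewrite lee_fin mulr_ge0 ?powR_ge0.
Qed.

Variables (n : nat) (v : nat -> F).
Hypothesis vn : v n = 0.

Definition discretize (u : F) : F := v (idx n u).

Definition discretize_data (f : T -> F) : seq (set T * F) :=
  [seq ([set w | idx n (f w) = i], v i) | i <- iota 0 n.+1].

Lemma simple_data_discretize f : bochner_measurable P f -> simple_data (discretize_data f).
Proof.
move=> mf; rewrite /discretize_data; elim: (iota _ _) => //= i l IH.
by apply/simple_data_cons; split=> //; exact: measurable_cell.
Qed.

Lemma simple_eval_discretize f w : simple_eval (discretize_data f) w = discretize (f w).
Proof.
have hin : idx n (f w) \in iota 0 n.+1 by rewrite mem_iota add0n ltnS cell_index_le.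
rewrite /simple_eval /discretize_data big_map (bigD1_seq _ hin (iota_uniq _ _)).
rewrite indicE mem_set// scale1r big1 /= ?addr0// => i /eqP ni.
by rewrite indicE memNset ?scale0r// => /= h; apply: ni.
Qed.

Lemma bochner_discretize f : bochner_measurable P f ->
  bochner_measurable P (fun w => discretize (f w)).
Proof.
move=> mf; rewrite (_ : (fun w => _) = simple_eval (discretize_data f)).
  by apply: bochner_simple; exact: simple_data_discretize.
by apply/funext => w; rewrite simple_eval_discretize.
Qed.

(** A value and the representative of its cell lie within r of the same center. Null cells need no
    representative of their own, and on the remainder cell the representative 0 leaves the tail
    integral. *)
Lemma discretize_error (f : T -> F) (s : R) : bochner_measurable P f -> 0 < s -> 0 < r ->
  (forall i, (i < n)%N -> P [set w | idx n (f w) = i] = 0%E \/ idx n (v i) = i) ->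
  (\int[P]_w (`|f w - discretize (f w)| `^ s)%R%:E <= ((2 * r) `^ s)%R%:E +
   \int[P]_w ((idx n (f w) == n)%:R * `|f w| `^ s)%R%:E)%E.
Proof.
move=> mf s0 r0 H.
have mi : measurable_fun setT (fun w => (idx n (f w) == n)%:R : R).
  rewrite (_ : (fun w => _) = \1_([set w | idx n (f w) = n])).
    by apply: measurable_indic; exact: measurable_cell.
  apply/funext => w; rewrite indicE; congr (_%:R); congr nat_of_bool.
  by apply/eqP/idP => h; [rewrite inE|move: h; rewrite inE].
have mfs : measurable_fun setT (fun w => `|f w| `^ s).
  exact/measurable_EFinP/(measurable_bochner_powR Pcomplete).
have mp : measurable_fun setT (fun w => (idx n (f w) == n)%:R * `|f w| `^ s).
  exact: measurable_funM.
have -> : ((2 * r) `^ s)%:E = (\int[P]_w ((2 * r) `^ s)%:E)%E.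
  by rewrite integral_cst// [X in (_ * X)%E](@probability_setT _ _ _ P) mule1.
rewrite -ge0_integralD//; last 2 first.
- by move=> w _; rewrite lee_fin powR_ge0.
- exact/measurable_EFinP.
apply: ae_ge0_le_integral => //.
- apply: (measurable_bochner_powR Pcomplete (f := fun w => f w - discretize (f w))).
  by apply: bochnerB => //; exact: bochner_discretize.
- by move=> w _; rewrite -EFinD lee_fin addr_ge0 ?mulr_ge0 ?powR_ge0.
- by apply: emeasurable_funD; exact/measurable_EFinP.
have ae_i : {ae P, forall w (i : 'I_n), P [set w | idx n (f w) = i] = 0%E ->
    idx n (f w) <> i}.
  apply: filter_forall => i.
  have [p0|p0] := pselect (P [set w | idx n (f w) = i] = 0%E); last by apply: aeW => w /p0.
  exists [set w | idx n (f w) = i]; split=> //; first exact: measurable_cell.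
  by move=> w /= h; apply: contrapT => h'; apply: h.
apply: filterS ae_i => w hw _; rewrite -EFinD lee_fin /discretize.
have := cell_index_le c r n (f w); rewrite leq_eqVlt => /predU1P[e|lt].
  by rewrite e eqxx vn subr0 mul1r lerDr powR_ge0.
apply: (@le_trans _ _ ((2 * r) `^ s)); last by rewrite lerDl mulr_ge0 ?powR_ge0.
apply: ler_powR_base => //; first exact: ltW.
have [p0|vi] := H _ lt; first by have := hw (Ordinal lt) p0.
have h1 := cell_index_lt lt.
have h2 : `|v (idx n (f w)) - c (idx n (f w))| < r.
  by have := @cell_index_lt c r n (v (idx n (f w))); rewrite vi; apply.
have := ler_distD (c (idx n (f w))) (f w) (v (idx n (f w))).
by rewrite (distrC (c _)) => h3; lra.
Qed.

End Cells.
End Discretization.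

(** * Sums of independent samples with finitely many values *)

Section FiniteSampling.
Context (R : realType) (d : measure_display) (T : measurableType d).
Variable (P : probability T R).

Lemma ge0_integral_split (A : set T) (phi : T -> nat) (n : nat) (f : T -> R) :
  measurable A -> (forall m, measurable [set w | phi w = m]) ->
  (forall w, (phi w <= n)%N) -> measurable_fun setT f -> (forall w, 0 <= f w) ->
  (\int[P]_(w in A) (f w)%:E =
   \sum_(i < n.+1) \int[P]_(w in A `&` [set w | phi w = i]) (f w)%:E)%E.
Proof.
move=> mA mphi phin mf f0.
pose G (i : 'I_n.+1) := A `&` [set w | phi w = i].
have AE : A = \big[setU/set0]_(i <- index_enum 'I_n.+1) G i.
  rewrite -bigcup_seq; apply/seteqP; split=> [w Aw|w [i _ []]//].
  have pw : (phi w < n.+1)%N by rewrite ltnS.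
  by exists (Ordinal pw) => //=; exact: mem_index_enum.
rewrite [in LHS]AE ge0_integral_bigsetU//.
- by move=> i; exact: measurableI.
- exact: index_enum_uniq.
- by move=> i j _ _ [w [[_ /= wi] [_ /= wj]]]; apply: val_inj; rewrite /= -wi -wj.
- exact/measurable_funTS/measurable_EFinP.
- by move=> w _; rewrite lee_fin.
Qed.

(** If [g] exceeded (I + de)/P(A) all over [A], where I is its integral, integration would give I +
    de <= I. *)
Lemma exists_le_average (A : set T) (g : T -> R) (de : R) :
  measurable A -> P A != 0%E -> measurable_fun setT g -> (forall w, 0 <= g w) ->
  (\int[P]_(w in A) (g w)%:E < +oo)%E -> 0 < de ->
  exists2 w, A w & fine (P A) * g w <= fine (\int[P]_(w in A) (g w)%:E)%E + de.
Proof.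
move=> mA PA0 mg g0 gA de0; apply: contrapT => H.
set I := (\int[P]_(w in A) (g w)%:E)%E in gA H *.
have I0 : (0 <= I)%E by apply: integral_ge0 => w _; rewrite lee_fin.
have fI : I \is a fin_num by rewrite ge0_fin_numE.
have fP : P A \is a fin_num by rewrite fin_num_measure.
have p0 : 0 < fine (P A) by rewrite fine_gt0// lt0e PA0 measure_ge0 -ge0_fin_numE.
have lb w : A w -> (fine I + de) / fine (P A) <= g w.
  move=> Aw; rewrite ler_pdivrMr// mulrC leNgt; apply/negP => /ltW h.
  by apply: H; exists w.
have : (((fine I + de) / fine (P A))%:E * P A <= I)%E.
  rewrite -(integral_cst P mA); apply: ge0_le_integral => //.
  - by move=> w _; rewrite lee_fin divr_ge0 ?ltW// ltr_wpDl// fine_ge0.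
  - exact/measurable_funTS/measurable_EFinP.
rewrite -[X in (_ * X <= _)%E](fineK fP) -EFinM divfK ?gt_eqF// -(fineK fI) lee_fin.
by rewrite gerDl leNgt de0.
Qed.

Lemma measurable_seq_fiber (phi : nat -> T -> nat) (l t : seq nat) :
  (forall j m, measurable [set w | phi j w = m]) ->
  measurable [set w | [seq phi j w | j <- l] = t].
Proof.
move=> mphi; elim: l t => [|j l IH] [|i t] /=.
- by rewrite (_ : [set _ | _] = setT)//; apply/seteqP; split.
- by rewrite (_ : [set _ | _] = set0)//; apply/seteqP; split.
- by rewrite (_ : [set _ | _] = set0)//; apply/seteqP; split.
rewrite (_ : [set _ | _] = [set w | phi j w = i] `&` [set w | [seq phi j w | j <- l] = t]).
  exact: measurableI.
by apply/seteqP; split=> w /= [-> ->].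
Qed.

(** There are only countably many lists of indices, so measurability reduces to the fibers. *)
Lemma measurable_seq_fun (phi : nat -> T -> nat) (l : seq nat) (G : seq nat -> R) :
  (forall j m, measurable [set w | phi j w = m]) ->
  measurable_fun setT (fun w => G [seq phi j w | j <- l]).
Proof.
move=> mphi _ B mB; rewrite setTI.
pose C (m : nat) : set T := if (unpickle m : option (seq nat)) is Some t
  then [set w | [seq phi j w | j <- l] = t] `&` [set w | B (G t)] else set0.
rewrite (_ : _ @^-1` B = \bigcup_m C m).
  apply: bigcupT_measurable => m; rewrite /C; case: unpickle => [t|//].
  apply: measurableI; first exact: measurable_seq_fiber.
  have [b|b] := pselect (B (G t)).
    by rewrite (_ : [set _ | _] = setT)//; apply/seteqP; split.
  by rewrite (_ : [set _ | _] = set0)//; apply/seteqP; split.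
apply/seteqP; split=> w /=.
  by move=> Bw; exists (pickle [seq phi j w | j <- l]) => //; rewrite /C pickleK.
by case=> m _; rewrite /C; case: unpickle => [t|//] [/= <-].
Qed.

Section Sampling.
Context (V : lmodType R) (n : nat) (wt : 'I_n.+1 -> R) (v : nat -> V).
Variable phi : nat -> T -> nat.
Hypothesis mphi : forall j m, measurable [set w | phi j w = m].
Hypothesis phin : forall j w, (phi j w <= n)%N.
Hypothesis indep : forall t : seq 'I_n.+1,
  P [set w | [seq phi j w | j <- iota 0 (size t)] = [seq val i | i <- t]] =
  (\prod_(i <- t) wt i)%:E.

Let vbar := wmean wt (fun i => v i).

Lemma cavg_linear M (c : 'I_n.+1 -> R) (g : 'I_n.+1 -> V -> R) :
  cavg wt (fun i => v i) M (fun x => \sum_i c i * g i x) =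
  \sum_i c i * cavg wt (fun i => v i) M (g i).
Proof.
elim: M g => //= M IH g; rewrite -IH; congr cavg; apply/funext => x.
under eq_bigr do rewrite mulr_sumr.
rewrite exchange_big/=; apply: eq_bigr => i _; rewrite mulr_sumr.
by apply: eq_bigr => j _; rewrite mulrCA.
Qed.

(* The indices sampled after time [M] are frozen to [t], so that the induction
   on [M] can absorb the last remaining sample into [t]. *)
Lemma integral_sampling_in M (g : V -> R) (t : seq 'I_n.+1) : (forall x, 0 <= g x) ->
  (\int[P]_(w in [set w | [seq phi j w | j <- iota M (size t)] = [seq val i | i <- t]])
     (g (\sum_(i <- [seq phi j w | j <- iota 0 M]) (v i - vbar)))%:E =
   ((\prod_(i <- t) wt i) * cavg wt (fun i => v i) M g)%:E)%E.
Proof.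
elim: M g t => [|M IH] g t g0.
  under eq_integral do rewrite big_nil.
  rewrite integral_cst; last exact: measurable_seq_fiber.
  by rewrite /= indep -EFinM mulrC.
have mG l (G : seq nat -> R) : measurable_fun setT (fun w => G [seq phi j w | j <- l]).
  exact: measurable_seq_fun.
rewrite (@ge0_integral_split _ (phi M) n).
- rewrite [cavg _ _ M.+1 g]/= cavg_linear mulr_sumr -sumEFin; apply: eq_bigr => i _.
  have e : \prod_(j <- i :: t) wt j = wt i * \prod_(j <- t) wt j by rewrite big_cons.
  rewrite mulrA [_ * wt i]mulrC -e.
  rewrite -(IH (fun x => g (x + (v i - vbar))) (i :: t) (fun x => g0 _)).
  rewrite (_ : _ `&` _ = [set w | [seq phi j w | j <- iota M (size (i :: t))] = [seq val i0 | i0 <- i :: t]]).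
    apply: eq_integral => w; rewrite inE => h; have wi : phi M w = i by case: h.
    by rewrite -[M.+1]addn1 iotaD map_cat big_cat big_seq1 add0n wi.
  by apply/seteqP; split=> w /= [-> ->].
- exact: measurable_seq_fiber.
- exact: mphi.
- exact: phin.
- exact: (mG (iota 0 M.+1) (fun s => g (\sum_(i <- s) (v i - vbar)))).
- by [].
Qed.

Lemma integral_sampling M (g : V -> R) : (forall x, 0 <= g x) ->
  (\int[P]_w (g (\sum_(j < M) (v (phi j w) - vbar)))%:E =
   (cavg wt (fun i => v i) M g)%:E)%E.
Proof.
move=> g0; have := @integral_sampling_in M g [::] g0.
rewrite big_nil mul1r /= (_ : [set _ | _] = setT); last by apply/seteqP; split.
move=> <-; apply: eq_integral => w _; rewrite big_map.
by rewrite -(big_mkord xpredT (fun j => v (phi j w) - vbar)) /index_iota subn0.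
Qed.

End Sampling.
End FiniteSampling.

Lemma wconvex_norm_powR (R : realType) (V : normedModType R) (n : nat) (w : 'I_n -> R) (q : R) :
  1 <= q -> (forall i, 0 <= w i) -> \sum_i w i = 1 ->
  wconvex w (fun x : V => `|x| `^ q).
Proof.
move=> q1 w0 w1; have q0 : 0 <= q by lra.
split=> [y|x y].
  apply: le_trans (powR_jensen q1 w0 (fun i => normr_ge0 (y i)) w1).
  apply: ler_powR_base => //; apply: le_trans (ler_norm_sum _ _ _) _.
  by apply: ler_sum => i _; rewrite normrZ ger0_norm.
have := @powR_jensen R bool [:: true; false] (fun=> 2^-1) (fun b => if b then `|x| else `|y|) q q1.
rewrite !big_cons !big_nil !addr0 => h; apply: (@le_trans _ _ ((2^-1 * `|x| + 2^-1 * `|y|) `^ q)).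
  apply: ler_powR_base => //; rewrite -mulrDr normrZ ger0_norm ?invr_ge0// ler_wpM2l ?invr_ge0//.
  exact: ler_normD.
rewrite [leRHS]mulrC mulrDr; apply: h => [b|[]|]//.
by rewrite -mulr2n -[LHS]mulr_natr mulVf.
Qed.

Section MonteCarlo.
Context (R : realType) (d : measure_display) (T : measurableType d).
Variable (P : probability T R).
Hypothesis Pcomplete : measure_is_complete P.
Context (k : nat) (E Fs : completeNormedModType R) (iota_s : tensor_functional k E -> Fs).
Hypothesis k0 : (0 < k)%N.
Hypothesis HFs : is_sym_injective_tensor_product iota_s.
Context (p q tau : R).
Hypotheses (p1 : 1 <= p) (p2 : p <= 2) (pq : p <= q) (tau0 : 0 <= tau).
Hypothesis tb : type_bound E p tau.

Lemma measurable_zeta (X Y : T -> E) : bochner_measurable P X -> bochner_measurable P Y ->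
  measurable_fun setT (fun w => zeta k (X w, Y w)).
Proof.
move=> mX mY; apply: measurable_funM.
  by apply: (measurable_bochner_norm Pcomplete (f := fun w => X w - Y w)); exact: bochnerB.
apply: measurable_funX; apply: measurable_maxr; exact: (measurable_bochner_norm Pcomplete).
Qed.

Lemma moment_const_ge0 : 0 <= moment_const k p q tau.
Proof.
by rewrite /moment_const !mulr_ge0 ?powR_ge0// addr_ge0// expR_ge0.
Qed.

(** Samples and mean are replaced, up to an arbitrary [e], by values on finitely many cells. For
    these, symmetrization and [ravg_power_diff_powR] give the rate M^(1/p) of the sum. The 2 in
    [2 * B] pays for the slack in the choice of representatives. *)
Lemma monte_carlo (X Y : T -> E) (m : Fs) (eta : nat -> T -> Fs) (B : R) (M : nat) :
  bochner_measurable P X -> bochner_measurable P Y ->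
  is_bochner_integral P (fun w => power_diff iota_s (X w, Y w)) m ->
  0 < B -> (\int[P]_w (zeta k (X w, Y w) `^ q)%:E <= B%:E)%E ->
  (forall j, in_Lq P q (eta j)) ->
  independent_copies P (fun w => power_diff iota_s (X w, Y w)) eta -> (0 < M)%N ->
  (Lq_norm P q (fun w => (m - M%:R^-1 *: \sum_(j < M) eta j w)%R) <=
   ((moment_const k p q tau * (2 * B)) `^ q^-1 * M%:R `^ (p^-1 - 1))%R%:E)%E.
Proof.
set xi := fun w => power_diff iota_s (X w, Y w).
move=> mX mY xim B0 ZB etaL [eta_ind eta_dist] M0.
have q1 : 1 <= q by exact: le_trans pq.
have q0 : 0 < q by exact: lt_le_trans q1.
have qn0 : q != 0 by rewrite gt_eqF.
have p0 : 0 < p by exact: lt_le_trans p1.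
have [mxi _] := xim.
have meta j : bochner_measurable P (eta j) by case: (etaL j).
pose Z w := zeta k (X w, Y w).
have mZ : measurable_fun setT (fun w => Z w `^ q).
  exact: measurableT_comp (measurable_powR q) (measurable_zeta mX mY).
have ZI : (\int[P]_w (Z w `^ q)%:E < +oo)%E by exact: le_lt_trans ZB (ltry _).
have xiq : (\int[P]_w (`|xi w| `^ q)%:E < +oo)%E.
  apply: (@le_lt_trans _ _ (\int[P]_w ((k%:R `^ q * Z w `^ q)%R)%:E)%E).
    apply: ge0_integral_le.
    - exact/measurable_EFinP/(measurable_bochner_powR Pcomplete).
    - exact: measurable_funM.
    - move=> w; rewrite powR_ge0 /= -powRM ?zeta_ge0//.
      by apply: ler_powR_base; [exact: ltW| |exact: norm_power_diff].
  under eq_integral do rewrite EFinM.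
  rewrite (ge0_integralZl_EFin P measurableT _ _ (powR_ge0 _ _)).
  - by rewrite lte_mul_pinfty// lee_fin powR_ge0.
  - by move=> w _; rewrite lee_fin powR_ge0.
  - exact/measurable_EFinP.
have xi1 : (\int[P]_w (`|xi w| `^ 1)%:E < +oo)%E.
  exact: (integral_powR_lty Pcomplete mxi _ q1).
have etaq j : (\int[P]_w (`|eta j w| `^ q)%:E < +oo)%E.
  by apply: Lq_norm_ltyP => //; case: (etaL j).
have [c ae_c] := bochner_centers (meta 0%N).
apply/lee_addgt0Pr => e e0.
(* After division by M, discretizing the samples and the mean costs 4r each. *)
pose r := e / 8.
have r0 : 0 < r by rewrite divr_gt0.
(* The centers are chosen for [eta 0] only. The union of balls is Borel, so having probability one
   passes to [xi] and to all other copies by equality in law. *)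
pose S := \bigcup_i [set u : Fs | `|u - c i| < r].
have oS : open S.
  apply: bigcup_open => i _.
  have -> : [set u : Fs | `|u - c i| < r] = (fun u : Fs => `|u - c i|) @^-1` [set y | y < r] by [].
  apply: open_comp; last exact: open_lt.
  by move=> x _; apply: cvg_norm; apply: cvgB; [exact: cvg_id|exact: cvg_cst].
have bS : borel S by exact: sub_sigma_algebra.
have ae_near f : bochner_measurable P f -> P (f @^-1` S) = 1%E ->
    {ae P, forall w, exists i, `|f w - c i| < r}.
  move=> mf PS; have mS := bochner_preimage_borel Pcomplete mf bS.
  exists (~` (f @^-1` S)); split; first exact: measurableC.
    by rewrite probability_setC// PS subee.
  by move=> w /= h [i _ hi]; apply: h; exists i.
have S0 : P (eta 0%N @^-1` S) = 1%E.
  have mS := bochner_preimage_borel Pcomplete (meta 0%N) bS.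
  have NS : P (~` (eta 0%N @^-1` S)) = 0%E.
    apply: measure_negligible; first exact: measurableC.
    apply: negligibleS ae_c => w /= h h'; apply: h.
    by have [i hi] := h' _ r0; exists i.
  by rewrite -[eta 0%N @^-1` S]setCK probability_setC ?NS ?sube0//; exact: measurableC.
have Sxi : P (xi @^-1` S) = 1%E by rewrite -(eta_dist 0%N _ bS).
have Seta j : P (eta j @^-1` S) = 1%E by rewrite (eta_dist j _ bS).
have r2 (s : R) : 0 < (2 * r) `^ s by rewrite powR_gt0// mulr_gt0.
(* One n serves [xi] and the copies with index below M, as these are finitely many. *)
have [n [n_xi n_eta]] : exists n,
    (\int[P]_w ((cell_index c r n (xi w) == n)%:R * `|xi w| `^ 1)%R%:E < ((2 * r) `^ 1)%:E)%E /\
    (forall j : 'I_M, \int[P]_w ((cell_index c r n (eta j w) == n)%:R * `|eta j w| `^ q)%R%:E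
       < ((2 * r) `^ q)%:E)%E.
  have h1 := cell_tail Pcomplete mxi xi1 (ae_near _ mxi Sxi) (r2 1).
  have h2 : \forall n \near \oo, forall j : 'I_M,
      (\int[P]_w ((cell_index c r n (eta j w) == n)%:R * `|eta j w| `^ q)%R%:E
       < ((2 * r) `^ q)%:E)%E.
    apply: filter_forall => j.
    exact: (cell_tail Pcomplete (meta j) (etaq j) (ae_near _ (meta j) (Seta j)) (r2 q)).
  exact: filter_ex (filterI h1 h2).
pose idx := cell_index c r n.
pose cell i := [set w | idx (xi w) = i].
have mcell i : measurable (cell i) by exact: (measurable_cell Pcomplete).
(* The slack of one cell; over the n + 1 cells it adds up to [B]. *)
pose de := B / n.+1%:R.
have de0 : 0 < de by rewrite divr_gt0.
have fIc i : (\int[P]_(w in cell i) (Z w `^ q)%:E < +oo)%E.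
  apply: le_lt_trans ZI; apply: ge0_subset_integral => //.
    exact/measurable_EFinP.
  by move=> w _; rewrite lee_fin powR_ge0.
(* Representatives are pairs of values of [X] and [Y] at one point of the cell. Their tensor
   difference lies in the cell, and their [zeta] is controlled by the average over it. *)
have [z Hz] : {z : nat -> E * E & forall i,
    [/\ (i < n)%N -> P (cell i) = 0%E \/ idx (power_diff iota_s (z i)) = i,
        i = n -> power_diff iota_s (z i) = 0 &
        fine (P (cell i)) * zeta k (z i) `^ q <=
        fine (\int[P]_(w in cell i) (Z w `^ q)%:E)%E + de]}.
  suff H i : {z : E * E |
    [/\ (i < n)%N -> P (cell i) = 0%E \/ idx (power_diff iota_s z) = i,
        i = n -> power_diff iota_s z = 0 &
        fine (P (cell i)) * zeta k z `^ q <=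
        fine (\int[P]_(w in cell i) (Z w `^ q)%:E)%E + de]}.
    by exists (fun i => sval (H i)) => i; exact: (svalP (H i)).
  apply: cid.
  have [[ilt Pi]|ni] := pselect ((i < n)%N /\ P (cell i) != 0%E).
    have [w cw hw] := exists_le_average (mcell i) Pi mZ (fun w => powR_ge0 _ _) (fIc i) de0.
    exists (X w, Y w); split=> //; first by move=> _; right.
    by move=> ein; rewrite ein ltnn in ilt.
  (* A pair with vanishing [zeta] and tensor difference, for null cells and for the indices from n
     on. *)
  exists (0, 0); split.
  - move=> ilt; left; apply: contrapT => h; apply: ni; split=> //; exact/eqP.
  - by move=> _; rewrite /power_diff subrr.
  - rewrite /zeta subrr normr0 mul0r powR0// mulr0 addr_ge0//; last exact: ltW.
    by apply: fine_ge0; apply: integral_ge0 => w _; rewrite lee_fin powR_ge0.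
pose v i := power_diff iota_s (z i).
have vn : v n = 0 by have [_ h _] := Hz n; exact: h.
pose wt (i : 'I_n.+1) := fine (P (cell i)).
have wt0 i : 0 <= wt i by exact: fine_ge0.
have wtE (i : 'I_n.+1) : P (cell i) = (wt i)%:E by rewrite fineK// fin_num_measure.
have wt1 : \sum_i wt i = 1.
  have := @ge0_integral_split _ _ _ P setT (fun w => idx (xi w)) n (fun=> 1) measurableT mcell
    (fun w => cell_index_le c r n (xi w)) (measurable_cst _) (fun=> ler01).
  rewrite integral_cst// [X in (_ * X)%E](@probability_setT _ _ _ P) mule1.
  rewrite [RHS](eq_bigr (fun i => (wt i)%:E)) ?sumEFin; first by move=> -[].
  move=> i _; rewrite setTI -wtE (_ : (fun=> _) = cst 1%E)//.
  by rewrite integral_cst; [rewrite mul1e|exact: mcell].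
pose vbar := wmean wt (fun i => v i).
have err_eta (j : 'I_M) :
    (Lq_norm P q (fun w => (eta j w - discretize c r n v (eta j w))%R) <= (4 * r)%:E)%E.
  apply/Lq_norm_leP => //; first by rewrite mulr_ge0// ltW.
  apply: le_trans (discretize_error Pcomplete vn (meta j) q0 r0 _) _.
    move=> i ilt; have [h _ _] := Hz i; have [Pi|vi] := h ilt; last by right.
    by left; rewrite -Pi; exact: (eta_dist j _ (borel_cell c r n i)).
  apply: le_trans (leeD2l _ (ltW (n_eta j))) _; rewrite -EFinD lee_fin.
  have -> : 4 * r = 2 * (2 * r) by ring.
  have r20 : 0 <= 2 * r by rewrite mulr_ge0// ltW.
  rewrite [leRHS](powRM _ (ler0n _ 2) r20) -[X in X <= _]mulr2n -[X in X <= _]mulr_natl.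
  rewrite ler_wpM2r ?powR_ge0//.
  by rewrite -[X in X <= _](powRr1 (ler0n R 2)) ler_powR// ler1n.
have vbarE : vbar = simple_integral P (discretize_data c r n v xi).
  rewrite /simple_integral big_map /vbar /wmean.
  by rewrite -(big_mkord xpredT (fun i => fine (P (cell i)) *: v i)) /index_iota subn0.
have err_mean : `|vbar - m| <= 4 * r.
  rewrite distrC vbarE -lee_fin.
  have h0 := bochner_integral_dist Pcomplete xim (@simple_data_discretize _ _ _ _ Pcomplete _ c r n v xi mxi).
  apply: le_trans h0 _.
  have := @discretize_error _ _ _ _ Pcomplete _ c r n v vn xi 1 mxi ltr01 r0.
  have -> : (\int[P]_w (`|xi w - discretize c r n v (xi w)| `^ 1)%R%:E)%E =
      (\int[P]_w (`|xi w - simple_eval (discretize_data c r n v xi) w|)%R%:E)%E.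
    by apply: eq_integral => w _; rewrite simple_eval_discretize powRr1.
  move=> h; apply: le_trans (h _) _ => [i ilt|].
    by have [h' _ _] := Hz i; exact: h'.
  apply: le_trans (leeD2l _ (ltW n_xi)) _; rewrite -EFinD lee_fin powRr1; last by rewrite mulr_ge0// ltW.
  by rewrite -mulrDl -natrD.
pose phi j w := idx (eta j w).
have mphi j i : measurable [set w | phi j w = i] by exact: (measurable_cell Pcomplete).
have indep (t : seq 'I_n.+1) :
    P [set w | [seq phi j w | j <- iota 0 (size t)] = [seq val i | i <- t]] =
    (\prod_(i <- t) wt i)%:E.
  have bB j : borel [set u | idx u = nth 0%N [seq val i | i <- t] j] by exact: borel_cell.
  have := eta_ind (iota 0 (size t)) _ (iota_uniq _ _) bB.
  rewrite (_ : \bigcap_(i in _) _ = [set w | [seq phi j w | j <- iota 0 (size t)] = [seq val i | i <- t]]).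
    move=> ->; rewrite (big_nth ord0) -prodEFin /index_iota subn0.
    rewrite [LHS]big_seq [RHS]big_seq; apply: eq_bigr => j.
    rewrite mem_iota add0n => /andP[_ jt].
    rewrite (eta_dist j _ (bB j)) -wtE (nth_map ord0)//.
  apply/seteqP; split=> w /=.
    move=> h; apply: (@eq_from_nth _ 0%N); first by rewrite !size_map size_iota.
    move=> j; rewrite size_map size_iota => jt; rewrite (nth_map 0%N) ?size_iota//.
    by rewrite nth_iota// add0n; apply: h => /=; rewrite mem_iota add0n.
  move=> h j /=; rewrite mem_iota add0n => /andP[_ jt]; rewrite -h.
  by rewrite (nth_map 0%N) ?size_iota// nth_iota.
have main : (\int[P]_w (`|\sum_(j < M) (v (phi j w) - vbar)| `^ q)%R%:E <=
    (moment_const k p q tau * M%:R `^ (q / p) * (2 * B))%:E)%E.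
  rewrite (integral_sampling v mphi (fun j w => cell_index_le c r n (eta j w)) indep M
    (g := fun x => `|x| `^ q)); last by move=> x; exact: powR_ge0.
  rewrite lee_fin; apply: le_trans (cavg_le_savg _ wt0 wt1 M _) _.
    exact: wconvex_norm_powR.
  (* For fixed indices the Rademacher bound is additive, as [savg_le] requires; the factor M gained
     there raises the exponent q/p - 1 to q/p. *)
  pose Zc (i : 'I_n.+1) := moment_const k p q tau * M%:R `^ (q / p - 1) * zeta k (z i) `^ q.
  apply: le_trans (@savg_le _ _ _ _ _ wt0 wt1 M _ 0 Zc _) _.
    move=> s sM; rewrite add0r.
    have := ravg_power_diff_powR k0 HFs [seq z (val i) | i <- s] p1 p2 pq tau0 tb.
    by rewrite -map_comp size_map sM big_map mulr_sumr.
  rewrite add0r; have Mn0 : (M%:R : R) != 0 by rewrite pnatr_eq0 -lt0n.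
  have -> : M%:R * \sum_i wt i * Zc i =
      moment_const k p q tau * M%:R `^ (q / p) * \sum_i wt i * zeta k (z i) `^ q.
    have -> : q / p = 1 + (q / p - 1) by rewrite addrC subrK.
    rewrite powRD ?Mn0 ?implybT// powRr1// !mulr_sumr; apply: eq_bigr => i _.
    by rewrite /Zc; ring.
  rewrite ler_wpM2l ?mulr_ge0 ?moment_const_ge0 ?powR_ge0//.
  apply: (@le_trans _ _ (\sum_(i < n.+1) (fine (\int[P]_(w in cell i) (Z w `^ q)%:E)%E + de))).
    by apply: ler_sum => i _; have [_ _ h] := Hz i.
  rewrite big_split/= sumr_const card_ord -[de *+ _]mulr_natr divfK ?pnatr_eq0//.
  rewrite mulr_natl mulr2n lerD2r -lee_fin.
  rewrite -sumEFin; apply: le_trans ZB.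
  rewrite (@ge0_integral_split _ _ _ P setT (fun w => idx (xi w)) n (fun w => Z w `^ q))//.
  - rewrite le_eqVlt; apply/orP; left; apply/eqP; apply: eq_bigr => i _.
    rewrite setTI fineK// ge0_fin_numE// integral_ge0// => w _.
    by rewrite lee_fin powR_ge0.
  - by move=> w; exact: cell_index_le.
  - by move=> w; exact: powR_ge0.
set A := (moment_const k p q tau * (2 * B)) `^ q^-1.
have A0 : 0 <= A by exact: powR_ge0.
have mdis (j : 'I_M) : bochner_measurable P (fun w => discretize c r n v (eta j w)).
  exact: bochner_discretize.
have sum_le : (Lq_norm P q (fun w => (\sum_(j < M) (v (phi j w) - vbar))%R) <=
    (A * M%:R `^ p^-1)%:E)%E.
  apply/Lq_norm_leP => //; first by rewrite mulr_ge0// powR_ge0.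
  apply: le_trans main _; rewrite lee_fin powRM ?powR_ge0// /A -!powRrM mulVf//.
  rewrite [p^-1 * q]mulrC powRr1; first by rewrite mulrAC.
  by rewrite mulr_ge0 ?moment_const_ge0// mulr_ge0// ltW.
have m1 (j : 'I_M) : bochner_measurable P (fun w => v (phi j w) - vbar).
  by apply: bochnerB; [exact: mdis|exact: bochner_cst].
have m2 (j : 'I_M) : bochner_measurable P (fun w => eta j w - discretize c r n v (eta j w)).
  exact: bochnerB.
have total : (Lq_norm P q (fun w => (\sum_(j < M) (v (phi j w) - vbar) +
    (\sum_(j < M) (eta j w - discretize c r n v (eta j w)) + M%:R *: (vbar - m)))%R) <=
    (A * M%:R `^ p^-1 + (\sum_(j < M) (4 * r) + M%:R * (4 * r)))%:E)%E.
  apply: Lq_norm_leD => //; first exact: bochner_sum.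
    by apply: bochnerD; [exact: bochner_sum|exact: bochner_cst].
  apply: Lq_norm_leD => //; [exact: bochner_sum|exact: bochner_cst|exact: Lq_norm_le_sum|].
  apply: le_trans (Lq_norm_cst _ _ q0) _.
  by rewrite lee_fin normrZ normr_nat ler_wpM2l.
have Mn0 : (M%:R : R) != 0 by rewrite pnatr_eq0 -lt0n.
(* -M times the error is the centered discretized sum, plus the discretization errors of the
   samples, plus M times the error of the mean. *)
have fE : (fun w => m - M%:R^-1 *: \sum_(j < M) eta j w) =
   (fun w => (- M%:R^-1) *: (\sum_(j < M) (v (phi j w) - vbar) +
    (\sum_(j < M) (eta j w - discretize c r n v (eta j w)) + M%:R *: (vbar - m)))).
  apply/funext => w; rewrite !sumrB sumr_const card_ord.
  have alg (a b g f : Fs) : (a - b) + ((g - a) + (b - f)) = g - f.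
    by rewrite addrCA subrKA subrKA.
  rewrite scalerBr [M%:R *: vbar]scaler_nat alg.
  by rewrite scaleNr scalerBr scalerA mulVf// scale1r opprB.
have r40 : 0 <= 4 * r by rewrite mulr_ge0// ltW.
have b0 : 0 <= A * M%:R `^ p^-1 + (\sum_(j < M) (4 * r) + M%:R * (4 * r)).
  apply: addr_ge0; first by apply: mulr_ge0 => //; exact: powR_ge0.
  by apply: addr_ge0; [exact: sumr_ge0|exact: mulr_ge0].
have btot : bochner_measurable P (fun w => \sum_(j < M) (v (phi j w) - vbar) +
    (\sum_(j < M) (eta j w - discretize c r n v (eta j w)) + M%:R *: (vbar - m))).
  by apply: bochnerD; [exact: bochner_sum|apply: bochnerD; [exact: bochner_sum|exact: bochner_cst]].
rewrite fE; apply: le_trans (Lq_norm_leZ Pcomplete _ q0 b0 btot total) _.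
rewrite -EFinD lee_fin normrN normfV normr_nat sumr_const card_ord -[(4 * r) *+ M]mulr_natl.
rewrite powRD ?Mn0 ?implybT// powR_inv1// mulrDr [leRHS]addrC addrC lerD//.
  by rewrite mulrC mulrA.
by rewrite -mulrDr mulKf// -mulrDl -natrD /r mulrC divfK.
Qed.

End MonteCarlo.

(** * Choice of levels and sample sizes *)

Section LevelSelection.
Context (R : realType).

Lemma geometric_sumE (rho : R) (L : nat) :
  (\sum_(1 <= l < L.+1) rho ^+ l) * (1 - rho) = rho - rho ^+ L.+1.
Proof.
elim: L => [|L IH]; first by rewrite big_geq// mul0r expr1 subrr.
by rewrite big_nat_recr//= mulrDl IH [in RHS]exprS; ring.
Qed.

Lemma geometric_sum_lt1 (rho : R) (L : nat) : 0 <= rho -> rho < 1 ->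
  \sum_(1 <= l < L.+1) rho ^+ l <= (1 - rho)^-1.
Proof.
move=> r0 r1; have h : 0 < 1 - rho by lra.
rewrite -(ler_pM2r h) geometric_sumE mulVf ?gt_eqF//.
by have := exprn_ge0 L.+1 r0; lra.
Qed.

Lemma geometric_sum_gt1 (rho : R) (L : nat) : 1 < rho ->
  \sum_(1 <= l < L.+1) rho ^+ l <= rho / (rho - 1) * rho ^+ L.
Proof.
move=> r1; have h : 0 < rho - 1 by lra.
rewrite -(ler_pM2r h) mulrAC divfK ?gt_eqF// -exprS.
by have := geometric_sumE rho L; lra.
Qed.

Lemma powR_nat (A x : R) (l : nat) : A `^ (x * l%:R) = (A `^ x) ^+ l.
Proof. by rewrite powRrM powR_mulrn// powR_ge0. Qed.

Lemma powR_inv_base (a x : R) : 0 < a -> a^-1 `^ x = a `^ (- x).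
Proof. by move=> a0; rewrite -(powR_inv1 (ltW a0)) -powRrM mulN1r. Qed.

Lemma powR_powR_inv (a x : R) : 0 <= a -> x != 0 -> (a `^ x) `^ x^-1 = a.
Proof. by move=> a0 x0; rewrite -powRrM divff// powRr1. Qed.

Section Choice.
Context (alpha beta gamma A p' K1 K2 K3 : R).
Hypotheses (alpha0 : 0 < alpha) (beta0 : 0 < beta) (gamma0 : 0 < gamma) (A1 : 1 < A).
Hypotheses (p'2 : 2 <= p') (K10 : 0 < K1) (K20 : 0 < K2) (K30 : 0 < K3).

Let A0 : 0 < A. Proof. exact: lt_trans A1. Qed.
Let An0 : A != 0. Proof. by rewrite gt_eqF. Qed.
Let lnA0 : 0 < ln A. Proof. exact: ln_gt0. Qed.
Let p'0 : 0 < p'. Proof. exact: lt_le_trans p'2. Qed.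

Let AD x y : A `^ (x + y) = A `^ x * A `^ y.
Proof. by rewrite powRD// An0 implybT. Qed.

Let A_gt1 (x : R) : 0 < x -> 1 < A `^ x.
Proof.
move=> x0; have e : 1 `^ x = 1 :> R by rewrite powR1.
rewrite -[X in X < _]e.
by apply: gt0_ltr_powR => //; rewrite nnegrE// ltW.
Qed.

(** At least [4 * K1], for a bias of at most eps/4, and at least 1, so that K/eps has a nonnegative
    logarithm. *)
Let K := 4 * K1 + 1.
Let K_ge1 : 1 <= K. Proof. by rewrite lerDr mulr_ge0// ltW. Qed.
Let K_gt0 : 0 < K. Proof. exact: lt_le_trans K_ge1. Qed.
Let kappa := (gamma - beta * p') / (p' + 1).

(** [L] is the first integer above the t with A^(alpha t) = K/eps, so rounding costs A^(x L) at most
    a factor A^x. *)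
Lemma level_choice (eps : R) : 0 < eps -> eps <= 2^-1 ->
  exists L : nat, [/\ (0 < L)%N, K1 * A `^ (- alpha * L%:R) <= eps / 4,
    forall x, 0 <= x -> A `^ (x * L%:R) <= A `^ x * K `^ (x / alpha) * eps `^ (- (x / alpha)) &
    L%:R <= ln (K / eps) / (alpha * ln A) + 1].
Proof.
move=> e0 e2; pose t := ln (K / eps) / (alpha * ln A).
have Ke : 1 <= K / eps.
  rewrite ler_pdivlMr// mul1r; apply: le_trans K_ge1; apply: le_trans e2 _.
  by rewrite invf_le1// ler1n.
have Ke0 : 0 < K / eps by rewrite divr_gt0.
have t0 : 0 <= t by rewrite divr_ge0 ?ln_ge0// mulr_ge0// ltW.
have At : A `^ (alpha * t) = K / eps.
  rewrite /powR (negbTE An0) /t.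
  have -> : alpha * (ln (K / eps) / (alpha * ln A)) * ln A = ln (K / eps).
    by field; rewrite !gt_eqF.
  by rewrite lnK// posrE.
have /andP[tl tu] := truncn_itv t0.
exists (Num.truncn t).+1; split=> //.
- rewrite -ler_pdivlMl// mulNr powRN; rewrite [leRHS](_ : _ = (4 * K1 / eps)^-1); last first.
    by field; rewrite !gt_eqF.
  rewrite lef_pV2 ?posrE ?powR_gt0 ?divr_gt0 ?mulr_gt0//.
  apply: (@le_trans _ _ (K / eps)); first by rewrite ler_pM2r ?invr_gt0// lerDl.
  by rewrite -At ler_powR ?(ltW A1)// ler_wpM2l// ltW.
- move=> x x0; apply: (@le_trans _ _ (A `^ (x * (t + 1)))).
    by rewrite ler_powR ?(ltW A1)// ler_wpM2l// -natr1 lerD2r.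
  rewrite mulrDr mulr1 addrC AD -mulrA ler_wpM2l ?powR_ge0//.
  have -> : x * t = alpha * t * (x / alpha) by field; rewrite gt_eqF.
  by rewrite powRrM At powRM ?invr_ge0 ?(ltW K_gt0) ?(ltW e0)// powR_inv_base.
- by rewrite -natr1 lerD2r.
Qed.

Definition level_sum (L : nat) : R := \sum_(1 <= l < L.+1) A `^ (kappa * l%:R).

Lemma level_sum_gt0 L : (0 < L)%N -> 0 < level_sum L.
Proof.
move=> L0; rewrite /level_sum big_ltn//; apply: ltr_pwDl; first exact: powR_gt0.
by apply: sumr_ge0 => l _; exact: powR_ge0.
Qed.

(* The sample sizes minimize the cost for a prescribed sum of level errors, up
   to rounding. *)
Lemma sample_choice (eps : R) (L : nat) : 0 < eps -> (0 < L)%N ->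
  exists M : nat -> nat, [/\ forall l, (0 < M l)%N,
    \sum_(1 <= l < L.+1) K2 * A `^ (- beta * l%:R) * (M l)%:R `^ (- p'^-1) <= eps / 4 &
    \sum_(1 <= l < L.+1) K3 * A `^ (gamma * l%:R) * (M l)%:R <=
      K3 * \sum_(1 <= l < L.+1) A `^ (gamma * l%:R) +
      K3 * (4 * K2) `^ p' * eps `^ (- p') * level_sum L `^ (p' + 1)].
Proof.
move=> e0 L0; set S := level_sum L.
have S0 : 0 < S by exact: level_sum_gt0.
have pn0 : p' != 0 by rewrite gt_eqF.
have pn1 : p' + 1 != 0 by rewrite gt_eqF// addr_gt0.
pose th := 4 * K2 / eps.
have th0 : 0 < th by rewrite divr_gt0// mulr_gt0.
(* The p'-th root of the ideal sample size, scaled so that the level errors are (eps/4) A^(kappa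
   l)/S and add up to eps/4. *)
pose y l := th * A `^ (- ((beta + gamma) / (p' + 1) * l%:R)) * S.
have y0 l : 0 < y l by rewrite /y mulr_gt0// mulr_gt0// powR_gt0.
(* Rounding up keeps every size positive. It adds at most one sample per level, which is the first
   sum in the cost. *)
pose M l := (Num.truncn (y l `^ p')).+1.
have xM l : y l `^ p' <= (M l)%:R <= y l `^ p' + 1.
  have /andP[h1 h2] := truncn_itv (powR_ge0 (y l) p').
  by rewrite (ltW h2) /= /M -natr1 lerD2r.
exists M; split=> //.
- apply: (@le_trans _ _ (\sum_(1 <= l < L.+1) (eps / 4 / S) * A `^ (kappa * l%:R))).
    apply: ler_sum => l _; apply: (@le_trans _ _ (K2 * A `^ (- beta * l%:R) * (y l)^-1)).
      apply: ler_wpM2l; first by rewrite mulr_ge0 ?powR_ge0// ltW.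
      have yE : y l = (y l `^ p') `^ p'^-1 by rewrite powR_powR_inv// ltW.
      rewrite powRN lef_pV2 ?posrE ?powR_gt0// ?ltr0n//.
      by rewrite yE; apply: ler_powR_base; rewrite ?invr_ge0 ?powR_ge0 ?(ltW p'0)//; case/andP: (xM l).
    (* With this identity and its analogue for the cost below, the error and the unrounded cost of
       level l are both proportional to A^(kappa l). *)
    have -> : kappa * l%:R = (- beta * l%:R) + ((beta + gamma) / (p' + 1)) * l%:R.
      by rewrite /kappa; field.
    rewrite AD /y mulNr !powRN /th.
    set b := A `^ ((beta + gamma) / (p' + 1) * _).
    have b0 : 0 < b by exact: powR_gt0.
    set a := A `^ (beta * _); have a0 : 0 < a by exact: powR_gt0.
    rewrite le_eqVlt; apply/orP; left; apply/eqP; field.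
    by rewrite !gt_eqF.
  by rewrite -mulr_sumr -/(level_sum L) -/S divfK// gt_eqF.
- apply: (@le_trans _ _ (\sum_(1 <= l < L.+1) (K3 * A `^ (gamma * l%:R) +
      K3 * th `^ p' * S `^ p' * A `^ (kappa * l%:R)))).
    apply: ler_sum => l _.
    apply: (@le_trans _ _ (K3 * A `^ (gamma * l%:R) * (y l `^ p' + 1))).
      by apply: ler_wpM2l; [rewrite mulr_ge0 ?powR_ge0// ltW|case/andP: (xM l)].
    have -> : kappa * l%:R = gamma * l%:R + - ((beta + gamma) / (p' + 1) * l%:R) * p'.
      by rewrite /kappa; field.
    rewrite AD [A `^ (_ * p')]powRrM /y (powRM _ (mulr_ge0 (ltW th0) (powR_ge0 _ _)) (ltW S0)).
    rewrite (powRM _ (ltW th0) (powR_ge0 _ _)).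
    by rewrite le_eqVlt; apply/orP; left; apply/eqP; ring.
  rewrite big_split/= -!mulr_sumr -/(level_sum L) -/S lerD2l.
  rewrite powRD; last by rewrite (gt_eqF S0) implybT.
  rewrite powRr1 ?(ltW S0)// /th powRM ?invr_ge0 ?(ltW e0)//; last by rewrite mulr_ge0// ltW.
  by rewrite powR_inv_base// le_eqVlt; apply/orP; left; apply/eqP; ring.
Qed.

(** The three regimes are the signs of [kappa]: the level sum is bounded, equals L, or has the order
    of A^(kappa L). In the middle case L is of order |log eps|, whence the logarithm to the power p'
    + 1. *)
Lemma level_sum_rate : exists C : R, 0 < C /\
  forall (eps : R) (L : nat), 0 < eps -> eps <= 2^-1 -> (0 < L)%N ->
    (forall x, 0 <= x -> A `^ (x * L%:R) <= A `^ x * K `^ (x / alpha) * eps `^ (- (x / alpha))) ->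
    L%:R <= ln (K / eps) / (alpha * ln A) + 1 ->
  eps `^ (- (gamma / alpha)) + eps `^ (- p') * level_sum L `^ (p' + 1) <=
    C * mlmc_rate alpha beta gamma A p' eps.
Proof.
have pp1 : 0 < p' + 1 by rewrite addr_gt0.
(* The term eps^(-gamma/alpha) occurs on both sides; without it each regime concerns the level sum
   alone. *)
have key (c : R) : 0 < c ->
  (forall (eps : R) (L : nat), 0 < eps -> eps <= 2^-1 -> (0 < L)%N ->
    (forall x, 0 <= x -> A `^ (x * L%:R) <= A `^ x * K `^ (x / alpha) * eps `^ (- (x / alpha))) ->
    L%:R <= ln (K / eps) / (alpha * ln A) + 1 ->
    eps `^ (- p') * level_sum L `^ (p' + 1) <=
     c * (mlmc_rate alpha beta gamma A p' eps - eps `^ (- (gamma / alpha)))) ->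
  exists C : R, 0 < C /\
  forall (eps : R) (L : nat), 0 < eps -> eps <= 2^-1 -> (0 < L)%N ->
    (forall x, 0 <= x -> A `^ (x * L%:R) <= A `^ x * K `^ (x / alpha) * eps `^ (- (x / alpha))) ->
    L%:R <= ln (K / eps) / (alpha * ln A) + 1 ->
  eps `^ (- (gamma / alpha)) + eps `^ (- p') * level_sum L `^ (p' + 1) <=
    C * mlmc_rate alpha beta gamma A p' eps.
  move=> c0 H; exists (1 + c); split; first by rewrite addr_gt0.
  move=> eps L e0 e2 L0 h1 h2; have h := H eps L e0 e2 L0 h1 h2.
  set a := eps `^ (- (gamma / alpha)) in h *; set r := mlmc_rate _ _ _ _ _ _ in h *.
  have a0 : 0 <= a by exact: powR_ge0.
  have ra : a <= r.
    rewrite /r /mlmc_rate; case: ifP => _; first by rewrite lerDl powR_ge0.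
    by case: ifP => _; rewrite lerDl ?mulr_ge0 ?powR_ge0.
  by apply: le_trans (lerD (lexx a) h) _; nra.
have [gb|bg] := ltP gamma (beta * p').
  have k0 : kappa < 0 by rewrite /kappa pmulr_llt0 ?invr_gt0// subr_lt0.
  have rho1 : A `^ kappa < 1.
    by rewrite -[kappa]opprK powRN invf_lt1 ?powR_gt0// A_gt1// oppr_gt0.
  pose c := (1 - A `^ kappa)^-1 `^ (p' + 1).
  have c0 : 0 < c by rewrite powR_gt0// invr_gt0; lra.
  apply: (key c c0) => eps L e0 e2 L0 h1 h2.
  rewrite /mlmc_rate gb [X in _ <= _ * X]addrAC subrr add0r mulrC ler_wpM2r ?powR_ge0//.
  apply: ler_powR_base; [exact: ltW|exact/ltW/level_sum_gt0|].
  rewrite /level_sum; under eq_bigr do rewrite powR_nat.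
  by apply: geometric_sum_lt1 => //; exact: powR_ge0.
have [gb|gb] := eqVneq (beta * p') gamma.
  have ln2 : 0 < ln 2 :> R by rewrite ln_gt0// ltr1n.
  have K0 : 0 <= ln K by rewrite ln_ge0.
  (* As eps <= 1/2, ln 2 <= -ln eps, so the additive constants in the bound on L are absorbed into
     multiples of |ln eps|. *)
  pose c := (ln K / ln 2 + 1) / alpha + ln A / ln 2.
  have c0 : 0 < c.
    apply: addr_gt0; apply: divr_gt0 => //; apply: ltr_wpDl => //.
    exact: divr_ge0 K0 (ltW ln2).
  apply: (key (c `^ (p' + 1))); first exact: powR_gt0.
  move=> eps L e0 e2 L0 h1 h2.
  rewrite /mlmc_rate gb ltxx eqxx [X in _ <= _ * X]addrAC subrr add0r.
  rewrite mulrCA ler_wpM2l ?powR_ge0// -powRM ?(ltW c0)//.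
  apply: ler_powR_base; [exact: ltW|exact/ltW/level_sum_gt0|].
  have -> : level_sum L = L%:R.
    rewrite /level_sum /kappa gb subrr mul0r; under eq_bigr do rewrite mul0r powRr0.
    by rewrite sumr_const_nat subSS subn0.
  apply: le_trans h2 _.
  have lneps : ln 2 <= - ln eps.
    by rewrite -lnV ?posrE// ler_ln ?posrE ?invr_gt0// -[X in X <= _]invrK lef_pV2 ?posrE ?invr_gt0.
  rewrite normrM (ltr0_norm (_ : ln eps < 0)); last by lra.
  rewrite normfV (gtr0_norm lnA0) ln_div ?posrE//.
  set u := - ln eps in lneps *.
  have hK : ln K <= ln K / ln 2 * u.
    by rewrite mulrAC ler_pdivlMr// ler_wpM2l.
  have -> : c * (u / ln A) = (ln K / ln 2 * u + u) / (alpha * ln A) + u / ln 2.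
    by rewrite /c; field; rewrite !gt_eqF.
  apply: lerD; last by rewrite ler_pdivlMr// mul1r.
  by rewrite ler_wpM2r ?lerD// invr_ge0 mulr_ge0// ltW.
have {gb}bg : beta * p' < gamma by rewrite lt_neqAle gb.
have k0 : 0 < kappa by rewrite divr_gt0// subr_gt0.
have rho1 : 1 < A `^ kappa by exact: A_gt1.
pose ga := gamma - beta * p'.
have ga0 : 0 < ga by rewrite subr_gt0.
pose G := A `^ kappa / (A `^ kappa - 1).
have G0 : 0 < G by rewrite divr_gt0 ?powR_gt0//; lra.
pose c := G `^ (p' + 1) * (A `^ ga * K `^ (ga / alpha)).
have c0 : 0 < c by rewrite !mulr_gt0 ?powR_gt0.
apply: (key c c0) => eps L e0 e2 L0 h1 h2.
rewrite /mlmc_rate ltNge (ltW bg) /= (lt_eqF bg) [X in _ <= _ * X]addrAC subrr add0r.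
have SL : level_sum L <= G * A `^ (kappa * L%:R).
  rewrite /level_sum; under eq_bigr do rewrite powR_nat.
  by rewrite powR_nat; exact: geometric_sum_gt1.
apply: (@le_trans _ _ (eps `^ (- p') * (G `^ (p' + 1) * A `^ (ga * L%:R)))).
  apply: ler_wpM2l; first exact: powR_ge0.
  have -> : ga * L%:R = kappa * L%:R * (p' + 1).
    by rewrite /kappa /ga; field; rewrite gt_eqF.
  rewrite powRrM -powRM ?powR_ge0 ?(ltW G0)//.
  by apply: ler_powR_base => //; [exact: ltW|exact/ltW/level_sum_gt0].
rewrite -/ga [eps `^ (- p' - _)]powRD; last by rewrite (gt_eqF e0) implybT.
have h := h1 ga (ltW ga0).
rewrite /c -/ga [leRHS]mulrCA; apply: ler_wpM2l; first exact: powR_ge0.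
by rewrite -!mulrA ler_wpM2l ?powR_ge0// mulrA.
Qed.

(** The cost of rounding is a geometric sum of order A^(gamma L), that is eps^(-gamma/alpha); the
    remaining cost is the level sum term of [level_sum_rate]. *)
Lemma mlmc_parameters : exists C : R, 0 < C /\
  forall eps : R, 0 < eps -> eps <= 2^-1 ->
  exists (L : nat) (M : nat -> nat),
  [/\ (0 < L)%N, forall l, (0 < M l)%N,
      K1 * A `^ (- alpha * L%:R) <= eps / 4,
      \sum_(1 <= l < L.+1) K2 * A `^ (- beta * l%:R) * (M l)%:R `^ (- p'^-1) <= eps / 4 &
      \sum_(1 <= l < L.+1) K3 * A `^ (gamma * l%:R) * (M l)%:R <=
        C * mlmc_rate alpha beta gamma A p' eps].
Proof.
have [C [C0 HC]] := level_sum_rate.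
have rho1 : 1 < A `^ gamma by exact: A_gt1.
pose G := A `^ gamma / (A `^ gamma - 1).
have G0 : 0 < G by rewrite divr_gt0 ?powR_gt0//; lra.
pose c1 := K3 * (G * (A `^ gamma * K `^ (gamma / alpha))).
pose c2 := K3 * (4 * K2) `^ p'.
have c10 : 0 < c1 by rewrite /c1 mulr_gt0// mulr_gt0// mulr_gt0// powR_gt0.
have c20 : 0 < c2 by rewrite /c2 mulr_gt0// powR_gt0// mulr_gt0.
exists ((c1 + c2) * C); split; first by rewrite mulr_gt0// addr_gt0.
move=> eps e0 e2; have [L [L0 bias AL Lle]] := level_choice e0 e2.
have [M [M0 err cost]] := sample_choice e0 L0.
exists L, M; split=> //; apply: le_trans cost _.
rewrite -[leRHS]mulrA; apply: le_trans (ler_wpM2l (ltW (addr_gt0 c10 c20)) (HC _ _ e0 e2 L0 AL Lle)).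
set a := eps `^ (- (gamma / alpha)); set b := eps `^ (- p') * _.
have a0 : 0 <= a by exact: powR_ge0.
have b0 : 0 <= b by rewrite mulr_ge0 ?powR_ge0.
have h1 : K3 * \sum_(1 <= l < L.+1) A `^ (gamma * l%:R) <= c1 * a.
  rewrite /c1 -mulrA ler_wpM2l ?(ltW K30)// -mulrA.
  apply: (@le_trans _ _ (G * A `^ (gamma * L%:R))).
    under eq_bigr do rewrite powR_nat.
    by rewrite powR_nat; exact: geometric_sum_gt1.
  by rewrite ler_wpM2l ?(ltW G0)// AL// ltW.
rewrite -[X in _ + X]mulrA -/b -/c2.
by apply: le_trans (lerD h1 (lexx _)) _; nra.
Qed.

End Choice.
End LevelSelection.

(** * Multilevel estimate *)

(** Some admissible constant lies within 1 of the infimum. The resulting bound depends on [tau]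
    alone, as it must because C is chosen before E, and it is positive even when the infimum is
    0. *)
Lemma type_bound_constant (R : realType) (E : completeNormedModType R) (p tau : R) :
  rademacher_type E p -> type_constant E p = tau -> type_bound E p (`|tau| + 1).
Proof.
move=> [t t0 tb] tE.
have hi : has_inf [set u : R | 0 < u /\ type_bound E p u].
  by split; [exists t|exists 0 => u [/ltW]].
have [u [u0 ub] ult] := inf_adherent ltr01 hi.
have utau : u <= `|tau| + 1.
  by rewrite -tE; apply: le_trans (ltW ult) _; rewrite lerD2r; exact: ler_norm.
move=> d T P n r x Pc Pr; apply: le_trans (ub d T P n r x Pc Pr) _.
by rewrite lee_fin ler_wpM2r// powR_ge0.
Qed.

Section LevelVariance.
Context (R : realType) (d : measure_display) (T : measurableType d).
Variable (P : probability T R).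
Hypothesis Pcomplete : measure_is_complete P.

(** In place of Hölder, normalize: with a = |X-Y|/D and b = max(|X|,|Y|)/S, the product a b^(k-1) is
    at most max(a,b)^k, whose q-th power is at most a^(kq) + b^(kq). Bounding the maximum by both
    terms leaves three integrals, each at most 1 after normalization. *)
Lemma integral_zeta_le (k : nat) (E : completeNormedModType R) (q D S : R) (X Y : T -> E) :
  (0 < k)%N -> 0 < q -> 0 < D -> 0 < S ->
  bochner_measurable P X -> bochner_measurable P Y ->
  (\int[P]_w (`|X w - Y w| `^ (k%:R * q))%R%:E <= (D `^ (k%:R * q))%:E)%E ->
  (\int[P]_w (`|X w| `^ (k%:R * q))%R%:E <= (S `^ (k%:R * q))%:E)%E ->
  (\int[P]_w (`|Y w| `^ (k%:R * q))%R%:E <= (S `^ (k%:R * q))%:E)%E ->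
  (\int[P]_w (zeta k (X w, Y w) `^ q)%:E <= (3 * (D * S ^+ k.-1) `^ q)%R%:E)%E.
Proof.
move=> k0 q0 D0 S0 mX mY hD hX hY.
set r := k%:R * q in hD hX hY.
have r0 : 0 <= r by rewrite mulr_ge0// ltW.
pose c := (D * S ^+ k.-1) `^ q.
have c0 : 0 < c by rewrite powR_gt0// mulr_gt0// exprn_gt0.
have pt w : zeta k (X w, Y w) `^ q <=
    c / D `^ r * `|X w - Y w| `^ r + c / S `^ r * `|X w| `^ r + c / S `^ r * `|Y w| `^ r.
  pose a := `|X w - Y w| / D; pose b := Num.max `|X w| `|Y w| / S.
  have a0 : 0 <= a by rewrite divr_ge0// ltW.
  have m0 : 0 <= Num.max `|X w| `|Y w| by rewrite le_max normr_ge0.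
  have b0 : 0 <= b by rewrite divr_ge0// ltW.
  have -> : zeta k (X w, Y w) = D * S ^+ k.-1 * (a * b ^+ k.-1).
    rewrite /zeta /= /a /b expr_div_n.
    by field; rewrite expf_neq0 !gt_eqF.
  have ab0 : 0 <= a * b ^+ k.-1 by rewrite mulr_ge0// exprn_ge0.
  rewrite powRM ?(ltW (mulr_gt0 D0 (exprn_gt0 _ S0)))// -/c.
  have split_max : (Num.max `|X w| `|Y w|) `^ r <= `|X w| `^ r + `|Y w| `^ r.
    by rewrite maxEle; case: ifP => _; rewrite ?lerDl ?lerDr powR_ge0.
  apply: (@le_trans _ _ (c * (a `^ r + b `^ r))); last first.
    have Vr x : 0 < x -> (x^-1) `^ r = (x `^ r)^-1.
      by move=> x0; rewrite powR_inv_base// powRN.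
    rewrite /a /b !powRM ?invr_ge0 ?(ltW D0) ?(ltW S0)// !Vr//.
    rewrite mulrDr -addrA lerD//; first by rewrite [X in _ * X <= _]mulrC mulrA.
    rewrite -mulrDr -mulrA; apply: ler_wpM2l; first exact: ltW.
    by rewrite mulrC ler_wpM2l// invr_ge0 powR_ge0.
  apply: ler_wpM2l; first exact: ltW.
  have pw x : 0 <= x -> (x ^+ k) `^ q = x `^ r by move=> x0; rewrite -powR_mulrn// -powRrM.
  have kE x : x ^+ k = x * x ^+ k.-1 by rewrite -exprS prednK.
  have [ab|ba] := leP a b.
    apply: (@le_trans _ _ (b `^ r)); last by rewrite lerDr powR_ge0.
    rewrite -pw//; apply: ler_powR_base => //; first exact: ltW.
    by rewrite kE ler_wpM2r// exprn_ge0.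
  apply: (@le_trans _ _ (a `^ r)); last by rewrite lerDl powR_ge0.
  rewrite -pw//; apply: ler_powR_base => //; first exact: ltW.
  by rewrite kE ler_wpM2l// lerXn2r ?nnegrE// ltW.
have mP (f : T -> E) (u : R) : bochner_measurable P f ->
    measurable_fun setT (fun w => u * `|f w| `^ r).
  move=> mf; apply: measurable_funM => //.
  exact/measurable_EFinP/(measurable_bochner_powR Pcomplete).
have mXY := bochnerB mX mY.
have int_le (f : T -> E) (s : R) : bochner_measurable P f -> 0 < s ->
    (\int[P]_w (`|f w| `^ r)%:E <= (s `^ r)%:E)%E ->
    (\int[P]_w (c / s `^ r * `|f w| `^ r)%R%:E <= c%:E)%E.
  move=> mf s0 hf; under eq_integral do rewrite EFinM.
  have cs0 : 0 <= c / s `^ r by rewrite divr_ge0 ?powR_ge0// ltW.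
  rewrite (ge0_integralZl_EFin P measurableT _ _ cs0).
  - apply: le_trans (lee_wpmul2l _ hf) _; first by rewrite lee_fin.
    by rewrite -EFinM lee_fin divfK// gt_eqF// powR_gt0.
  - by move=> w _; rewrite lee_fin powR_ge0.
  - exact: (measurable_bochner_powR Pcomplete).
have ge0 (f : T -> E) (s : R) w : 0 < s -> 0 <= c / s `^ r * `|f w| `^ r.
  by move=> s0; rewrite mulr_ge0 ?divr_ge0 ?powR_ge0// ltW.
apply: (@le_trans _ _ (\int[P]_w (c / D `^ r * `|X w - Y w| `^ r + c / S `^ r * `|X w| `^ r
   + c / S `^ r * `|Y w| `^ r)%R%:E)%E).
  apply: ge0_integral_le.
  - exact: measurableT_comp (measurable_powR q) (measurable_zeta Pcomplete k mX mY).
  - apply: measurable_funD; last exact: mP.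
    by apply: measurable_funD; [exact: (mP (fun w => X w - Y w))|exact: mP].
  - by move=> w; rewrite powR_ge0 pt.
under eq_integral do rewrite !EFinD.
rewrite ge0_integralD//; last 4 first.
- by move=> w _; rewrite adde_ge0// lee_fin; [exact: (ge0 (fun w => X w - Y w))|exact: ge0].
- by apply: emeasurable_funD; apply/measurable_EFinP; [exact: (mP (fun w => X w - Y w))|exact: mP].
- by move=> w _; rewrite lee_fin; exact: ge0.
- by apply/measurable_EFinP; exact: mP.
rewrite ge0_integralD//; last 4 first.
- by move=> w _; rewrite lee_fin; exact: (ge0 (fun w => X w - Y w)).
- by apply/measurable_EFinP; exact: (mP (fun w => X w - Y w)).
- by move=> w _; rewrite lee_fin; exact: ge0.
- by apply/measurable_EFinP; exact: mP.
have -> : 3 * (D * S ^+ k.-1) `^ q = c + c + c by rewrite -/c; ring.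
rewrite !EFinD; apply: leeD; [apply: leeD|].
- exact: (int_le (fun w => X w - Y w)).
- exact: int_le.
- exact: int_le.
Qed.

End LevelVariance.

Theorem theorem3p25 (R : realType) (p p' q : R) (k : nat)
    (alpha beta gamma A Calpha Cbeta Cgamma Cstab c1 c2 tau : R)
    (hp1 : 1 < p) (hp2 : p <= 2) (hp' : 2 <= p') (hpp' : p^-1 + p'^-1 = 1)
    (hq : p <= q) (hk : (0 < k)%N)
    (halpha : 0 < alpha) (hbeta : 0 < beta) (hgamma : 0 < gamma)
    (hA : 1 < A) (hCalpha : 0 < Calpha) (hCbeta : 0 < Cbeta)
    (hCgamma : 0 < Cgamma) (hCstab : 0 < Cstab)
    (hc1 : 0 < c1) (hc12 : c1 <= c2) :
  exists C : R, 0 < C /\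
  forall (E : completeNormedModType R),
    rademacher_type E p -> type_constant E p = tau ->
  forall (F : completeNormedModType R) (iota : tensor_functional k E -> F),
    is_injective_tensor_product iota ->
  forall (Fs : completeNormedModType R) (iota_s : tensor_functional k E -> Fs),
    is_sym_injective_tensor_product iota_s ->
  forall (d : measure_display) (T : measurableType d) (P : probability T R),
    measure_is_complete P ->
  forall (X : T -> E) (X_ : nat -> T -> E) (cost : nat -> R) (N : nat -> nat)
         (xi : nat -> nat -> T -> Fs),
    in_Lq P k%:R X ->
    (forall l, (0 < l)%N -> in_Lq P (k%:R * q) (X_ l)) ->
    X_ 0%N = (fun _ => 0) ->
    (forall l, (0 < l)%N -> 0 <= cost l) ->
    (forall l, (0 < l)%N -> (0 < N l)%N) ->
    (forall l, (0 < l)%N ->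
      c1 * A ^+ l <= (N l)%:R /\ (N l)%:R <= c2 * A ^+ l) ->
    (forall l, (0 < l)%N ->
      `|sym_injective_moment P iota iota_s X
        - sym_injective_moment P iota iota_s (X_ l)|
      <= Calpha * (N l)%:R `^ (- alpha)) ->
    (forall l, (0 < l)%N ->
      (Lq_norm P (k%:R * q) (fun w => (X_ l w - X_ l.-1 w)%R)
       <= (Cbeta * (N l)%:R `^ (- beta))%:E)%E) ->
    (forall l, (0 < l)%N -> cost l <= Cgamma * (N l)%:R `^ gamma) ->
    (forall l, (0 < l)%N ->
      (maxe (Lq_norm P k%:R X) (Lq_norm P (k%:R * q) (X_ l)) <= Cstab%:E)%E) ->
    (forall l j, (0 < l)%N -> in_Lq P q (xi l j)) ->
    (forall l, (0 < l)%N ->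
      independent_copies P (level_difference iota_s X_ l) (xi l)) ->
  forall eps : R, 0 < eps -> eps <= 2^-1 ->
  exists (L : nat) (M : nat -> nat),
    [/\ (0 < L)%N,
        (forall l, (0 < l <= L)%N -> (0 < M l)%N),
        (Lq_norm P q
           (fun w => (sym_injective_moment P iota iota_s X
                      - mlmc_estimator L M xi w)%R) < eps%:E)%E
      & mlmc_cost L M cost <= C * mlmc_rate alpha beta gamma A p' eps].
Proof.
have p1 : 1 <= p by exact: ltW.
have q1 : 1 <= q by exact: le_trans hq.
have q0 : 0 < q by exact: lt_le_trans q1.
have A0 : 0 < A by exact: lt_trans hA.
have c20 : 0 < c2 by exact: lt_le_trans hc12.
have kq0 : 0 < k%:R * q by rewrite mulr_gt0// ltr0n.
have t0 : 0 <= `|tau| + 1 by rewrite addr_ge0.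
pose mc := moment_const k p q (`|tau| + 1).
have mc0 : 0 <= mc by exact: moment_const_ge0.
pose K1 := Calpha * c1 `^ (- alpha).
(* 6 = 2 * 3: the 2 of [monte_carlo] and the 3 of [integral_zeta_le]. *)
pose Kb := (6 * mc) `^ q^-1 * (Cstab ^+ k.-1 * (Cbeta * c1 `^ (- beta))).
have Kb0 : 0 <= Kb.
  by rewrite mulr_ge0 ?powR_ge0// mulr_ge0 ?exprn_ge0 ?(ltW hCstab)// mulr_ge0 ?powR_ge0// ltW.
pose K3 := Cgamma * c2 `^ gamma.
have K10 : 0 < K1 by rewrite mulr_gt0// powR_gt0.
(* [mlmc_parameters] asks for a strictly positive constant, while [Kb] is only known to be
   nonnegative. *)
have K20 : 0 < Kb + 1 by rewrite ltr_wpDl.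
have K30 : 0 < K3 by rewrite mulr_gt0// powR_gt0.
have [C [C0 HC]] := mlmc_parameters beta halpha hgamma hA hp' K10 K20 K30.
exists C; split=> // E Etype Etau F iota HF Fs iota_s HFs d T P Pc X X_ cost N xi.
move=> _ X_L X_0 _ N0 NA Ha Hb Hc Hstab xiL xi_copies eps e0 e2.
have [L [M [L0 M0 bias err costs]]] := HC eps e0 e2.
have tb := type_bound_constant Etype Etau.
have AE (x : R) l : (A ^+ l) `^ x = A `^ (x * l%:R).
  by rewrite -powR_mulrn ?(ltW A0)// -powRrM mulrC.
have N_lo (x : R) l : (0 < l)%N -> 0 < x ->
    (N l)%:R `^ (- x) <= c1 `^ (- x) * A `^ (- x * l%:R).
  move=> l0 x0; have [h _] := NA l l0.
  rewrite -AE -powRM ?exprn_ge0 ?(ltW hc1) ?(ltW A0)// !powRN.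
  have cA : 0 < c1 * A ^+ l by rewrite mulr_gt0// exprn_gt0.
  rewrite lef_pV2 ?posrE ?powR_gt0 ?ltr0n ?N0//.
  by apply: ler_powR_base => //; exact: ltW.
have bX l : bochner_measurable P (X_ l).
  by case: l => [|l]; [rewrite X_0; exact: bochner_cst|case: (X_L l.+1)].
have stab l : (\int[P]_w (`|X_ l w| `^ (k%:R * q))%R%:E <= (Cstab `^ (k%:R * q))%:E)%E.
  (* [Hstab] starts at level 1; at level 0 the variable is 0. *)
  case: l => [|l].
    rewrite X_0; under eq_integral do rewrite normr0 powR0 ?gt_eqF//.
    by rewrite integral0 lee_fin powR_ge0.
  apply/Lq_norm_leP => //; first exact: ltW.
  by apply: le_trans (Hstab l.+1 _); rewrite // le_max lexx orbT.
pose mom l := sym_injective_moment P iota iota_s (X_ l).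
have momP l : is_bochner_integral P (fun w => iota_s (tensor_power (X_ l w))) (mom l).
  apply: sym_injective_momentP => //.
  apply: (integral_powR_lty Pc (bX l) _ (_ : k%:R <= k%:R * q)) => //.
    by rewrite ler_peMr.
  by apply: le_lt_trans (stab l) _; exact: ltry.
(* Lets the sum of the moment differences telescope to [mom L] exactly. *)
have mom0 : mom 0%N = 0.
  apply: (is_bochner_integral_unique Pc (momP 0%N)).
  rewrite X_0 (_ : (fun w : T => _) = fun=> 0); first exact: is_bochner_integral0.
  by apply/funext => w; rewrite tensor_power0// (iota_s0 HFs).
have level i : (Lq_norm P q (fun w => (mom i.+1 - mom i -
     (M i.+1)%:R^-1 *: \sum_(j < M i.+1) xi i.+1 j w)%R) <=
     (Kb * A `^ (- beta * i.+1%:R) * (M i.+1)%:R `^ (- p'^-1))%R%:E)%E.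
  have D0 : 0 < Cbeta * (N i.+1)%:R `^ (- beta) by rewrite mulr_gt0// powR_gt0// ltr0n N0.
  have Di : (\int[P]_w (`|X_ i.+1 w - X_ i w| `^ (k%:R * q))%R%:E <=
      ((Cbeta * (N i.+1)%:R `^ (- beta)) `^ (k%:R * q))%:E)%E.
    by apply/(Lq_norm_leP _ (fun w => X_ i.+1 w - X_ i w)) => //; [exact: ltW|exact: Hb].
  have B0 : 0 < 3 * (Cbeta * (N i.+1)%:R `^ (- beta) * Cstab ^+ k.-1) `^ q.
    by rewrite mulr_gt0// powR_gt0// mulr_gt0// exprn_gt0.
  have ZB := integral_zeta_le Pc hk q0 D0 hCstab (bX i.+1) (bX i) Di (stab i.+1) (stab i).
  have := @monte_carlo _ _ _ P Pc k E Fs iota_s hk HFs p q (`|tau| + 1) p1 hp2 hq t0 tb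
    (X_ i.+1) (X_ i) (mom i.+1 - mom i) (xi i.+1) _ (M i.+1) (bX _) (bX _)
    (is_bochner_integralB Pc (momP _) (momP _)) B0 ZB
    (fun j => xiL _ j (ltn0Sn i)) (xi_copies _ (ltn0Sn i)) (M0 _).
  move=> h; apply: le_trans h _; rewrite lee_fin.
  (* Conjugacy of p and p' turns the Monte Carlo rate into the one for which the sample sizes are
     chosen. *)
  have -> : p^-1 - 1 = - p'^-1 by lra.
  apply: ler_wpM2r; first exact: powR_ge0.
  set D := Cbeta * _; rewrite -/mc.
  have DS0 : 0 <= D * Cstab ^+ k.-1 by rewrite mulr_ge0 ?exprn_ge0 ?(ltW D0) ?(ltW hCstab).
  have -> : mc * (2 * (3 * (D * Cstab ^+ k.-1) `^ q)) = 6 * mc * (D * Cstab ^+ k.-1) `^ q by ring.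
  rewrite (powRM _ (mulr_ge0 _ mc0 : 0 <= 6 * mc) (powR_ge0 _ _))// powR_powR_inv ?gt_eqF//.
  rewrite /Kb -mulrA; apply: ler_wpM2l; first exact: powR_ge0.
  rewrite [leLHS]mulrC -mulrA; apply: ler_wpM2l; first by rewrite exprn_ge0 ?(ltW hCstab).
  rewrite /D -mulrA; apply: ler_wpM2l; first exact: ltW.
  exact: N_lo.
exists L, M; split=> //.
  have bxi l j : (0 < l)%N -> bochner_measurable P (xi l j) by move=> l0; case: (xiL l j l0).
  (* The bias at level L plus one centered error per level; the sum runs over i = l - 1. *)
  have fE : (fun w => sym_injective_moment P iota iota_s X - mlmc_estimator L M xi w) =
     (fun w => (sym_injective_moment P iota iota_s X - mom L) + \sum_(0 <= i < L)
       (mom i.+1 - mom i - (M i.+1)%:R^-1 *: \sum_(j < M i.+1) xi i.+1 j w)).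
    apply/funext => w; rewrite sumrB telescope_sumr// mom0 subr0 addrA subrK.
    by rewrite /mlmc_estimator big_add1.
  (* Bias and sampling error are at most eps/4 each, which leaves room for the strict inequality. *)
  rewrite fE; apply: (@le_lt_trans _ _ (eps / 4 + eps / 4)%:E); last by rewrite lte_fin; lra.
  have blev i : bochner_measurable P (fun w => mom i.+1 - mom i -
      (M i.+1)%:R^-1 *: \sum_(j < M i.+1) xi i.+1 j w).
    apply: bochnerB; first exact: bochner_cst.
    by apply: bochnerZ; apply: bochner_sum => j; exact: bxi.
  apply: Lq_norm_leD => //; [exact: bochner_cst|exact: bochner_sum| |].
    apply: le_trans (Lq_norm_cst _ _ q0) _; rewrite lee_fin.
    apply: le_trans bias; apply: le_trans (Ha L L0) _.
    by rewrite /K1 -mulrA ler_wpM2l ?(ltW hCalpha)// N_lo.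
  apply: le_trans (Lq_norm_le_sum Pc _ q1 blev level) _; rewrite lee_fin.
  apply: le_trans err; rewrite [leRHS]big_add1; apply: ler_sum => i _.
  apply: ler_wpM2r; first exact: powR_ge0.
  by apply: ler_wpM2r; [exact: powR_ge0|rewrite lerDl].
apply: le_trans costs; rewrite /mlmc_cost big_nat [leRHS]big_nat.
apply: ler_sum => l /andP[l0 _]; apply: ler_wpM2r => //.
apply: le_trans (Hc l l0) _; rewrite /K3 -mulrA ler_wpM2l ?(ltW hCgamma)//.
have [_ h] := NA l l0; rewrite -AE -powRM ?exprn_ge0 ?(ltW c20) ?(ltW A0)//.
by apply: ler_powR_base => //; exact: ltW.
Qed.
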